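(* Let $N\in\mathbb{Z}_{\ge1}$, $r_n\in\mathbb{Z}$ for $n\mid N$, $\mathbf r=(r_n)_{n\mid N}$, $k'=\frac12\sum_{n\mid N}r_n$, $x_N=\sum_{n\mid N}nr_n$, $\varpi=\prod_{n\mid N}(N/n)^{|r_n|}$, and let $\chi_{\mathbf r}$ be the character of $\prod_{n\mid N}\eta(n\tau)^{r_n}$ on $\widetilde{\Gamma_0(N)}$. Let $f$ be a meromorphic modular form on $\Gamma_0(N)$ of weight $k\in k'+2\mathbb{Z}$ with character $\chi_{\mathbf r}$, and let $l\in L_{\mathbf r}$. Then: (a) there are $Y_0\ge0$ and uniquely determined $c_f(n),c_{T_lf}(n)\in\mathbb{C}$ such that on $\operatorname{Im}\tau>Y_0$ $$f(\tau)=\sum_{n\in\frac{x_N}{24}+\mathbb{Z}}c_f(n)q^n,\qquad T_lf(\tau)=\sum_{n\in\frac{x_N}{24}+\mathbb{Z}}c_{T_lf}(n)q^n,$$ where $T_l=T_{l;\chi_{\mathbf r},\chi_{\mathbf r}}$; (b) for $n\in\frac{x_N}{24}+\mathbb{Z}$, $$c_{T_lf}(n)=l^{-\frac k2}\sum_{\substack{a\mid l,\ d=l/a\\(a,N)=1}}\Big(\frac a\varpi\Big)a^k\,c_f\Big(\frac{ln}{a^2}\Big)\sum_{\substack{0\le b<d\\(a,b,d)=1}}\Big(\frac{-Nb}{(a,d)}\Big)^{2k}e\Big(bd\Big(\frac nl-\frac{x_N}{24}\Big)\Big)\psi_{l,\mathbf r}(a,b),$$ with the convention $c_f(\frac{ln}{a^2})=0$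 if $\frac{ln}{a^2}\notin\frac{x_N}{24}+\mathbb{Z}$, where $\psi_{l,\mathbf r}(a,b)=e\big(-\frac{k+\delta}4(d-1)+\frac{(k+\delta)(l-1)(N-1)}4\big)$ if $2\nmid l$; $=e\big(-\frac{k+\delta}4(a-1)-\frac{N(k+\delta)(1+\delta_1)}4b\big)$ if $2\mid l$, $2\mid N$; $=1$ if $2\mid l$, $2\nmid N$; here $\delta=0$ (resp. $1$) if $\varpi=2^\alpha(4m+1)$ (resp. $2^\alpha(4m+3)$) with $\alpha,m\in\mathbb{Z}_{\ge0}$, and $\delta_1=1$ if $2\mid l$, $4\mid N$, $k\in\frac12+\mathbb{Z}$ and $v_2(\varpi)$ is odd, $\delta_1=0$ otherwise.
   Context: $e(x)=\exp(2\pi ix)$, $q=e(\tau)$, $\eta(\tau)=q^{1/24}\prod(1-q^n)$. $\widetilde{\Gamma_0(N)}$: pairs $(\gamma,\varepsilon(c\tau+d)^{1/2})$, $\gamma=\begin{pmatrix}a&b\\c&d\end{pmatrix}\in\Gamma_0(N)$, $\varepsilon=\pm1$ (principal square root), product $(\gamma_1,\phi_1)(\gamma_2,\phi_2)=(\gamma_1\gamma_2,\phi_1(\gamma_2\tau)\phi_2(\tau))$; $\widetilde\gamma=(\gamma,(c\tau+d)^{1/2})$; $(g|_k(\gamma,\phi))(\tau)=\phi(\tau)^{-2k}g(\gamma\tau)$. $\chi_{\mathbf r}(\gamma,\varepsilon(c\tau+d)^{1/2})=\varepsilon^{-2k'}e\big(\frac1{24}\sum_{n\mid N}r_n\Psi\begin{pmatrix}a&bn\\c/n&d\end{pmatrix}\big)$,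 $\Psi\begin{pmatrix}a&b\\c&d\end{pmatrix}=\frac{a+d}c+12s(-d,c)-3$ ($c>0$), $\frac{a+d}c+12s(d,-c)+3$ ($c<0$), $b$ ($c=0,a>0$), $-b-6$ ($c=0,a<0$), $s(h,c)=\sum_{r\bmod c}((r/c))((hr/c))$, $((x))=x-\lfloor x\rfloor-\frac12$ ($x\notin\mathbb{Z}$), else $0$. Meromorphic modular form of weight $k$ with character $\chi$: meromorphic $g$ on $\mathbb{H}$ with $g|_k\gamma=\chi(\gamma)g$ for $\gamma\in\widetilde{\Gamma_0(N)}$ and, for all $\gamma\in\mathrm{SL}_2(\mathbb{Z})$, $g|_k\widetilde\gamma=\sum_{n\in\frac1h\mathbb{Z}}c_nq^n$ for $\operatorname{Im}\tau$ large with finitely many $n<0$ having $c_n\ne0$. $m_{\mathbf r}=24/\gcd(24,\sum_n(N/n)r_n,\sum_n nr_n)$; $L_{\mathbf r}=\{l\ge1:l\equiv1\bmod m_{\mathbf r}\}$ if $k'\in\mathbb{Z}$, and additionally $l$ a perfect square if $k'\in\frac12+\mathbb{Z}$. $T_{l;\chi,\chi}g(\tau)=l^{-k/2}\sum_{a\mid l,(N,a)=1}a^k\sum_{0\le b<d,(a,b,d)=1}\chi(\widetilde{\begin{pmatrix}-Nb+ax&z\\-Nd&y\end{pmatrix}})^{-1}\chi(\widetilde{\begin{pmatrix}ay&by-dz\\N&x\end{pmatrix}})^{-1}g(\frac{a\tau+b}d)$, $d=l/a$, with integers $x,y,z$ satisfying $(-Nb+ax)y+Ndz=1$ (independent of the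 choice for such $l$). $(\frac mn)$ is the Kronecker–Jacobi symbol, with $(\frac m0)=0$ for $m\ne\pm1$ and $(\frac{\pm1}0)=1$; $(a,d)=\gcd(a,d)$; $v_2$ is the 2-adic valuation. *)

(* Defs.v *)
From Stdlib Require Import Reals ZArith ClassicalEpsilon.
From Coquelicot Require Import Coquelicot.
From mathcomp Require Import ssreflect ssrbool ssrfun eqtype ssrnat seq div prime fintype.

Set Implicit Arguments.
Unset Strict Implicit.

Definition sumR (s : seq nat) (F : nat -> R) : R := foldr (fun n acc => (F n + acc)%R) 0%R s.
Definition sumC (s : seq nat) (F : nat -> C) : C := foldr (fun n acc => (F n + acc)%C) (RtoC 0) s.
Definition sumZ (s : seq nat) (F : nat -> Z) : Z := foldr (fun n acc => (F n + acc)%Z) 0%Z s.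
Definition prodN (s : seq nat) (F : nat -> nat) : nat := foldr (fun n acc => (F n * acc)%N) 1%N s.

Definition cexp (z : C) : C := (exp (Re z) * cos (Im z), exp (Re z) * sin (Im z))%R.
Definition e (z : C) : C := cexp (RtoC (2 * PI) * Ci * z)%C.
Definition eR (x : R) : C := e (RtoC x).
(* principal square root (argument in (-pi/2, pi/2]) *)
Definition Csqrt (w : C) : C :=
  (sqrt ((Cmod w + Re w) / 2),
   (if Rlt_dec (Im w) 0 then (-1)%R else 1%R) * sqrt ((Cmod w - Re w) / 2))%R.
Definition Cpowz (w : C) (n : Z) : C :=
  match n with
  | Z0 => RtoC 1
  | Zpos p => Cpow w (Pos.to_nat p)
  | Zneg p => Cinv (Cpow w (Pos.to_nat p))
  end.

Definition inH (tau : C) : Prop := (0 < Im tau)%R.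
Definition mob (a b c d : Z) (tau : C) : C :=
  ((RtoC (IZR a) * tau + RtoC (IZR b)) / (RtoC (IZR c) * tau + RtoC (IZR d)))%C.
(* weight k = K/2 ; (g |_k (gamma, eps (c tau + d)^(1/2)))(tau) *)
Definition slash (K : Z) (a b c d eps : Z) (g : C -> C) (tau : C) : C :=
  (Cpowz (RtoC (IZR eps) * Csqrt (RtoC (IZR c) * tau + RtoC (IZR d))) (- K) * g (mob a b c d tau))%C.

Definition SL2Z (a b c d : Z) : Prop := (a * d - b * c = 1)%Z.
Definition Gamma0 (N : nat) (a b c d : Z) : Prop := SL2Z a b c d /\ (Z.of_nat N | c)%Z.

Definition saw (p q : Z) : R :=
  if (p mod q =? 0)%Z then 0%R else (IZR (p mod q) / IZR q - 1 / 2)%R.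
Definition dedekind_s (h c : Z) : R :=
  sumR (iota 0 (Z.to_nat c))
       (fun r => saw (Z.of_nat r) c * saw (h * Z.of_nat r) c)%R.
Definition Psi (a b c d : Z) : R :=
  if (0 <? c)%Z then (IZR (a + d) / IZR c + 12 * dedekind_s (- d) c - 3)%R
  else if (c <? 0)%Z then (IZR (a + d) / IZR c + 12 * dedekind_s d (- c) + 3)%R
  else if (0 <? a)%Z then IZR b else (- IZR b - 6)%R.

(* sum_{n | N} r_n  (= 2 k') *)
Definition sumr (N : nat) (r : nat -> Z) : Z := sumZ (divisors N) r.
Definition xN (N : nat) (r : nat -> Z) : Z := sumZ (divisors N) (fun n => Z.of_nat n * r n)%Z.
Definition varpi (N : nat) (r : nat -> Z) : nat :=
  prodN (divisors N) (fun n => ((N %/ n) ^ Z.abs_nat (r n))%N).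

(* chi_r(gamma, eps (c tau + d)^(1/2)) = eps^(-2k')
      e( 1/24 sum_{n|N} r_n Psi(a, b n; c/n, d) ) *)
Definition chi (N : nat) (r : nat -> Z) (a b c d eps : Z) : C :=
  (Cpowz (RtoC (IZR eps)) (- sumr N r) *
   eR (/ 24 * sumR (divisors N)
          (fun n => IZR (r n) * Psi a (b * Z.of_nat n) (c / Z.of_nat n) d))%R)%C.

Definition discrete_in_H (P : C -> Prop) : Prop :=
  (forall p, P p -> inH p) /\
  (forall tau, inH tau -> exists eps : R, (0 < eps)%R /\
     forall p, P p -> p <> tau -> (eps <= Cmod (p - tau))%R).
(* g is meromorphic on H with (possible) pole set P; values of g on P are irrelevant *)
Definition meromorphic_H (g : C -> C) (P : C -> Prop) : Prop :=
  discrete_in_H P /\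
  (forall tau, inH tau -> ~ P tau -> ex_derive g tau) /\
  (forall p, P p -> exists (m : nat) (h : C -> C) (eps : R), (0 < eps)%R /\
     (forall w, (Cmod (w - p) < eps)%R -> ex_derive h w) /\
     (forall w, (0 < Cmod (w - p) < eps)%R -> h w = (Cpow (w - p) m * g w)%C)).

Definition cusp_expansion (G : C -> C) : Prop :=
  exists (h : nat) (c : Z -> C) (M : Z) (Y : R), (0 < h)%nat /\
    (forall j, (j < - M)%Z -> c j = RtoC 0) /\
    forall tau, (Y < Im tau)%R ->
      is_series (fun i : nat => (c (Z.of_nat i - M)%Z *
                   e (RtoC (IZR (Z.of_nat i - M) / INR h) * tau))%C) (G tau).

Definition merom_modform (N : nat) (r : nat -> Z) (K : Z) (f : C -> C) : Prop :=
  exists P : C -> Prop, meromorphic_H f P /\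
  (forall a b c d eps, Gamma0 N a b c d -> (eps = 1 \/ eps = -1)%Z ->
     forall tau, inH tau -> ~ P tau -> ~ P (mob a b c d tau) ->
       slash K a b c d eps f tau = (chi N r a b c d eps * f tau)%C) /\
  (forall a b c d, SL2Z a b c d -> cusp_expansion (slash K a b c d 1 f)).

Definition m_r (N : nat) (r : nat -> Z) : Z :=
  (24 / Z.gcd 24 (Z.gcd (sumZ (divisors N) (fun n => Z.of_nat (N %/ n) * r n)%Z)
                        (xN N r)))%Z.
Definition in_Lr (N : nat) (r : nat -> Z) (l : nat) : Prop :=
  (1 <= l)%N /\ ((Z.of_nat l - 1) mod m_r N r = 0)%Z /\
  (Z.odd (sumr N r) = true -> exists s : nat, l = (s * s)%N).

(* integers x, y, z with (-Nb + a x) y + N d z = 1 (chosen; independent of choice) *)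
Definition xyz (N a b d : Z) : Z * Z * Z :=
  epsilon (inhabits (0%Z, 0%Z, 0%Z))
    (fun t => let '(x, y, z) := t in ((- N * b + a * x) * y + N * d * z = 1)%Z).

Definition hecke (N : nat) (r : nat -> Z) (K : Z) (l : nat) (g : C -> C) (tau : C) : C :=
  let k := (IZR K / 2)%R in
  let NZ := Z.of_nat N in
  (RtoC (Rpower (INR l) (- k / 2)) *
   sumC [seq a <- divisors l | coprime a N]
     (fun a => let d := l %/ a in
        let aZ := Z.of_nat a in let dZ := Z.of_nat d in
        RtoC (Rpower (INR a) k) *
        sumC [seq b <- iota 0 d | gcdn (gcdn a b) d == 1%N]
          (fun b => let bZ := Z.of_nat b in
             let '(x, y, z) := xyz NZ aZ bZ dZ in
             Cinv (chi N r (- NZ * bZ + aZ * x)%Z z (- NZ * dZ)%Z y 1%Z) *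
             Cinv (chi N r (aZ * y)%Z (bZ * y - dZ * z)%Z NZ x 1%Z) *
             g ((RtoC (IZR aZ) * tau + RtoC (IZR bZ)) / RtoC (IZR dZ)))))%C.

(* ---------- q-expansions indexed by n = x_N/24 + m, m in Z ---------- *)
Definition qexp (N : nat) (r : nat -> Z) (g : C -> C) (c : Z -> C) (Y : R) : Prop :=
  exists M : Z, (forall j, (j < - M)%Z -> c j = RtoC 0) /\
    forall tau, (Y < Im tau)%R ->
      is_series (fun i : nat => (c (Z.of_nat i - M)%Z *
                   e (RtoC (IZR (xN N r) / 24 + IZR (Z.of_nat i - M)) * tau))%C) (g tau).

Definition kron_p (m : Z) (p : nat) : Z :=
  if p == 2%N then
    (if Z.even m then 0%Z
     else if ((m mod 8 =? 1) || (m mod 8 =? 7))%Z then 1%Z else (-1)%Z)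
  else if (m mod Z.of_nat p =? 0)%Z then 0%Z
  else if [exists x : 'I_p, ((x * x) %% p)%N == Z.to_nat (m mod Z.of_nat p)] then 1%Z
  else (-1)%Z.
Definition kron (m : Z) (n : nat) : Z :=
  if n == 0%N then (if ((m =? 1) || (m =? -1))%Z then 1%Z else 0%Z)
  else foldr (fun p acc => (kron_p m p ^ Z.of_nat (logn p n) * acc)%Z) 1%Z (primes n).

Definition delta (N : nat) (r : nat -> Z) : R :=
  let w := varpi N r in
  if ((w %/ 2 ^ logn 2 w) %% 4 == 3)%N then 1%R else 0%R.
Definition delta1 (N : nat) (r : nat -> Z) (K : Z) (l : nat) : R :=
  if [&& ~~ odd l, (4 %| N)%N, Z.odd K & odd (logn 2 (varpi N r))] then 1%R else 0%R.
Definition psi (N : nat) (r : nat -> Z) (K : Z) (l a b : nat) : C :=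
  let k := (IZR K / 2)%R in
  let dl := delta N r in
  let d := l %/ a in
  if odd l then
    eR (- (k + dl) / 4 * (INR d - 1) + (k + dl) * (INR l - 1) * (INR N - 1) / 4)%R
  else if ~~ odd N then
    eR (- (k + dl) / 4 * (INR a - 1)
        - INR N * (k + dl) * (1 + delta1 N r K l) / 4 * INR b)%R
  else RtoC 1.

(* c_f(l n / a^2) with n = x_N/24 + m, zero if l n/a^2 not in x_N/24 + Z *)
Definition cf_at (N : nat) (r : nat -> Z) (cf : Z -> C) (l a : nat) (m : Z) : C :=
  let x := xN N r in
  let num := (Z.of_nat l * (x + 24 * m) - Z.of_nat a ^ 2 * x)%Z in
  let den := (24 * Z.of_nat a ^ 2)%Z in
  if (num mod den =? 0)%Z then cf (num / den)%Z else RtoC 0.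

Definition hecke_coeff (N : nat) (r : nat -> Z) (K : Z) (l : nat) (cf : Z -> C) (m : Z) : C :=
  let k := (IZR K / 2)%R in
  let NZ := Z.of_nat N in
  let nR := (IZR (xN N r) / 24 + IZR m)%R in
  (RtoC (Rpower (INR l) (- k / 2)) *
   sumC [seq a <- divisors l | coprime a N]
     (fun a => let d := l %/ a in
        RtoC (IZR (kron (Z.of_nat a) (varpi N r))) * RtoC (Rpower (INR a) k) *
        cf_at N r cf l a m *
        sumC [seq b <- iota 0 d | gcdn (gcdn a b) d == 1%N]
          (fun b =>
             RtoC (powerRZ (IZR (kron (- NZ * Z.of_nat b)%Z (gcdn a d))) K) *
             eR (INR b * INR d * (nR / INR l - IZR (xN N r) / 24)) *
             psi N r K l a b)))%C.

(* Main.v *)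
Require Import Defs.

(** Each coefficient of T_l is a product of two values of the eta multiplier.
    Dedekind reciprocity and Gauss's lemma express Psi modulo 24 through Kronecker
    symbols, and summing over n | N reduces the product of the two values to
    congruences modulo 3 and 8 between the moments of r; the condition l in L_r is
    what makes them hold.  The q-expansion of f comes from the expansion at the
    cusp infinity, where invariance under translation forces the exponents into
    x_N/24 + Z, and coefficients are unique because a power series vanishing along
    a sequence tending to 0 is zero.  In T_l f the contribution of a fixed divisor a
    is a Gauss-type sum over b; shifting b by gcd(a,d) shows that it vanishes
    unless the resulting exponent lies again in x_N/24 + Z. *)

(** * Dedekind sums as integers and their reciprocity law *)

Module DedekindSums.

From Stdlib Require Import ZArith Lia.
From mathcomp Require Import all_boot.
From mathcomp Require Import zify.
Set Implicit Arguments. Unset Strict Implicit. Unset Printing Implicit Defensive.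

(** Modulo 3 no symbol appears. Modulo 8 a symbol enters as 4 times its sign bit, so products of
    symbols become sums of bits modulo 2; the bits of (a/(N/n)) weighted by r_n add up to the bit of
    (a/varpi), because r_n and |r_n| have the same parity. With R the sum of the r_n, X = x_N and S
    the sum of the (N/n) r_n, the rest is an expression in a, b, d, x, y, z whose vanishing has two
    sources. First, m_r divides l-1, so 24 divides (l-1)X and (l-1)S. Second, n * (N/n) = N forces
    congruences between R, X, S, delta and v_2(varpi) that change with v_2(N); they explain the
    cases of psi and the correction delta_1. For odd R a symbol modulo d survives; there l = a d is
    a square, hence a and d are their gcd times squares and the symbol descends to gcd(a,d). Gauss's
    lemma evaluates Dedekind sums for prime moduli only; composite moduli need quadratic
    reciprocity, which is drawn from Dedekind reciprocity within the same induction. *)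

Lemma sum_ord_id n : 2 * (\sum_(r < n) r) + n = n * n.
Proof.
elim: n => [|n]; first by rewrite big_ord0.
by rewrite big_ord_recr /=; move: (\sum_(r < n) _) => s; lia.
Qed.

Lemma sum_ord_sqr n : 6 * (\sum_(r < n) r * r) + 3 * (n * n) = 2 * (n * n * n) + n.
Proof.
elim: n => [|n]; first by rewrite big_ord0.
by rewrite big_ord_recr /=; move: (\sum_(r < n) _) => s; lia.
Qed.

Lemma sum_mulmod (h k : nat) (F : nat -> nat) : 0 < k -> coprime h k ->
  \sum_(r < k) F (h * r %% k) = \sum_(r < k) F r.
Proof.
move=> k0 chk.
pose s (r : 'I_k) := Ordinal (ltn_pmod (h * r) k0).
have inj : injective s.
  move=> r1 r2 /(congr1 val) /= /eqP.
  wlog le12 : r1 r2 / r1 <= r2.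
    by move=> H E; case/orP: (leq_total r1 r2) => L; [exact: H | symmetry; apply: H => //; rewrite eq_sym].
  rewrite eq_sym eqn_mod_dvd ?leq_mul // -mulnBr Gauss_dvdr; last by rewrite coprime_sym.
  move=> D; apply: val_inj => /=.
  case: (posnP (r2 - r1)) => [|P]; first lia.
  by have := dvdn_leq P D; have := ltn_ord r2; lia.
by rewrite [RHS](reindex_inj inj).
Qed.

Definition floorsum (h k : nat) : nat := \sum_(r < k) r * (h * r %/ k).

Section FloorReciprocity.
Variables h k : nat.
Hypotheses (h0 : 0 < h) (k0 : 0 < k) (chk : coprime h k).

Lemma sum_floor : h * (\sum_(r < k) r) = k * (\sum_(r < k) (h * r %/ k)) + \sum_(r < k) r.
Proof.
rewrite -{2}(sum_mulmod (fun x => x) k0 chk) !big_distrr -big_split /=.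
by apply: eq_bigr => r _; rewrite {1}(divn_eq (h * r) k) mulnC.
Qed.

(** Squares [h r - k floor(h r / k) = h r mod k] and sums over [r]; multiplication by [h] permutes
    the residues modulo [k]. *)
Lemma sum_floor_sqr :
  h * h * (\sum_(r < k) r * r) + k * k * (\sum_(r < k) (h * r %/ k) * (h * r %/ k))
  = 2 * (h * k) * floorsum h k + \sum_(r < k) r * r.
Proof.
rewrite -{2}(sum_mulmod (fun x => x * x) k0 chk) /floorsum !big_distrr -!big_split /=.
apply: eq_bigr => r _.
by have := divn_eq (h * r) k; nia.
Qed.

Lemma count_gt c m : c < m -> \sum_(r < m) (c < r) = m - 1 - c.
Proof.
elim: m => [//|m IH] cm; rewrite big_ord_recr /=.
case: (ltngtP c m) => [L|L|->]; [by rewrite IH //; lia | lia |].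
rewrite big1; first lia.
by move=> i _; have := ltn_ord i; case: ltnP => //; lia.
Qed.

Lemma triangle_le q : q < h -> 2 * (\sum_(v < h) v * (v <= q)) = q * q.+1.
Proof.
elim: h q => [//|m IH] q; rewrite big_ord_recr /= ltnS leq_eqVlt => /orP[/eqP->|L].
  rewrite leqnn muln1.
  under eq_bigr => i _ do rewrite (ltnW (ltn_ord i)) muln1.
  by have := sum_ord_id m; move: (\sum_(r < m) _) => s; nia.
by rewrite mulnDr IH // leqNgt L muln0 addn0.
Qed.

(** The lattice points under the line of slope [h / k], weighted by their height [v], are counted by
    columns and by rows. Coprimality keeps interior lattice points off the line, so row [v > 0] has
    exactly [k - 1 - floor(k v / h)] points. *)
Lemma sum_floor_lattice :
  \sum_(r < k) (h * r %/ k) * (h * r %/ k).+1 + 2 * floorsum k h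
  = 2 * (k.-1 * \sum_(v < h) v).
Proof.
have -> : \sum_(r < k) (h * r %/ k) * (h * r %/ k).+1
        = 2 * \sum_(v < h) \sum_(r < k) v * (v <= h * r %/ k).
  rewrite exchange_big /= big_distrr /=; apply: eq_bigr => r _.
  by rewrite triangle_le // ltn_divLR // ltn_pmul2l.
rewrite -mulnDr; congr (_ * _); rewrite /floorsum -big_split big_distrr /=.
apply: eq_bigr => v _.
rewrite -big_distrr /= -mulnDr mulnC.
case: (posnP v) => [->|v0]; first by rewrite !muln0.
congr (_ * _).
have vh := ltn_ord v.
have nd : forall r, (v <= h * r %/ k) = (k * v %/ h < r).
  move=> r; rewrite leq_divRL // ltn_divLR //.
  have : v * k != r * h.
    apply/eqP => E.
    have : h %| v * k by rewrite E dvdn_mull.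
    by rewrite Gauss_dvdl // => /(dvdn_leq v0); lia.
  by lia.
under eq_bigr => r _ do rewrite nd.
have L : k * v %/ h < k by rewrite ltn_divLR // ltn_pmul2l.
rewrite count_gt //; lia.
Qed.

Lemma floorsum_reciprocity : (12 * Z.of_nat h * Z.of_nat (floorsum h k)
   + 12 * Z.of_nat k * Z.of_nat (floorsum k h)
   = (Z.of_nat h - 1) * (Z.of_nat k - 1) * (8 * Z.of_nat h * Z.of_nat k - Z.of_nat h - Z.of_nat k - 1))%Z.
Proof.
have A1 := sum_floor; have A2 := sum_floor_sqr; have A3 := sum_floor_lattice.
have B1 := sum_ord_id k; have B2 := sum_ord_sqr k; have B3 := sum_ord_id h.
have E : \sum_(r < k) (h * r %/ k) * (h * r %/ k).+1 =
  \sum_(r < k) (h * r %/ k) * (h * r %/ k) + \sum_(r < k) (h * r %/ k).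
  by rewrite -big_split /=; apply: eq_bigr => r _; rewrite mulnS addnC.
rewrite E in A3; clear E.
move: A1 A2 A3 B1 B2 B3.
set q1 := \sum_(r < k) (h * r %/ k).
set q2 := \sum_(r < k) (h * r %/ k) * (h * r %/ k).
set s1 := \sum_(r < k) r; set s2 := \sum_(r < k) r * r; set t1 := \sum_(v < h) v.
set f := floorsum h k; set g := floorsum k h.
move=> A1 A2 A3 B1 B2 B3.
have {A3} : (q2 + q1 + 2 * g + 2 * t1 = 2 * (k * t1)).
  by rewrite A3 -mulnDr; congr (_ * _); rewrite -mulSnr prednK.
clearbody q1 q2 s1 s2 t1 f g => A3.
have {}A1 : (Z.of_nat h * Z.of_nat s1 = Z.of_nat k * Z.of_nat q1 + Z.of_nat s1)%Z by lia.
have {}A2 : (Z.of_nat h * Z.of_nat h * Z.of_nat s2 + Z.of_nat k * Z.of_nat k * Z.of_nat q2 = 2 * Z.of_nat h * Z.of_nat k * Z.of_nat f + Z.of_nat s2)%Z by lia.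
have {}A3 : (Z.of_nat q2 + Z.of_nat q1 + 2 * Z.of_nat g + 2 * Z.of_nat t1 = 2 * Z.of_nat k * Z.of_nat t1)%Z by lia.
have {}B1 : (2 * Z.of_nat s1 = Z.of_nat k * Z.of_nat k - Z.of_nat k)%Z by lia.
have {}B2 : (6 * Z.of_nat s2 = 2 * (Z.of_nat k * Z.of_nat k * Z.of_nat k) + Z.of_nat k - 3 * (Z.of_nat k * Z.of_nat k))%Z by lia.
have {}B3 : (2 * Z.of_nat t1 = Z.of_nat h * Z.of_nat h - Z.of_nat h)%Z by lia.
have kp : (Z.of_nat k <> 0)%Z by lia.
move: A1 A2 A3 B1 B2 B3 kp.
move: (Z.of_nat h) (Z.of_nat k) (Z.of_nat q1) (Z.of_nat q2) (Z.of_nat s1) (Z.of_nat s2) (Z.of_nat t1) (Z.of_nat f) (Z.of_nat g) => H k' q1' q2' s1' s2' t1' f' g' A1 A2 A3 B1 B2 B3 kp.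
(* The sum of the floors is known only multiplied by [k], so the identity is proved after
   multiplication by [k]. *)
apply: (Z.mul_reg_l _ _ k') => //.
have A1' : (2 * (k' * q1') = (H - 1) * (k' * k' - k'))%Z by rewrite -B1; lia.
have -> : (k' * (12 * H * f' + 12 * k' * g') = 6 * (2 * H * k' * f') + 6 * k' * k' * (2 * g'))%Z by ring.
have -> : (2 * H * k' * f' = H * H * s2' + k' * k' * q2' - s2')%Z by lia.
have -> : (2 * g' = 2 * k' * t1' - q2' - q1' - 2 * t1')%Z by lia.
have -> : (6 * (H * H * s2' + k' * k' * q2' - s2') + 6 * k' * k' * (2 * k' * t1' - q2' - q1' - 2 * t1') = (H*H-1) * (6 * s2') - 3 * k' * (2 * (k' * q1')) + 6 * k' * k' * (k' - 1) * (2 * t1'))%Z by ring.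
rewrite B2 A1' B3; ring.
Qed.
End FloorReciprocity.

(** This is 12 k s(h, k) with the sawtooth written through floors, so that it is visibly an integer;
    all the arithmetic sits in [floorsum]. *)
Definition dedS (h k : nat) : Z :=
  (2 * Z.of_nat h * (Z.of_nat k - 1) * (2 * Z.of_nat k - 1)
   - 12 * Z.of_nat (floorsum h k) - 3 * Z.of_nat k * (Z.of_nat k - 1))%Z.

Lemma dedS_reciprocity h k : 0 < h -> 0 < k -> coprime h k ->
  (Z.of_nat h * dedS h k + Z.of_nat k * dedS k h =
   Z.of_nat h * Z.of_nat h + Z.of_nat k * Z.of_nat k + 1 - 3 * Z.of_nat h * Z.of_nat k)%Z.
Proof.
move=> h0 k0 c; have := floorsum_reciprocity h0 k0 c; rewrite /dedS => E.
nia.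
Qed.

(** In this form [h] occurs only through [h r mod k], which yields periodicity and oddness in
    [h]. *)
Lemma dedS_modsum h k : 0 < k ->
  (Z.of_nat k * dedS h k = 12 * Z.of_nat (\sum_(r < k) r * (h * r %% k))
    - 3 * Z.of_nat k * Z.of_nat k * (Z.of_nat k - 1))%Z.
Proof.
move=> k0.
have E : (\sum_(r < k) r * (h * r %% k) + k * floorsum h k = h * \sum_(r < k) r * r).
  rewrite /floorsum !big_distrr -big_split /=; apply: eq_bigr => r _.
  by have := divn_eq (h * r) k; nia.
have B2 := sum_ord_sqr k; rewrite /dedS.
move: E B2; set s := \sum_(r < k) r * r; set t := \sum_(r < k) _; set f := floorsum h k.
clearbody s t f => E B2.
have {}E : (Z.of_nat t = Z.of_nat h * Z.of_nat s - Z.of_nat k * Z.of_nat f)%Z by lia.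
have {}B2 : (6 * Z.of_nat s = 2 * (Z.of_nat k * Z.of_nat k * Z.of_nat k) + Z.of_nat k - 3 * (Z.of_nat k * Z.of_nat k))%Z by lia.
rewrite E; have -> : (12 * (Z.of_nat h * Z.of_nat s - Z.of_nat k * Z.of_nat f) = 2 * Z.of_nat h * (6 * Z.of_nat s) - 12 * Z.of_nat k * Z.of_nat f)%Z by ring.
rewrite B2; ring.
Qed.

Lemma dedS_mod h k : 0 < k -> dedS (h %% k) k = dedS h k.
Proof.
move=> k0; apply: (Z.mul_reg_l _ _ (Z.of_nat k)); first lia.
rewrite !dedS_modsum //.
by under eq_bigr => r _ do rewrite modnMml.
Qed.

Lemma dedS_opp h h' k : 0 < k -> coprime h k -> k %| h + h' -> dedS h' k = (- dedS h k)%Z.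
Proof.
move=> k0 chk D; apply: (Z.mul_reg_l _ _ (Z.of_nat k)); first lia.
rewrite Z.mul_opp_r !dedS_modsum //.
have E : \sum_(r < k) r * (h' * r %% k) + \sum_(r < k) r * (h * r %% k) = k * \sum_(r < k) r.
  rewrite -big_split big_distrr /=; apply: eq_bigr => r _.
  case: (posnP r) => [->|r0]; first by rewrite !muln0.
  rewrite -mulnDr mulnC; congr (_ * _).
  have D2 : k %| (h' * r %% k + h * r %% k).
    by rewrite /dvdn modnDm -mulnDl addnC -/(dvdn _ _) dvdn_mulr.
  have P : 0 < h * r %% k.
    rewrite lt0n -/(dvdn k (h * r)); apply/negP; rewrite Gauss_dvdr; last by rewrite coprime_sym.
    by move/(dvdn_leq r0); have := ltn_ord r; lia.
  have L1 := ltn_pmod (h * r) k0; have L2 := ltn_pmod (h' * r) k0.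
  (* The two residues add up to a positive multiple of [k] below [2 k], hence to [k]. *)
  case/dvdnP: D2 => [[|[|q]]] Eq; nia.
have B := sum_ord_id k.
move: E B; set s := \sum_(r < k) r; move: (\sum_(r < k) _) (\sum_(r < k) _) s => u v s E B.
have : (2 * Z.of_nat u + 2 * Z.of_nat v = Z.of_nat k * (Z.of_nat k * Z.of_nat k - Z.of_nat k))%Z by nia.
nia.
Qed.

End DedekindSums.

(** * Euler's criterion, Gauss's lemma and Dedekind sums of prime modulus *)

Module GaussLemma.

Require Import Defs.
Import DedekindSums.
From Stdlib Require Import ZArith Lia.
From mathcomp Require Import all_boot ssralg finalg zmodp fingroup cyclic finfield.
From mathcomp Require Import zify.
Set Implicit Arguments. Unset Strict Implicit. Unset Printing Implicit Defensive.

Lemma modn_Z m d : 0 < d -> (Z.of_nat m mod Z.of_nat d = Z.of_nat (m %% d))%Z.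
Proof.
move=> d0; symmetry; apply: (Z.mod_unique_pos _ _ (Z.of_nat (m %/ d))).
  by have := ltn_pmod m d0; lia.
by have := divn_eq m d; lia.
Qed.

Section PrimeField.
Import GRing.Theory.
Local Open Scope ring_scope.
Variables (p m : nat).
Hypotheses (pp : prime p) (pm : p = m.*2.+1).

Lemma card_F : #|'F_p| = m.*2.+1.
Proof. by rewrite card_Fp. Qed.

Lemma Fp_expm (u : 'F_p) : u != 0 -> u ^+ m.*2 = 1.
Proof.
move=> u0; apply: (mulfI u0); rewrite mulr1 -exprS -card_F.
by rewrite expf_card.
Qed.

(** The unit group is cyclic of order [2 m]: for [u = g ^ i], the equation [u ^ m = 1] says that
    [2 m] divides [i m], so [i] is even. *)
Lemma euler_sqr (u : 'F_p) : u != 0 -> ((u ^+ m == 1) = [exists y : 'F_p, y ^+ 2 == u]).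
Proof.
move=> u0; apply/eqP/existsP => [E|[y /eqP yu]]; last first.
  have y0 : y != 0 by apply: contraNneq u0 => y0; rewrite -yu y0 expr0n.
  by rewrite -yu -exprM mul2n Fp_expm.
have /cyclicP[g Eg] := field_unit_group_cyclic [set: {unit 'F_p}]%G.
have uu : u \is a GRing.unit by rewrite unitfE.
have : FinRing.unit 'F_p uu \in <[g]>%g by rewrite -Eg inE.
case/cycleP => i Ei.
have val_pow : forall (v : {unit 'F_p}) n, val (v ^+ n)%g = (val v) ^+ n.
  by move=> v n; rewrite FinRing.val_unitX.
have Eu : u = val g ^+ i by rewrite -val_pow -Ei.
have og : #[g]%g = m.*2.
  have := card_finField_unit 'F_p; rewrite card_F /= => <-.
  by rewrite -[LHS]/(#|<[g]>%g|) -Eg.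
have D : (m.*2 %| i * m)%N.
  rewrite -og order_dvdn; apply/eqP; apply: val_inj.
  by rewrite val_pow exprM -Eu E.
have m0 : (0 < m)%N by move: (prime_gt1 pp); rewrite pm; case: (m).
have ei : (2 %| i)%N by move: D; rewrite -muln2 mulnC dvdn_pmul2r.
exists (val g ^+ (i %/ 2)); by rewrite -exprM divnK // Eu.
Qed.

Lemma euler_pm (u : 'F_p) : u != 0 -> u ^+ m = (-1) ^+ ~~ [exists y : 'F_p, y ^+ 2 == u].
Proof.
move=> u0; rewrite -euler_sqr //; case: eqP => [->//|/eqP ne] /=.
have : (u ^+ m) ^+ 2 == 1 by rewrite -exprM muln2 Fp_expm.
by rewrite sqrf_eq1 (negPf ne) /= => /eqP.
Qed.

Lemma natF_eq0 n : (n%:R == 0 :> 'F_p) = (p %| n)%N.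
Proof. by rewrite (dvdn_pcharf (pchar_Fp pp)). Qed.

Lemma existsF (h : nat) : [exists x : 'I_p, ((x * x) %% p)%N == (h %% p)%N] = [exists y : 'F_p, y ^+ 2 == h%:R].
Proof.
have nat_eq (x y : nat) : (x%:R == y%:R :> 'F_p) = (x == y %[mod p]).
  apply/eqP/eqP => [/(congr1 (@nat_of_ord _))|E]; first by rewrite !val_Fp_nat.
  by apply: val_inj; rewrite /= !val_Fp_nat.
apply/existsP/existsP => [[x xP]|[y yP]].
  by exists x%:R; rewrite -natrX nat_eq.
have yp : (y < p)%N by have := ltn_ord y; rewrite [X in (_ < X)%N -> _](Fp_cast pp).
exists (Ordinal yp); rewrite /=.
by rewrite -nat_eq natrM -[X in X * _]/((y : nat)%:R) natr_Zp -expr2.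
Qed.

Section Gauss.
Variable h : nat.
Hypothesis ph : ~~ (p %| h)%N.
(** Gauss's lemma is run over the odd representatives 1, 3, ..., p - 2 instead of the lower half:
    the parity of [floorsum] sees only odd [r], so the sign count can be read off from it
    directly. *)
Let rho (j : nat) := (h * j.*2.+1 %% p)%N.

Lemma rho_gt0 j : (j < m)%N -> (0 < rho j)%N.
Proof.
move=> jm; rewrite lt0n -/(dvdn _ _) Euclid_dvdM // negb_or ph /=.
by apply/negP => /dvdn_leq; rewrite pm; lia.
Qed.

Lemma rho_lt j : (rho j < p)%N.
Proof. by rewrite ltn_pmod // prime_gt0. Qed.

Lemma sig_lt (j : 'I_m) : ((if odd (rho j) then rho j else p - rho j)%N./2 < m)%N.
Proof.
have := rho_gt0 (ltn_ord j); have := rho_lt j; rewrite pm.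
by case: ifP; lia.
Qed.

(** Exactly one of [rho j] and [p - rho j] is odd; [sig j] is its index. No two odd representatives
    are opposite modulo [p], since their sum is even and below [2 p], so [sig] is a permutation. *)
Definition sig (j : 'I_m) : 'I_m := Ordinal (sig_lt j).

Lemma sig_odd (j : 'I_m) : ((sig j).*2.+1 = if odd (rho j) then rho j else p - rho j)%N.
Proof.
rewrite /=; have := rho_lt j; rewrite pm.
by case: ifP; lia.
Qed.

Lemma rho_sig (j : 'I_m) :
  (h * j.*2.+1)%:R = (-1) ^+ (~~ odd (rho j)) * ((sig j).*2.+1)%:R :> 'F_p.
Proof.
rewrite sig_odd (_ : (h * j.*2.+1)%:R = (rho j)%:R); last first.
  by apply: val_inj; rewrite /= !val_Fp_nat // modn_mod.
case: odd; first by rewrite mul1r.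
rewrite natrB ?(ltnW (rho_lt j)) // pchar_Fp_0 //.
by rewrite sub0r mulrNN mul1r.
Qed.

Lemma sig_inj : injective sig.
Proof.
move=> i j E.
have Ei := rho_sig i; have Ej := rho_sig j; rewrite E in Ei.
have h0 : h%:R != 0 :> 'F_p by rewrite natF_eq0.
have : exists b : bool, (i.*2.+1)%:R = (-1) ^+ b * (j.*2.+1)%:R :> 'F_p.
  exists ((~~ odd (rho i)) (+) (~~ odd (rho j))).
  apply: (mulfI h0); rewrite mulrCA -!natrM Ei Ej mulrA; congr (_ * _).
  by rewrite -signr_addb -addbA addbb addbF.
have Li := ltn_ord i; have Lj := ltn_ord j.
case=> [] [] Eb; last first.
  apply: val_inj; move: Eb; rewrite mul1r => /(congr1 (@nat_of_ord _)).
  by rewrite !val_Fp_nat // !modn_small /=; lia.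
have : (i.*2.+1 + j.*2.+1)%:R == 0 :> 'F_p by rewrite natrD Eb mulN1r addNr.
rewrite natF_eq0 => /dvdnP[[|[|q]]]; rewrite pm; nia.
Qed.

(** Both sides are multiplied by the product of the odd representatives, a nonzero factor that [sig]
    merely permutes up to signs. *)
Lemma gauss_odd : h%:R ^+ m = (-1) ^+ (\sum_(j < m) ~~ odd (rho j))%N :> 'F_p.
Proof.
have nz : \prod_(j < m) (j.*2.+1)%:R != 0 :> 'F_p.
  apply/prodf_neq0 => j _; rewrite natF_eq0; apply/negP => /dvdn_leq.
  by have := ltn_ord j; rewrite pm; lia.
apply: (mulIf nz).
rewrite -prodrXr {2}(reindex_inj sig_inj) -big_split /=.
have -> : h%:R ^+ m = \prod_(j < m) (h%:R : 'F_p) by rewrite prodr_const card_ord.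
rewrite -big_split /=; apply: eq_bigr => j _.
by rewrite -rho_sig natrM.
Qed.
End Gauss.
End PrimeField.

Lemma odd_floorsum (q : nat -> nat) m :
  odd (\sum_(r < m.*2.+1) r * q r) = odd (\sum_(j < m) q j.*2.+1).
Proof.
elim: m => [|m IH]; first by rewrite big_ord_recr /= !big_ord0 mul0n.
rewrite doubleS big_ord_recr big_ord_recr /= [in RHS]big_ord_recr /=.
rewrite !oddD IH !oddM /= odd_double /=.
by case: (odd (q m.*2.+2)); rewrite ?addbF.
Qed.

(** Reducing [h (2 j + 1) = q p + rho j] modulo 2, with [p] odd, turns the parity of the remainder
    into that of [q + h]. *)
Lemma odd_gauss_count h p m : p = m.*2.+1 ->
  odd (\sum_(j < m) ~~ odd (h * j.*2.+1 %% p)) = odd (floorsum h p + m * h.+1).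
Proof.
move=> pm; rewrite /floorsum [in RHS]oddD.
have -> : \sum_(r < p) r * (h * r %/ p) = \sum_(r < m.*2.+1) r * (h * r %/ p) by rewrite -pm.
rewrite (odd_floorsum (fun r => h * r %/ p)).
rewrite -oddD; have -> : m * h.+1 = \sum_(j < m) h.+1 by rewrite sum_nat_const card_ord.
rewrite -big_split /= !(big_morph odd oddD (erefl _)).
apply: eq_bigr => j _.
have := divn_eq (h * j.*2.+1) p; move/(congr1 odd).
rewrite oddD !oddM /= odd_double /= (_ : odd p); last by rewrite pm /= odd_double.
by rewrite oddb oddD /=; case: (odd h); case: (odd (_ %/ _)); case: (odd (_ %% _)).
Qed.

Lemma prime_odd_double p : prime p -> p != 2 -> p = (p./2).*2.+1.
Proof. by move=> pp p2; have := odd_double_half p; case: (even_prime pp) => [E|->] //; rewrite E in p2. Qed.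

(** Modulo 8 the term [12 floorsum] depends only on the parity of [floorsum], and Gauss's lemma
    identifies this parity with the Legendre symbol. *)
Lemma dedS_prime p h : prime p -> p != 2 -> ~~ (p %| h) ->
  (8 | dedS h p - (Z.of_nat p + 1 - 2 * kron_p (Z.of_nat h) p))%Z.
Proof.
move=> pp p2 ph; have pm := prime_odd_double pp p2; set m := p./2 in pm.
have p0 := prime_gt0 pp.
have Z1 : (Z.of_nat h mod Z.of_nat p = Z.of_nat (h %% p))%Z by rewrite modn_Z.
have nz : (h%:R != 0 :> 'F_p)%R by rewrite natF_eq0.
have Ek : kron_p (Z.of_nat h) p = (if odd (\sum_(j < m) ~~ odd (h * j.*2.+1 %% p)) then -1 else 1)%Z.
  rewrite /kron_p (negPf p2) Z1.
  have -> : (Z.of_nat (h %% p) =? 0)%Z = false by move: ph; rewrite /dvdn; lia.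
  rewrite Nat2Z.id existsF //.
  have := gauss_odd pp pm ph; rewrite (euler_pm pp pm nz) -[RHS]GRing.signr_odd.
  move: (\sum_(j < m) _) => c.
  have ne : ((-1)%R != 1%R :> 'F_p).
    rewrite -GRing.subr_eq0 -GRing.opprD GRing.oppr_eq0 -(GRing.natrD _ 1 1) natF_eq0 //.
    by apply/negP => /dvdn_leq; have := prime_gt1 pp; lia.
  case: existsP => _; case: (odd c) => //= /eqP; rewrite ?GRing.expr0 ?GRing.expr1.
    by rewrite eq_sym (negPf ne).
  by rewrite (negPf ne).
rewrite Ek (odd_gauss_count h pm) /dedS.
move: (floorsum h p) => A.
have -> : Z.of_nat p = (2 * Z.of_nat m + 1)%Z by lia.
have E : (Z.of_nat (A + m * h.+1) = Z.of_nat A + Z.of_nat m * (Z.of_nat h + 1))%Z by lia.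
have O : (exists b, Z.of_nat (A + m * h.+1) = 2 * b + (if odd (A + m * h.+1) then 1 else 0))%Z.
  exists (Z.of_nat ((A + m * h.+1)./2)). have := odd_double_half (A + m * h.+1). case: odd; lia.
have [c Ec] : (exists c, Z.of_nat m * (Z.of_nat m + 1) = 2 * c)%Z.
  by case: (Z.Even_or_Odd (Z.of_nat m)) => - [c ->];
    [exists (c * (2 * c + 1))%Z | exists ((2 * c + 1) * (c + 1))%Z]; ring.
move: O; rewrite E; set M := Z.of_nat m in Ec *; set H := Z.of_nat h; set A' := Z.of_nat A.
case: odd => - [b Eb].
  exists (2 * H * M * M + 2 * H * M - 3 * b - 2 + c - 2 * M * M)%Z.
  have -> : A' = (2 * b + 1 - M * (H + 1))%Z by lia.
  by lia.
exists (2 * H * M * M + 2 * H * M - 3 * b + c - 2 * M * M)%Z.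
have -> : A' = (2 * b - M * (H + 1))%Z by lia.
by lia.
Qed.

End GaussLemma.

(** * Multiplicativity and periodicity of the Kronecker symbol *)

Module KroneckerSymbol.

Require Import Defs.
Import DedekindSums GaussLemma.
From HB Require Import structures.
From Stdlib Require Import ZArith Lia.
From mathcomp Require Import all_boot ssralg finalg zmodp fingroup cyclic finfield.
From mathcomp Require Import zify.
Ltac mlia := Z.to_euclidean_division_equations; lia.
Set Implicit Arguments. Unset Strict Implicit. Unset Printing Implicit Defensive.

HB.instance Definition _ := Monoid.isComLaw.Build Z 1%Z Z.mul Z.mul_assoc Z.mul_comm Z.mul_1_l.

(** The product runs over all indices below a common bound, including those of exponent 0, so that
    symbols with different lower entries can be multiplied factor by factor. *)
Lemma kron_big m n B : 0 < n -> n < B ->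
  kron m n = \big[Z.mul/1%Z]_(0 <= p < B) (kron_p m p ^ Z.of_nat (logn p n))%Z.
Proof.
move=> n0 nB; rewrite /kron eqn0Ngt n0 /=.
have -> : foldr (fun p acc => (kron_p m p ^ Z.of_nat (logn p n) * acc)%Z) 1%Z (primes n)
  = \big[Z.mul/1%Z]_(p <- primes n) (kron_p m p ^ Z.of_nat (logn p n))%Z.
  by elim: (primes n) => [|p s IH]; rewrite ?big_nil ?big_cons //= IH.
have pe : perm_eq (primes n) [seq p <- index_iota 0 B | p \in primes n].
  apply: uniq_perm; rewrite ?primes_uniq ?filter_uniq ?iota_uniq // => p.
  rewrite mem_filter mem_index_iota andbC; case: (boolP (p \in primes n)) => [|_]; last by rewrite andbF.
  by rewrite mem_primes => /and3P[_ _ /(dvdn_leq n0)]; lia.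
rewrite (perm_big _ pe) big_filter big_mkcond /=.
apply: eq_bigr => p _; case: ifP => // /negbT.
rewrite -logn_gt0 -eqn0Ngt => /eqP ->; by rewrite Z.pow_0_r.
Qed.

Lemma kron1n n : kron 1 n = 1%Z.
Proof.
case: (posnP n) => [->//|n0]; rewrite (kron_big _ n0 (leqnn _)).
rewrite big_seq big1 // => p _.
case: (boolP (prime p)) => [pp|np]; last by rewrite lognE (negPf np) Z.pow_0_r.
suff -> : kron_p 1 p = 1%Z by rewrite Z.pow_1_l //; lia.
rewrite /kron_p; case: eqP => [_ //|_].
have p1 := prime_gt1 pp.
rewrite Z.mod_1_l; last lia.
rewrite /=.
case: existsP => // - []; exists (Ordinal p1) => /=; by rewrite mul1n modn_small.
Qed.

Lemma kronn1 m : kron m 1 = 1%Z. Proof. by []. Qed.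

Lemma kronM m n1 n2 : 0 < n1 -> 0 < n2 -> kron m (n1 * n2) = (kron m n1 * kron m n2)%Z.
Proof.
move=> p1 p2; have p12 : 0 < n1 * n2 by rewrite muln_gt0 p1.
have L1 : n1 < (n1 * n2).+1 by nia.
have L2 : n2 < (n1 * n2).+1 by nia.
rewrite (kron_big _ p12 (leqnn _)) (kron_big _ p1 L1) (kron_big _ p2 L2) -big_split /=.
apply: eq_bigr => p _; rewrite lognM // Nat2Z.inj_add Z.pow_add_r //; lia.
Qed.

Lemma kron_prime m p : prime p -> kron m p = kron_p m p.
Proof.
by move=> pp; rewrite /kron eqn0Ngt prime_gt0 // primes_prime //= logn_prime // eqxx Z.mul_1_r Z.pow_1_r.
Qed.

Lemma nat_prime_ind (P : nat -> Prop) : P 1 ->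
  (forall p n, prime p -> 0 < n -> P n -> P (p * n)) -> forall n, 0 < n -> P n.
Proof.
move=> P1 PM; elim/ltn_ind => n IH n0.
case: (ltngtP n 1) => [|n1|->//]; first lia.
have pp := pdiv_prime n1; have D := pdiv_dvd n.
have q0 : 0 < n %/ pdiv n by rewrite divn_gt0 ?pdiv_gt0 // dvdn_leq.
have qn : n %/ pdiv n < n by rewrite ltn_Pdiv // prime_gt1.
have -> : n = pdiv n * (n %/ pdiv n) by rewrite mulnC divnK.
exact: (PM _ _ pp q0 (IH _ qn q0)).
Qed.

Definition ncop (m : Z) (n : nat) : bool := coprime (Z.abs_nat m) n.

Lemma mod_abs_eq0 m p : 0 < p -> (m mod Z.of_nat p =? 0)%Z = (p %| Z.abs_nat m).
Proof.
move=> p0; apply/idP/idP => [/Z.eqb_eq H|/dvdnP[q E]].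
  have [q Eq] : (Z.of_nat p | m)%Z by apply/Z.mod_divide => //; lia.
  by apply/dvdnP; exists (Z.abs_nat q); nia.
apply/Z.eqb_eq/Z.mod_divide; first lia.
exists (if (0 <=? m)%Z then Z.of_nat q else - Z.of_nat q)%Z.
by case: Z.leb_spec => ?; nia.
Qed.

Lemma Zeven_abs_nat m : Z.even m = ~~ odd (Z.abs_nat m).
Proof.
have := Zabs2Nat.id_abs m; rewrite Zeven_mod; move: (Z.abs_nat m) => n.
have := odd_double_half n; rewrite -muln2; case: (odd n) => /=.
  by move=> E1 E2; apply/Z.eqb_neq; mlia.
by move=> E1 E2; apply/Z.eqb_eq; mlia.
Qed.

Lemma kron_p_pm m p : prime p -> ncop m p -> (kron_p m p = 1 \/ kron_p m p = -1)%Z.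
Proof.
move=> pp; rewrite /ncop coprime_sym prime_coprime // => nd; rewrite /kron_p.
case: eqP nd => [->|_]; last first.
  by rewrite mod_abs_eq0 ?prime_gt0 // => /negPf ->; case: existsP; [left|right].
rewrite dvdn2 negbK => O; rewrite Zeven_abs_nat O /=.
by case: orb; [left|right].
Qed.

Lemma kron_pm m n : 0 < n -> ncop m n -> (kron m n = 1 \/ kron m n = -1)%Z.
Proof.
move=> n0; elim/nat_prime_ind: n / n0 => [|p n pp n0 IH]; first by left.
rewrite /ncop coprimeMr => /andP[c1 c2]; rewrite kronM ?(prime_gt0 pp) // (kron_prime _ pp).
by case: (kron_p_pm pp c1) (IH c2) => -> [] ->; [left|right|right|left].
Qed.

Lemma kron_p_mod m m' p : prime p -> p != 2 -> (m mod Z.of_nat p = m' mod Z.of_nat p)%Z ->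
  kron_p m p = kron_p m' p.
Proof. by move=> pp p2 E; rewrite /kron_p (negPf p2) E. Qed.

(** Oddness of [n] matters: (m/2) depends on [m] modulo 8. *)
Lemma kron_mod m m' n : odd n -> (Z.of_nat n | m - m')%Z -> kron m n = kron m' n.
Proof.
move=> on; have n0 := odd_gt0 on; move: on.
elim/nat_prime_ind: n / n0 => [|p n pp n0 IH]; first by [].
rewrite oddM => /andP[op on] [q E].
rewrite !kronM ?(prime_gt0 pp) // IH //; last by exists (q * Z.of_nat p)%Z; nia.
rewrite !(kron_prime _ pp); congr (_ * _)%Z; apply: kron_p_mod => //; first by case: eqP op => // ->.
have -> : m = (m' + (q * Z.of_nat n) * Z.of_nat p)%Z by nia.
by rewrite Z.mod_add //; have := prime_gt0 pp; lia.
Qed.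

(** For [p = 2] this is a table of odd residues modulo 8; for odd [p] it is the multiplicativity of
    [u ^ m] in Euler's criterion. *)
Lemma kron_pMl m1 m2 p : prime p -> kron_p (m1 * m2) p = (kron_p m1 p * kron_p m2 p)%Z.
Proof.
move=> pp; have p0 := prime_gt0 pp.
case: (eqVneq p 2) => [->|p2].
  rewrite /kron_p /= Z.even_mul.
  case: (boolP (Z.even m1)) => // o1; case: (boolP (Z.even m2)) => //= o2; first by case: orb.
  have E1 : (m1 mod 8 = 1 \/ m1 mod 8 = 3 \/ m1 mod 8 = 5 \/ m1 mod 8 = 7)%Z by move: o1 o2; rewrite !Zeven_mod; mlia.
  have E2 : (m2 mod 8 = 1 \/ m2 mod 8 = 3 \/ m2 mod 8 = 5 \/ m2 mod 8 = 7)%Z by move: o1 o2; rewrite !Zeven_mod; mlia.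
  rewrite Z.mul_mod //.
  by case: E1 => [->|[->|[->|->]]]; case: E2 => [->|[->|[->|->]]].
have pm := prime_odd_double pp p2.
have Zk (m : Z) : kron_p m p = if p %| Z.to_nat (m mod Z.of_nat p) then 0%Z else
    (if [exists y : 'F_p, y ^+ 2 == (Z.to_nat (m mod Z.of_nat p))%:R]%R then 1 else -1)%Z.
  rewrite /kron_p (negPf p2).
  have B : (0 <= m mod Z.of_nat p < Z.of_nat p)%Z by apply: Z.mod_pos_bound; lia.
  rewrite -existsF // modn_small; last lia.
  have -> // : (p %| Z.to_nat (m mod Z.of_nat p)) = (m mod Z.of_nat p =? 0)%Z.
  apply/idP/idP => [|/Z.eqb_eq -> //].
  by case: (posnP (Z.to_nat (m mod Z.of_nat p))) => [E _|P /(dvdn_leq P)]; lia.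
rewrite !Zk.
have B1 : (0 <= m1 mod Z.of_nat p < Z.of_nat p)%Z by apply: Z.mod_pos_bound; lia.
have B2 : (0 <= m2 mod Z.of_nat p < Z.of_nat p)%Z by apply: Z.mod_pos_bound; lia.
have E12 : Z.to_nat ((m1 * m2) mod Z.of_nat p) =
   Z.to_nat (m1 mod Z.of_nat p) * Z.to_nat (m2 mod Z.of_nat p) %% p.
  rewrite Z.mul_mod; last lia.
  rewrite -{1}(Z2Nat.id (m1 mod _)) -1?{1}(Z2Nat.id (m2 mod _)); try lia.
  by rewrite -Nat2Z.inj_mul modn_Z // Nat2Z.id.
rewrite E12; move: (Z.to_nat (m1 mod _)) (Z.to_nat (m2 mod _)) => h1 h2.
have F12 : ((h1 * h2 %% p)%:R = h1%:R * h2%:R :> 'F_p)%R.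
  by rewrite -GRing.natrM; apply: val_inj; rewrite /= !val_Fp_nat // modn_mod.
rewrite F12 /dvdn modn_mod -!/(dvdn _ _) Euclid_dvdM //.
case: (boolP (p %| h1)) => d1 //=; case: (boolP (p %| h2)) => d2 /=; first by rewrite Z.mul_0_r.
have u1 : (h1%:R != 0 :> 'F_p)%R by rewrite natF_eq0.
have u2 : (h2%:R != 0 :> 'F_p)%R by rewrite natF_eq0.
have u12 := GRing.mulf_neq0 u1 u2.
have := euler_pm pp pm u12; rewrite GRing.exprMn (euler_pm pp pm u1) (euler_pm pp pm u2).
have ne : ((-1)%R != 1%R :> 'F_p).
  rewrite -GRing.subr_eq0 -GRing.opprD GRing.oppr_eq0 -(GRing.natrD _ 1 1) natF_eq0 //.
  by apply/negP => /dvdn_leq; have := prime_gt1 pp; lia.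
case: existsP => _; case: existsP => _; case: existsP => _ //=; rewrite ?GRing.expr0 ?GRing.expr1 ?GRing.mulr1 ?GRing.mul1r ?GRing.mulrNN ?GRing.mulr1 => /eqP; rewrite ?(negPf ne) // eq_sym ?(negPf ne) //.
Qed.

Lemma kronMl m1 m2 n : 0 < n -> kron (m1 * m2) n = (kron m1 n * kron m2 n)%Z.
Proof.
move=> n0; elim/nat_prime_ind: n / n0 => [|p n pp n0 IH]; first by [].
by rewrite !kronM ?(prime_gt0 pp) // IH !(kron_prime _ pp) kron_pMl //; ring.
Qed.

Lemma floorsum1 k : floorsum 1 k = 0.
Proof. by rewrite /floorsum big1 // => r _; rewrite mul1n divn_small // muln0. Qed.

(** First supplement. For a prime, [dedS] at -1 is the negative of [dedS 1 p], which is explicit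
    because [floorsum 1 p = 0]; comparison with [dedS_prime] gives the symbol. *)
Lemma kronN1 n : odd n -> (4 | kron (-1) n - Z.of_nat n)%Z.
Proof.
move=> on; have n0 := odd_gt0 on; move: on.
elim/nat_prime_ind: n / n0 => [|p n pp n0 IH]; first by exists 0%Z.
rewrite oddM => /andP[op /IH [q Eq]].
have p2 : p != 2 by case: eqP op => // ->.
have p1 := prime_gt1 pp.
have [q' Eq'] : (4 | kron (-1) p - Z.of_nat p)%Z; last first.
  exists (q * q' * 4 + q' * Z.of_nat n + q * Z.of_nat p)%Z.
  rewrite kronM ?(prime_gt0 pp) //.
  have -> : kron (-1) n = (Z.of_nat n + q * 4)%Z by lia.
  have -> : kron (-1) p = (Z.of_nat p + q' * 4)%Z by lia.
  by rewrite Nat2Z.inj_mul; ring.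
have c1 : coprime 1 p by rewrite coprime1n.
have nd : ~~ (p %| p.-1) by apply/negP => /dvdn_leq; lia.
have := dedS_prime pp p2 nd.
have Eo : dedS p.-1 p = (- dedS 1 p)%Z.
  by apply: dedS_opp => //; [lia | rewrite add1n prednK // ltnW].
rewrite Eo (kron_prime _ pp) -(@kron_p_mod (-1)) //; last first.
  have -> : Z.of_nat p.-1 = (-1 + 1 * Z.of_nat p)%Z by lia.
  by rewrite Z.mod_add //; lia.
have : ncop (-1) p by exact: c1.
move/(kron_p_pm pp); rewrite /dedS floorsum1.
have := prime_odd_double pp p2; move: (p./2) => m.
move: (kron_p _ _) => kk -> K [w Ew].
have [c Ec] : (exists c, Z.of_nat m * (Z.of_nat m + 1) = 2 * c)%Z.
  by case: (Z.Even_or_Odd (Z.of_nat m)) => - [c ->];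
    [exists (c * (2 * c + 1))%Z | exists ((2 * c + 1) * (c + 1))%Z]; ring.
have [w' Ew'] : (4 | kk - Z.of_nat m.*2.+1)%Z; last by exists w'.
apply/Z.mod_divide => //.
have E : (Z.of_nat m.*2.+1 = 2 * Z.of_nat m + 1)%Z by lia.
rewrite E in Ew *; move: (Z.of_nat m) Ew Ec => M Ew Ec.
have : (2 * kk = 8 * w + 8 * c - 8 * M + 2 + 4 * M)%Z by lia.
mlia.
Qed.

End KroneckerSymbol.

(** * Dedekind sums modulo 8 and 3, and quadratic reciprocity *)

Module DedekindKronecker.

Require Import Defs.
Import DedekindSums GaussLemma KroneckerSymbol.
From HB Require Import structures.
From Stdlib Require Import ZArith Lia.
From mathcomp Require Import all_boot ssralg finalg zmodp fingroup cyclic finfield.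
From mathcomp Require Import zify.
Set Implicit Arguments. Unset Strict Implicit. Unset Printing Implicit Defensive.

Definition qrsgn (h k : Z) : Z := if ((h mod 4 =? 3) && (k mod 4 =? 3))%Z then (-1)%Z else 1%Z.

Lemma odd_mod8 h : (h mod 2 = 1)%Z -> exists u, (h = 8 * u + 1 \/ h = 8 * u + 3 \/ h = 8 * u + 5 \/ h = 8 * u + 7)%Z.
Proof. by move=> o; exists (h / 8)%Z; mlia. Qed.

Lemma qrsgnMr h k1 k2 : (k1 mod 2 = 1)%Z -> (k2 mod 2 = 1)%Z ->
  qrsgn h (k1 * k2) = (qrsgn h k1 * qrsgn h k2)%Z.
Proof.
move=> o1 o2; rewrite /qrsgn Z.mul_mod //.
have E1 : (k1 mod 4 = 1 \/ k1 mod 4 = 3)%Z by mlia.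
have E2 : (k2 mod 4 = 1 \/ k2 mod 4 = 3)%Z by mlia.
by case: E1 => ->; case: E2 => ->; case: Z.eqb.
Qed.

(** When both Dedekind sums are known modulo 8 up to a sign, Dedekind reciprocity becomes a
    congruence between odd residues that fixes the product of the two signs. This is quadratic
    reciprocity. *)
Lemma qr_from_reciprocity h k S S' x x' : (h mod 2 = 1)%Z -> (k mod 2 = 1)%Z ->
  (h * S + k * S' = h * h + k * k + 1 - 3 * h * k)%Z ->
  (8 | S - (k + 1 - 2 * x))%Z -> (8 | S' - (h + 1 - 2 * x'))%Z ->
  (x = 1 \/ x = -1)%Z -> (x' = 1 \/ x' = -1)%Z -> x = (qrsgn h k * x')%Z.
Proof.
move=> oh ok E [w Ew] [w' Ew'] X X'.
have {}Ew : S = (k + 1 - 2 * x + 8 * w)%Z by lia.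
have {}Ew' : S' = (h + 1 - 2 * x' + 8 * w')%Z by lia.
subst S S'; rewrite /qrsgn.
have [u U] := odd_mod8 oh; have [v V] := odd_mod8 ok.
have M4 r i : (0 <= i < 8)%Z -> ((8 * r + i) mod 4 = i mod 4)%Z by mlia.
by case: U => [|[|[|]]] U; case: V => [|[|[|]]] V; subst h k; rewrite !M4; try lia;
  case: X => ?; case: X' => ?; subst x x'; rewrite //=; lia.
Qed.

(** The odd [h] is invertible modulo 8, so reciprocity transports the congruence from one order of
    the arguments to the other. *)
Lemma dedS_from_reciprocity h k S S' x' : (h mod 2 = 1)%Z -> (k mod 2 = 1)%Z ->
  (h * S + k * S' = h * h + k * k + 1 - 3 * h * k)%Z ->
  (8 | S' - (h + 1 - 2 * x'))%Z ->
  (x' = 1 \/ x' = -1)%Z -> (8 | S - (k + 1 - 2 * (qrsgn h k * x')))%Z.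
Proof.
move=> oh ok E [w' Ew'] X'.
have {}Ew' : S' = (h + 1 - 2 * x' + 8 * w')%Z by lia.
subst S'; rewrite /qrsgn.
have [u U] := odd_mod8 oh; have [v V] := odd_mod8 ok.
have M4 r i : (0 <= i < 8)%Z -> ((8 * r + i) mod 4 = i mod 4)%Z by mlia.
apply/Z.mod_divide => //.
by case: U => [|[|[|]]] U; case: V => [|[|[|]]] V; subst h k; rewrite !M4; try lia;
  case: X' => ?; subst x'; vm_compute (if _ then _ else _); mlia.
Qed.

Lemma odd_Zmod (n : nat) : odd n -> (Z.of_nat n mod 2 = 1)%Z.
Proof. by move=> o; have := odd_double_half n; rewrite o -muln2; mlia. Qed.

(** Strong induction on the modulus. Gauss's lemma covers prime [k]. For [k = p n] the induction
    hypothesis gives quadratic reciprocity between [h] and each factor, hence between [h] and [k] by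
    multiplicativity; Dedekind reciprocity then carries the congruence from modulus [h < k] to
    modulus [k]. *)
Lemma dedS_kron k h : odd k -> coprime h k ->
  (8 | dedS h k - (Z.of_nat k + 1 - 2 * kron (Z.of_nat h) k))%Z.
Proof.
elim/ltn_ind: k h => k IH h ok chk.
have k0 := odd_gt0 ok.
case: (ltngtP k 1) => [|k1|E1]; [lia| |]; last first.
  rewrite E1 kronn1 /dedS /floorsum big_ord_recr big_ord0 /= ; by exists 0%Z; lia.
wlog hk : h chk / h < k.
  move=> W; have := W (h %% k); rewrite coprime_modl => /(_ chk (ltn_pmod _ k0)).
  rewrite dedS_mod // (@kron_mod (Z.of_nat (h %% k)) (Z.of_nat h)) //.
  exists (- Z.of_nat (h %/ k))%Z; have := divn_eq h k; nia.
have h0 : 0 < h by case: (posnP h) chk => // ->; rewrite /coprime gcd0n; lia.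
(* [h] will serve as a modulus and must be odd. For even [h] pass to [k - h], which negates [dedS]
   and multiplies the symbol by (-1/k). *)
wlog oh : h chk hk h0 / odd h.
  move=> W; case: (boolP (odd h)) => [|eh]; first exact: W.
  have c' : coprime (k - h) k.
    rewrite /coprime -{2}(subnKC (ltnW hk)) gcdnDr gcdnC -gcdnDr subnK //; exact: ltnW.
  have L1 : k - h < k by lia.
  have L2 : 0 < k - h by lia.
  have o' : odd (k - h) by rewrite oddB ?(ltnW hk) // ok (negPf eh).
  have := W _ c' L1 L2 o'.
  have -> : dedS (k - h) k = (- dedS h k)%Z by apply: dedS_opp => //; rewrite subnKC // ltnW.
  have -> : kron (Z.of_nat (k - h)) k = (kron (-1) k * kron (Z.of_nat h) k)%Z.
    rewrite -kronMl //; apply: kron_mod => //; exists 1%Z; lia.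
  have [w Ew] := kronN1 ok.
  have : ncop (Z.of_nat h) k by rewrite /ncop Zabs2Nat.id.
  move/(kron_pm k0); have : ncop (-1) k by rewrite /ncop coprime1n.
  move/(kron_pm k0) => X X' [v Ev]; apply/Z.mod_divide => //.
  have := odd_Zmod ok.
  move: (kron (-1) k) (kron (Z.of_nat h) k) (dedS h k) (Z.of_nat k) X X' Ew Ev => x x' S kk.
  by case=> ->; case=> -> Ew Ev ?; mlia.
case: (boolP (prime k)) => [pk|npk].
  rewrite kron_prime //; apply: dedS_prime => //; first by case: eqP ok => // ->.
  by rewrite -prime_coprime // coprime_sym.
have Xc (m n : nat) : 0 < n -> coprime m n -> (kron (Z.of_nat m) n = 1 \/ kron (Z.of_nat m) n = -1)%Z.
  by move=> n0 c; apply: kron_pm => //; rewrite /ncop Zabs2Nat.id.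
have QR n : n < k -> odd n -> coprime h n -> kron (Z.of_nat h) n = (qrsgn (Z.of_nat h) (Z.of_nat n) * kron (Z.of_nat n) h)%Z.
  move=> nk on chn; have n0 := odd_gt0 on.
  apply: (qr_from_reciprocity (odd_Zmod oh) (odd_Zmod on) (dedS_reciprocity h0 n0 chn)).
  - exact: IH.
  - by apply: IH => //; rewrite coprime_sym.
  - exact: Xc.
  - by apply: Xc => //; rewrite coprime_sym.
have [p [n [Ek pk nk n0]]] : exists p n, [/\ k = p * n, p < k, n < k & 0 < n /\ 0 < p].
  exists (pdiv k), (k %/ pdiv k); have D := pdiv_dvd k.
  split; [by rewrite mulnC divnK| |by rewrite ltn_Pdiv // prime_gt1 // pdiv_prime|].
    rewrite ltn_neqAle dvdn_leq // andbT; apply/negP => /eqP E.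
    by move/negP: npk; apply; rewrite -E pdiv_prime.
  by rewrite pdiv_gt0 divn_gt0 ?pdiv_gt0 // dvdn_leq.
move: (ok) (chk); rewrite {1 2}Ek oddM coprimeMr => /andP[op on] /andP[cp cn].
have -> : kron (Z.of_nat h) k = (qrsgn (Z.of_nat h) (Z.of_nat k) * kron (Z.of_nat k) h)%Z.
  rewrite {1}Ek kronM; [|by case: n0|by case: n0]. rewrite (QR p) // (QR n) //.
  by rewrite [in RHS]Ek Nat2Z.inj_mul qrsgnMr ?odd_Zmod // kronMl //; ring.
apply: (dedS_from_reciprocity (odd_Zmod oh) (odd_Zmod ok) (dedS_reciprocity h0 k0 chk)).
- by apply: IH => //; rewrite coprime_sym.
- by apply: Xc => //; rewrite coprime_sym.
Qed.

Lemma kron_pm_nat (m n : nat) : 0 < n -> coprime m n ->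
  (kron (Z.of_nat m) n = 1 \/ kron (Z.of_nat m) n = -1)%Z.
Proof. by move=> n0 c; apply: kron_pm => //; rewrite /ncop Zabs2Nat.id. Qed.

Lemma kron_reciprocity h k : odd h -> odd k -> coprime h k ->
  kron (Z.of_nat h) k = (qrsgn (Z.of_nat h) (Z.of_nat k) * kron (Z.of_nat k) h)%Z.
Proof.
move=> oh ok c; have h0 := odd_gt0 oh; have k0 := odd_gt0 ok.
have c' : coprime k h by rewrite coprime_sym.
apply: (qr_from_reciprocity (odd_Zmod oh) (odd_Zmod ok) (dedS_reciprocity h0 k0 c)).
- exact: dedS_kron.
- exact: dedS_kron.
- exact: kron_pm_nat.
- exact: kron_pm_nat.
Qed.

(** Second supplement, from Dedekind reciprocity with [h = 2], where [dedS n 2] vanishes. *)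
Lemma kron2n n : odd n -> kron 2 n = kron (Z.of_nat n) 2.
Proof.
move=> on; have n0 := odd_gt0 on; have c : coprime 2 n by rewrite coprime2n.
have := dedS_reciprocity (isT : 0 < 2) n0 c.
have -> : dedS n 2 = 0%Z.
  by rewrite -dedS_mod // modn2 on /dedS floorsum1.
have [w Ew] := dedS_kron on c.
have X := kron_pm_nat n0 c.
rewrite -[Z.of_nat 2]/2%Z in Ew X *.
have -> : dedS 2 n = (Z.of_nat n + 1 - 2 * kron 2 n + 8 * w)%Z by lia.
have -> : kron (Z.of_nat n) 2 =
    (if ((Z.of_nat n mod 8 =? 1) || (Z.of_nat n mod 8 =? 7))%Z then 1 else -1)%Z.
  by rewrite (@kron_prime _ 2) // /kron_p /= Zeven_abs_nat Zabs2Nat.id on.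
have [u U] := odd_mod8 (odd_Zmod on).
have M8 r i : (0 <= i < 8)%Z -> ((8 * r + i) mod 8 = i)%Z by mlia.
move: (kron 2 n) (Z.of_nat n) U X => x m.
by case => [->|[->|[->|->]]]; rewrite M8 // => X E; case: X E => -> E; rewrite //=; lia.
Qed.

Definition dedZ (h c : Z) : Z := dedS (Z.to_nat (h mod c)) (Z.to_nat c).

Lemma bezout_coprime (h c u v : Z) : (h * u + c * v = 1)%Z -> coprime (Z.abs_nat h) (Z.abs_nat c).
Proof.
move=> E; rewrite /coprime -dvdn1.
set g := gcdn _ _.
have D (m : Z) : g %| Z.abs_nat m -> (Z.of_nat g | m)%Z.
  by case/dvdnP => q Eq; apply/Z.divide_abs_r; exists (Z.of_nat q); have := Zabs2Nat.id_abs m; nia.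
have [x Ex] := D h (dvdn_gcdl _ _); have [y Ey] := D c (dvdn_gcdr _ _).
have D1 : (Z.of_nat g | 1)%Z by exists (x * u + y * v)%Z; rewrite -E Ex Ey; ring.
by apply/dvdnP; exists 1; have := Z.divide_1_r_nonneg _ (Zle_0_nat g) D1; lia.
Qed.

Lemma coprime_bezout (h c : Z) : coprime (Z.abs_nat h) (Z.abs_nat c) ->
  exists u v, (h * u + c * v = 1)%Z.
Proof.
move=> chc; have hc : Z.gcd h c = 1%Z.
  apply: Z.gcd_unique; [lia|exact: Z.divide_1_l|exact: Z.divide_1_l|].
  move=> q [x Ex] [y Ey]; have : Z.abs_nat q %| gcdn (Z.abs_nat h) (Z.abs_nat c).
    by rewrite dvdn_gcd; apply/andP; split; apply/dvdnP; [exists (Z.abs_nat x)|exists (Z.abs_nat y)]; nia.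
  rewrite (eqP chc) dvdn1 => /eqP q1; apply/Z.divide_abs_l; rewrite -Zabs2Nat.id_abs q1; exact: Z.divide_refl.
by have [x [y E]] := Z.gcd_bezout _ _ _ hc; exists x, y; lia.
Qed.

Lemma coprime_Zmod (h c : Z) : (0 < c)%Z -> coprime (Z.abs_nat h) (Z.abs_nat c) ->
  coprime (Z.to_nat (h mod c)) (Z.abs_nat c).
Proof.
move=> c0 /coprime_bezout [u [v uv]].
have B : (0 <= h mod c < c)%Z by apply: Z.mod_pos_bound.
have E := Z.div_mod h c ltac:(lia).
have -> : Z.to_nat (h mod c) = Z.abs_nat (h mod c) by lia.
by apply: (@bezout_coprime _ _ u (v + (h / c) * u)); rewrite -uv {3}E; ring.
Qed.

Lemma dedZ_nat (h : nat) (c : Z) : (0 < c)%Z -> dedZ (Z.of_nat h) c = dedS h (Z.to_nat c).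
Proof.
move=> c0; rewrite /dedZ -{1}(Z2Nat.id c); last lia.
by rewrite modn_Z ?Nat2Z.id ?dedS_mod //; lia.
Qed.

Lemma dedZ_abs (h c : Z) : (0 < c)%Z -> coprime (Z.abs_nat h) (Z.abs_nat c) -> (h <> 0)%Z ->
  (h * dedZ h c = Z.of_nat (Z.abs_nat h) * dedS (Z.abs_nat h) (Z.abs_nat c))%Z.
Proof.
move=> c0 chc h0; have Ea := Zabs2Nat.id_abs h.
have Ec : Z.to_nat c = Z.abs_nat c by have := Zabs2Nat.id_abs c; lia.
case: (Z.lt_ge_cases h 0) => s.
  have -> : dedZ h c = (- dedS (Z.abs_nat h) (Z.abs_nat c))%Z; last by nia.
  rewrite /dedZ Ec; apply: dedS_opp => //; first lia.
  have B : (0 <= h mod c < c)%Z by apply: Z.mod_pos_bound.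
  have E := Z.div_mod h c ltac:(lia).
  apply/dvdnP; exists (Z.to_nat (- (h / c))).
  have ? : (h / c <= 0)%Z by apply: Z.div_le_upper_bound; lia.
  have := Zabs2Nat.id_abs c; nia.
have E : h = Z.of_nat (Z.abs_nat h) by lia.
by rewrite {2}E dedZ_nat // Ec; nia.
Qed.

Lemma dedZ_odd_modulus (h c : Z) : (0 < c)%Z -> (c mod 2 = 1)%Z ->
  coprime (Z.abs_nat h) (Z.abs_nat c) ->
  (8 | dedZ h c - (c + 1 - 2 * kron h (Z.abs_nat c)))%Z.
Proof.
move=> c0 oc chc; rewrite /dedZ.
have Ec : Z.to_nat c = Z.abs_nat c by have := Zabs2Nat.id_abs c; lia.
have Ec' : c = Z.of_nat (Z.abs_nat c) by have := Zabs2Nat.id_abs c; lia.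
have ok : odd (Z.abs_nat c).
  by have := odd_double_half (Z.abs_nat c); rewrite -muln2; case: odd => //; mlia.
have B : (0 <= h mod c < c)%Z by apply: Z.mod_pos_bound.
have E := Z.div_mod h c ltac:(lia).
rewrite Ec.
rewrite (@kron_mod h (Z.of_nat (Z.to_nat (h mod c)))) //; last first.
  by exists (h / c)%Z; rewrite -Ec' Z2Nat.id; lia.
suff cc : coprime (Z.to_nat (h mod c)) (Z.abs_nat c).
  by have := dedS_kron ok cc; rewrite -Ec'.
exact: coprime_Zmod.
Qed.

Section DedZ.
Variables h c : Z.
Hypotheses (c0 : (0 < c)%Z) (chc : coprime (Z.abs_nat h) (Z.abs_nat c)).

Let C := Z.abs_nat c.
Let H := Z.abs_nat h.
Lemma absC : Z.of_nat C = c. Proof. by rewrite /C Zabs2Nat.id_abs; lia. Qed.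
Lemma absH : Z.of_nat H = Z.abs h. Proof. by rewrite /H Zabs2Nat.id_abs; lia. Qed.

Lemma dedZ_reciprocity : (h <> 0)%Z ->
  (h * dedZ h c + c * dedS C H = h * h + c * c + 1 - 3 * Z.abs h * c)%Z.
Proof.
move=> h0; rewrite dedZ_abs //.
have := @dedS_reciprocity H C; rewrite absC absH => -> //; [nia|have := absH; lia|have := absC; lia].
Qed.

(** Here [c] may be even; reciprocity trades the sum modulo [c] for the one modulo the odd number
    [|h|], which [dedS_kron] evaluates. *)
Lemma dedZ_odd : (h mod 2 = 1)%Z ->
  (8 * c | h * dedZ h c - (h * h + 1 + c * c + 3 * c + 2 * c * kron c H))%Z.
Proof.
move=> oh; have h0 : (h <> 0)%Z by move=> E; rewrite E in oh.
have R := dedZ_reciprocity h0.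
have oH : odd H.
  by have := absH; have := odd_double_half H; rewrite -muln2; case: odd => //; mlia.
have cCH : coprime C H by rewrite coprime_sym.
have [w Ew] := dedS_kron oH cCH.
rewrite absC absH in Ew.
have Eh : (Z.abs h = 2 * (Z.abs h / 2) + 1)%Z by mlia.
exists (- w - Z.abs h / 2 - 1)%Z.
have {}Ew : dedS C H = (Z.abs h + 1 - 2 * kron c H + 8 * w)%Z by lia.
rewrite Ew in R; move: R Eh; move: (kron c H) (Z.abs h / 2)%Z (Z.abs h) (dedZ h c) => x a b S R Eh.
by rewrite Eh in R; lia.
Qed.

Lemma dedZ_modulus : (c | h * dedZ h c - (h * h + 1))%Z.
Proof.
case: (Z.eq_dec h 0) => [E|h0]; last first.
  by have R := dedZ_reciprocity h0; exists (c - 3 * Z.abs h - dedS C H)%Z; lia.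
suff -> : c = 1%Z by exact: Z.divide_1_l.
by move: chc; rewrite E /coprime gcd0n => /eqP; have := absC; rewrite /C; lia.
Qed.

Lemma dedS3 k : (3 | Z.of_nat k)%Z -> forall n, (3 | dedS k n)%Z.
Proof.
move=> [q Eq] n; rewrite /dedS Eq.
exists (2 * q * (Z.of_nat n - 1) * (2 * Z.of_nat n - 1) - 4 * Z.of_nat (floorsum k n) - Z.of_nat n * (Z.of_nat n - 1))%Z.
ring.
Qed.

(** [dedS C H] is a multiple of 3 because its first argument is; this gains a factor 3 over
    [dedZ_modulus] in the reciprocity law. *)
Lemma dedZ_3dvd : (3 | c)%Z -> (3 * c | h * dedZ h c - (h * h + 1))%Z.
Proof.
move=> [q Eq].
have h0 : (h <> 0)%Z.
  by move=> E; move: chc; rewrite E /coprime gcd0n => /eqP; have := absC; rewrite /C; lia.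
have R := dedZ_reciprocity h0.
have [w Ew] : (3 | dedS C H)%Z by apply: dedS3; rewrite absC; exists q.
exists (q - Z.abs h - w)%Z; rewrite Ew in R; nia.
Qed.

Lemma dedZ_3ndvd : (c mod 3 <> 0)%Z -> (3 | dedZ h c)%Z.
Proof.
move=> c3; rewrite /dedZ /dedS.
have -> : Z.of_nat (Z.to_nat c) = c by lia.
move: (Z.of_nat (floorsum _ _)) (Z.of_nat _) => y x.
have [d [E|E]] : exists d, (c = 3 * d + 1 \/ c = 3 * d + 2)%Z by exists (c / 3)%Z; mlia.
  by exists (2 * x * d * (2 * c - 1) - 4 * y - c * (c - 1))%Z; rewrite E; ring.
by exists (2 * x * (c - 1) * (2 * d + 1) - 4 * y - c * (c - 1))%Z; rewrite E; ring.
Qed.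
End DedZ.

End DedekindKronecker.

(** * Integrality of Psi and its residues modulo 3 and 8 *)

Module PsiIntegrality.

Require Import Defs.
Import DedekindSums GaussLemma KroneckerSymbol DedekindKronecker.
From Stdlib Require Import Reals ZArith Lia Lra.
From mathcomp Require Import all_boot.
From mathcomp Require Import zify.
Delimit Scope R_scope with R.
Set Implicit Arguments. Unset Strict Implicit. Unset Printing Implicit Defensive.

Local Arguments Z.mul : simpl never.
Local Arguments Z.add : simpl never.
Local Arguments Z.sub : simpl never.
Local Arguments Z.of_nat : simpl never.

Lemma sumR_iotaS n F : sumR (iota 0 n.+1) F = (sumR (iota 0 n) F + F n)%R.
Proof.
rewrite /sumR -addn1 iotaD foldr_cat /= add0n Rplus_0_r.
elim: (iota 0 n) => /= [|x s ->]; ring.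
Qed.

Lemma dedekind_dedZ h c : (0 < c)%Z -> coprime (Z.abs_nat h) (Z.abs_nat c) ->
  (12 * IZR c * dedekind_s h c = IZR (dedZ h c))%R.
Proof.
move=> c0 chc.
have Ec : Z.to_nat c = Z.abs_nat c by have := Zabs2Nat.id_abs c; lia.
rewrite /dedekind_s /dedZ Ec.
set k := Z.abs_nat c; set h0 := Z.to_nat (h mod c).
have Ek : c = Z.of_nat k by rewrite /k; have := Zabs2Nat.id_abs c; lia.
have k0 : 0 < k by lia.
have B : (0 <= h mod c < c)%Z by apply: Z.mod_pos_bound.
have Eh0 : Z.of_nat h0 = (h mod c)%Z by lia.
have Eh (r : nat) : ((h * Z.of_nat r) mod c = Z.of_nat (h0 * r %% k))%Z.
  by rewrite -modn_Z // Nat2Z.inj_mul Eh0 -Ek Z.mul_mod_idemp_l //; lia.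
have ch : coprime h0 k by exact: coprime_Zmod.
have kR : (IZR c <> 0)%R by apply: not_0_IZR; lia.
(* Partial sums make the induction possible. Each index contributes the constant [3 c c] except
   [r = 0], where the sawtooth is 0 instead of -1/2. *)
have main n : (n <= k)%coq_nat ->
  (IZR c * (12 * IZR c * sumR (iota 0 n) (fun r => saw (Z.of_nat r) c * saw (h * Z.of_nat r) c))
  = IZR (12 * Z.of_nat (\sum_(r < n) r * (h0 * r %% k)) - 6 * c * Z.of_nat (\sum_(r < n) r)
     - 6 * c * Z.of_nat (\sum_(r < n) (h0 * r %% k)) + 3 * c * c * (Z.of_nat n - (if n == O then 0%Z else 1%Z))))%R.
  elim: n => [|n IH] nk.
    rewrite /= !big_ord0 /=; have -> : (12 * Z.of_nat 0 - 6 * c * Z.of_nat 0 - 6 * c * Z.of_nat 0 + 3 * c * c * (Z.of_nat 0 - 0))%Z = 0%Z by lia.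
    by ring.
  rewrite sumR_iotaS !Rmult_plus_distr_l IH; last lia.
  rewrite !big_ord_recr /= /saw Eh Z.mod_small; last lia.
  case: (posnP n) => [->|n0].
    rewrite !big_ord0 muln0 mod0n /= !Rmult_0_r Rplus_0_r; congr IZR; lia.
  have -> : (Z.of_nat n =? 0)%Z = false by lia.
  have -> : (Z.of_nat (h0 * n %% k) =? 0)%Z = false.
    apply/Z.eqb_neq => E0.
    have : k %| h0 * n by rewrite /dvdn; lia.
    by rewrite Gauss_dvdr 1?coprime_sym // => /(dvdn_leq n0); lia.
  rewrite !(Nat2Z.inj_add, Nat2Z.inj_mul) Nat2Z.inj_succ.
  by rewrite /Z.succ !(plus_IZR, minus_IZR, mult_IZR); field.
have := main k (le_n k).
rewrite (sum_mulmod (fun x => x) k0 ch).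
have := sum_ord_id k; have := dedS_modsum h0 k0.
have -> : (k == 0) = false by lia.
set t := \sum_(r < k) r * _; set s := \sum_(r < k) r; clearbody t s => E1 E2 E3.
apply: (Rmult_eq_reg_l (IZR c)) => //; rewrite E3 -mult_IZR; congr IZR.
rewrite -Ek in E1 *; rewrite E1.
have : (2 * Z.of_nat s + c = c * c)%Z by lia.
nia.
Qed.

Lemma Zabs_nat_opp h : Z.abs_nat (- h) = Z.abs_nat h.
Proof. by case: h. Qed.

Lemma dedZ_opp h c : (0 < c)%Z -> coprime (Z.abs_nat h) (Z.abs_nat c) -> dedZ (- h) c = (- dedZ h c)%Z.
Proof.
move=> c0 chc; case: (Z.eq_dec h 0) => [E|h0].
  have : c = 1%Z.
    by move: chc; rewrite E /coprime gcd0n => /eqP; have := Zabs2Nat.id_abs c; lia.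
  move=> ->; rewrite E /dedZ /=.
  by rewrite /dedS /floorsum big_ord_recr big_ord0.
have c' : coprime (Z.abs_nat (- h)) (Z.abs_nat c) by rewrite Zabs_nat_opp.
have := dedZ_abs c0 chc h0; have := dedZ_abs c0 c' ltac:(lia).
rewrite Zabs_nat_opp; nia.
Qed.

(** The formula for [Psi] at [C > 0], multiplied by [C] to become an equation between integers. *)
Definition psi_eqn (A B C D P : Z) := (C * P = A + D + dedZ (- D) C - 3 * C)%Z.

Section PsiInt.
Variables A B C D : Z.
Hypotheses (det : (A * D - B * C = 1)%Z) (C0 : (0 < C)%Z).

Lemma psi_coprime : coprime (Z.abs_nat (- D)) (Z.abs_nat C).
Proof. by apply: (@bezout_coprime _ _ (- A) (- B)); lia. Qed.

(** Modulo [C] the product [D * dedZ (- D) C] is [-(D^2 + 1)], so [D] times the right side reduces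
    to [A D - 1 = B C]; and [D] is prime to [C]. *)
Lemma psi_eqn_exists : exists P, psi_eqn A B C D P.
Proof.
have [w Ew] := dedZ_modulus C0 psi_coprime.
have : (C | D * (A + D + dedZ (- D) C - 3 * C))%Z.
  exists (B - w - 3 * D)%Z; nia.
move/Z.gauss => /(_ _) [|P EP].
  apply/Z.bezout_1_gcd; exists (- B)%Z, A; lia.
by exists P; rewrite /psi_eqn; lia.
Qed.

Variable P : Z.
Hypothesis HP : psi_eqn A B C D P.

(** If 3 divides [C], the sum is known modulo [3 C] and [D^2 = 1] modulo 3; otherwise [C^2 = 1]
    modulo 3 and the sum is itself divisible by 3. The polynomial on the right covers both cases at
    once. *)
Lemma psi_mod3 : (3 | P - ((A + D) * C - B * D * (C * C - 1)))%Z.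
Proof.
move: HP; rewrite /psi_eqn => E.
case: (Z.eq_dec (C mod 3) 0) => [C3|C3].
  have D3 : (3 | C)%Z by apply/Z.mod_divide.
  have [w Ew] := dedZ_3dvd C0 psi_coprime D3.
  case: D3 => q Eq.
  have EP : (D * P = B - 3 * (w + D))%Z.
    apply: (Z.mul_reg_l _ _ C); first lia. nia.
  have [d D1] : exists d, (D = 3 * d + 1 \/ D = 3 * d + 2)%Z.
    exists (D / 3)%Z; have : (D mod 3 <> 0)%Z; last by mlia.
    move/Z.mod_divide => /(_ ltac:(lia)) [d Ed]; move: det; rewrite Ed Eq; lia.
  have [e Ee] : exists e, (1 - D * D = 3 * e)%Z.
    by case: D1 => ->; [exists (- 3 * d * d - 2 * d)%Z | exists (- 3 * d * d - 4 * d - 1)%Z]; ring.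
  exists (P * e + D * (-(w + D)) - (A + D) * q + B * D * C * q)%Z.
  have : (P = P * (3 * e) + D * (D * P))%Z by rewrite -Ee; ring.
  rewrite EP => EP'.
  rewrite {1}EP' Eq; ring.
have [w Ew] : (3 | dedZ (- D) C)%Z by apply: dedZ_3ndvd => //; exact: psi_coprime.
have [e Ee] : exists e, (C * C - 1 = 3 * e)%Z.
  have [d D1] : exists d, (C = 3 * d + 1 \/ C = 3 * d + 2)%Z by exists (C / 3)%Z; mlia.
  by case: D1 => ->; [exists (3 * d * d + 2 * d)%Z | exists (3 * d * d + 4 * d + 1)%Z]; ring.
exists (- e * P + C * (w - C) + B * D * e)%Z.
have : (P = C * (C * P) - (C * C - 1) * P)%Z by ring.
rewrite E Ew => EP; rewrite {1}EP !Ee; ring.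
Qed.

Lemma psi_mod8_oddC : (C mod 2 = 1)%Z ->
  (8 | P - (C * (A + D) + C - 2 - 2 * C * kron (- D) (Z.abs_nat C)))%Z.
Proof.
move=> oC; have [w Ew] := dedZ_odd_modulus C0 oC psi_coprime.
have [e Ee] : exists e, (C * C = 8 * e + 1)%Z.
  have [d D1] := odd_mod8 oC.
  by case: D1 => [|[|[|]]] ->; [exists (8 * d * d + 2 * d)%Z | exists (8 * d * d + 6 * d + 1)%Z | exists (8 * d * d + 10 * d + 3)%Z | exists (8 * d * d + 14 * d + 6)%Z]; ring.
move: HP; rewrite /psi_eqn => E.
exists (- e * P + C * w - 2 * e)%Z.
have : (P = C * (C * P) - 8 * e * P)%Z by rewrite Z.mul_assoc Ee; ring.
rewrite E => EP; rewrite {1}EP.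
have -> : dedZ (- D) C = (C + 1 - 2 * kron (- D) (Z.abs_nat C) + 8 * w)%Z by lia.
move: (kron _ _) => x.
have -> : (C * (A + D + (C + 1 - 2 * x + 8 * w) - 3 * C) = C * (A + D) + C - 2 * C * x + 8 * C * w - 2 * (C * C))%Z by ring.
rewrite Ee; ring.
Qed.

(** Counterpart of the odd [C] case: the odd number [D] makes [D P] determine [P] modulo 8, and the
    symbol has its entries exchanged because the Dedekind sum is evaluated modulo [|D|]. *)
Lemma psi_mod8_oddD : (D mod 2 = 1)%Z ->
  (8 | D * P - (B - C - 3 - 2 * kron C (Z.abs_nat D) - 3 * D))%Z.
Proof.
move=> oD; have oD' : ((- D) mod 2 = 1)%Z by mlia.
have [w Ew] := dedZ_odd C0 psi_coprime oD'.
rewrite Zabs_nat_opp in Ew.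
move: HP; rewrite /psi_eqn => E.
exists (- w)%Z; apply: (Z.mul_reg_l _ _ C); first lia.
move: (kron _ _) Ew => x Ew.
have -> : (C * (D * P - (B - C - 3 - 2 * x - 3 * D)) = D * (C * P) - B * C + C * C + 3 * C + 2 * C * x + 3 * C * D)%Z by ring.
rewrite E; lia.
Qed.
End PsiInt.

Lemma Psi_pos A B C D P : (A * D - B * C = 1)%Z -> (0 < C)%Z -> psi_eqn A B C D P ->
  Psi A B C D = IZR P.
Proof.
move=> det C0 E; rewrite /Psi (proj2 (Z.ltb_lt 0 C) C0).
have := dedekind_dedZ C0 (psi_coprime det).
have kR : (IZR C <> 0)%R by apply: not_0_IZR; lia.
move=> Es; apply: (Rmult_eq_reg_l (IZR C)) => //.
move: E Es; rewrite /psi_eqn; move: (dedZ _ _) => S E Es.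
by rewrite -mult_IZR E !(plus_IZR, minus_IZR, mult_IZR) -Es; field.
Qed.

(** Conjugation by diag(1, -1) negates [Psi], which reduces negative [C] to positive. *)
Lemma Psi_neg A B C D P : (A * D - B * C = 1)%Z -> (0 < - C)%Z -> psi_eqn A (- B) (- C) D P ->
  Psi A B C D = IZR (- P).
Proof.
move=> det C0 E; rewrite /Psi.
have -> : (0 <? C)%Z = false by apply/Z.ltb_ge; lia.
have -> : (C <? 0)%Z by apply/Z.ltb_lt; lia.
have cop : coprime (Z.abs_nat D) (Z.abs_nat (- C)).
  by apply: (@bezout_coprime _ _ A B); lia.
have Es := dedekind_dedZ C0 cop.
have kR : (IZR C <> 0)%R by apply: not_0_IZR; lia.
apply: (Rmult_eq_reg_l (IZR (- C))); last by apply: not_0_IZR; lia.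
rewrite -mult_IZR (_ : (- C * - P = - (- C * P))%Z); last ring.
move: E Es; rewrite /psi_eqn (dedZ_opp C0 cop); move: (dedZ _ _) => S E Es.
rewrite E !(opp_IZR, plus_IZR, minus_IZR, mult_IZR) in Es *.
by rewrite -Es; field.
Qed.

End PsiIntegrality.

(** * Sign bits and reciprocity with signed or even entries *)

Module PsiKronecker.

Require Import Defs.
Import DedekindSums GaussLemma KroneckerSymbol DedekindKronecker PsiIntegrality.
From Stdlib Require Import Reals ZArith Lia Lra Zdiv.
From mathcomp Require Import all_boot.
From mathcomp Require Import zify.
Delimit Scope R_scope with R.
Set Implicit Arguments. Unset Strict Implicit. Unset Printing Implicit Defensive.

Local Arguments Z.mul : simpl never.
Local Arguments Z.add : simpl never.
Local Arguments Z.sub : simpl never.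
Local Arguments Z.of_nat : simpl never.

(** The value of [Psi] for [C > 0]; the division is exact as soon as [A], [C], [D] belong to an
    integral matrix of determinant 1. *)
Definition psiZ A C D : Z := ((A + D + dedZ (- D) C - 3 * C) / C)%Z.

Lemma psiZP A B C D : (A * D - B * C = 1)%Z -> (0 < C)%Z -> psi_eqn A B C D (psiZ A C D).
Proof.
move=> det C0; have [P E] := psi_eqn_exists det C0.
by rewrite /psi_eqn /psiZ -E (Z.mul_comm C P) Z.div_mul; lia.
Qed.

(** The exponent of a sign, [u = (-1) ^ sbit u]. It turns products of symbols into sums modulo 2,
    which is how they occur in [Psi] modulo 8. *)
Definition sbit (u : Z) : Z := if (u =? -1)%Z then 1%Z else 0%Z.
Definition pm (u : Z) : Prop := (u = 1 \/ u = -1)%Z.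

Lemma pmE u : pm u -> (u = 1 - 2 * sbit u)%Z.
Proof. by case=> ->. Qed.

Lemma neg01 u : (sbit u = 0 \/ sbit u = 1)%Z.
Proof. by rewrite /sbit; case: Z.eqb; [right|left]. Qed.

Lemma negM u v : pm u -> pm v -> (2 | sbit (u * v) - (sbit u + sbit v))%Z.
Proof. by case=> ->; case=> ->; [exists 0%Z|exists 0%Z|exists 0%Z|exists (-1)%Z]. Qed.

Lemma pmM u v : pm u -> pm v -> pm (u * v).
Proof. by case=> ->; case=> ->; [left|right|right|left]. Qed.

Lemma pm_kron m n : 0 < n -> coprime (Z.abs_nat m) n -> pm (kron m n).
Proof. by move=> n0 c; apply: kron_pm. Qed.

Lemma neg_kronN1 n : odd n -> (8 | 4 * sbit (kron (-1) n) - 2 * (Z.of_nat n - 1))%Z.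
Proof.
move=> on; have [w Ew] := kronN1 on.
have : pm (kron (-1) n) by apply: pm_kron; [exact: odd_gt0|rewrite coprime1n].
by move=> X; apply/Z.mod_divide => //; case: X Ew => -> Ew; rewrite /sbit /=; mlia.
Qed.

(** For negative [y] the symbol (-1/m) that appears is exactly the change of [qrsgn] when [y] is
    replaced by [- y]. *)
Lemma signed_reciprocity (m : nat) (y : Z) : odd m -> (y mod 2 = 1)%Z -> coprime m (Z.abs_nat y) ->
  kron (Z.of_nat m) (Z.abs_nat y) = (qrsgn (Z.of_nat m) y * kron y m)%Z.
Proof.
move=> om oy c; have Ea := Zabs2Nat.id_abs y.
have oY : odd (Z.abs_nat y).
  by have := odd_double_half (Z.abs_nat y); rewrite -muln2; case: odd => //; mlia.
rewrite kron_reciprocity // Ea.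
case: (Z.lt_ge_cases y 0) => s; last by rewrite Z.abs_eq; [|lia].
rewrite Z.abs_neq; last lia.
have -> : (- y = -1 * y)%Z by ring.
rewrite kronMl ?odd_gt0 // Z.mul_assoc; congr (_ * _)%Z.
have [w Ew] := kronN1 om.
have : pm (kron (-1) m) by apply: pm_kron; [exact: odd_gt0|rewrite coprime1n].
have -> : (-1 * y = - y)%Z by ring.
move: (kron (-1) m) (Z.of_nat m) (odd_Zmod om) Ew => u M oM Ew X.
have M4 : (M mod 4 = 1 \/ M mod 4 = 3)%Z by mlia.
have Y4 : (y mod 4 = 1 /\ (- y) mod 4 = 3 \/ y mod 4 = 3 /\ (- y) mod 4 = 1)%Z by mlia.
rewrite /qrsgn.
case: M4 => m4; case: Y4 => - [-> ->]; rewrite m4; case: X Ew => -> Ew //=; mlia.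
Qed.

(** The nontrivial character modulo 4 evaluated at the odd part of [n]; its bit at [varpi] is
    [delta]. *)
Definition chi4 (n : nat) : Z := if (n %/ 2 ^ logn 2 n) %% 4 == 3 then (-1)%Z else 1%Z.

Lemma neg_qrsgn m y : (y mod 2 = 1)%Z ->
  sbit (qrsgn m y) = (if (m mod 4 =? 3)%Z then (if (y mod 4 =? 3)%Z then 1 else 0) else 0)%Z.
Proof. by rewrite /qrsgn; case: Z.eqb; case: Z.eqb. Qed.

Lemma kron_2_even m : (m mod 2 = 1)%Z -> 
  kron m 2 = (if ((m mod 8 =? 1) || (m mod 8 =? 7))%Z then 1 else -1)%Z.
Proof.
move=> om; rewrite kron_prime // /kron_p /=.
have -> : Z.even m = false by rewrite Zeven_mod; apply/Z.eqb_neq; lia.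
by [].
Qed.

Lemma odd_abs_nat y : (y mod 2 = 1)%Z -> odd (Z.abs_nat y).
Proof.
by move=> oy; have := Zabs2Nat.id_abs y; have := odd_double_half (Z.abs_nat y); rewrite -muln2; case: odd => //; mlia.
Qed.

Lemma kron_2_abs m : (m mod 2 = 1)%Z -> kron 2 (Z.abs_nat m) = kron m 2.
Proof.
move=> om; rewrite kron2n ?odd_abs_nat // !kron_2_even //; last by rewrite Zabs2Nat.id_abs; mlia.
rewrite Zabs2Nat.id_abs.
have [u U] := odd_mod8 om.
case: (Z.lt_ge_cases m 0) => s; last by rewrite Z.abs_eq; [|lia].
rewrite Z.abs_neq; last lia.
have : (m mod 8 = 1 /\ (- m) mod 8 = 7 \/ m mod 8 = 3 /\ (- m) mod 8 = 5 \/
        m mod 8 = 5 /\ (- m) mod 8 = 3 \/ m mod 8 = 7 /\ (- m) mod 8 = 1)%Z by mlia.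
by case=> [|[|[|]]] [-> ->].
Qed.

(* The Kronecker symbols below and above [m] differ by a quadratic reciprocity sign
   on the odd part of [m] and by [kron (a q) 2] on its 2-part. *)
Lemma kron_flip (m : nat) (a q : Z) : 0 < m -> (a mod 2 = 1)%Z -> (q mod 2 = 1)%Z ->
  (Z.of_nat m | a * q - 1)%Z ->
  (2 | sbit (kron (Z.of_nat m) (Z.abs_nat q)) - (sbit (kron a m)
     + Z.of_nat (logn 2 m) * sbit (kron (a * q) 2) + sbit (chi4 m) * (if (q mod 4 =? 3)%Z then 1 else 0)))%Z.
Proof.
move=> m0 oa oq [w Ew].
have q0 : 0 < Z.abs_nat q by apply: odd_gt0; apply: odd_abs_nat.
have Em : m = (2 ^ logn 2 m * (m %/ 2 ^ logn 2 m))%N by rewrite mulnC divnK // pfactor_dvdnn.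
set e := logn 2 m in Em *; set o := (m %/ 2 ^ e)%N in Em.
have o0 : 0 < o by move: m0; rewrite Em muln_gt0 => /andP[].
have oo : odd o.
  have := pfactor_coprime (isT : prime 2) m0 => - [o' co' E'].
  have : o = o' by rewrite /o E' mulnK // expn_gt0.
  by move=> ->; rewrite -coprime2n.
have cq : coprime m (Z.abs_nat q).
  rewrite -(Zabs2Nat.id m); apply: (@bezout_coprime _ _ (- w) a); lia.
have ca : coprime (Z.abs_nat a) m.
  rewrite -(Zabs2Nat.id m); apply: (@bezout_coprime _ _ q (- w)); lia.
have coq : coprime o (Z.abs_nat q) by move: cq; rewrite Em coprimeMl => /andP[].
have cao : coprime (Z.abs_nat a) o by move: ca; rewrite Em coprimeMr => /andP[].
have cqo : coprime (Z.abs_nat q) o by rewrite coprime_sym.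
have P2q : pm (kron 2 (Z.abs_nat q)) by apply: pm_kron => //; rewrite coprime2n odd_abs_nat.
have P2a : pm (kron a 2) by apply: pm_kron => //; rewrite coprimen2 odd_abs_nat.
have Pao : pm (kron a o) by apply: pm_kron.
have Pqo : pm (kron q o) by apply: pm_kron.
have kpow1 i : kron (Z.of_nat (2 ^ i)) (Z.abs_nat q) = (kron 2 (Z.abs_nat q) ^ Z.of_nat i)%Z.
  elim: i => [|i IH]; first exact: kron1n.
  by rewrite expnS Nat2Z.inj_mul kronMl // IH (Nat2Z.inj_succ i) Z.pow_succ_r //; lia.
have kpow2 i : kron a (2 ^ i) = (kron a 2 ^ Z.of_nat i)%Z.
  elim: i => [|i IH]; first by [].
  by rewrite expnS kronM // ?expn_gt0 // IH (Nat2Z.inj_succ i) Z.pow_succ_r //; lia.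
have pmpow u i : pm u -> pm (u ^ Z.of_nat i).
  move=> U; elim: i => [|i IH]; first by left.
  by rewrite (Nat2Z.inj_succ i) Z.pow_succ_r; [apply: pmM|lia].
have negpow u i : pm u -> (2 | sbit (u ^ Z.of_nat i) - Z.of_nat i * sbit u)%Z.
  move=> U; elim: i => [|i [v IH]]; first by exists 0%Z.
  rewrite (Nat2Z.inj_succ i) Z.pow_succ_r; last lia.
  by have [t T] := negM U (pmpow _ i U); exists (v + t)%Z; lia.
have E1 : kron (Z.of_nat m) (Z.abs_nat q) = (kron q 2 ^ Z.of_nat e * (qrsgn (Z.of_nat o) q * kron q o))%Z.
  by rewrite {1}Em Nat2Z.inj_mul kronMl // kpow1 kron_2_abs // signed_reciprocity.
have E2 : kron a m = (kron a 2 ^ Z.of_nat e * kron a o)%Z.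
  by rewrite {1}Em kronM // ?expn_gt0 // kpow2.
(* [q] and [a] are inverse modulo the odd part of [m], and a sign is its own inverse. *)
have E3 : kron q o = kron a o.
  have : (kron q o * kron a o = 1)%Z.
    rewrite -kronMl // -(kron1n o); apply: kron_mod => //.
    by exists (w * Z.of_nat (2 ^ e))%Z; rewrite Z.mul_comm Ew {1}Em; lia.
  by case: Pqo => ->; case: Pao => ->; lia.
rewrite E1 E2 E3 kronMl //.
rewrite -kron_2_abs // in E1 *.
have Ps : pm (qrsgn (Z.of_nat o) q) by rewrite /qrsgn; case: andb; [right|left].
have [t1 T1] := negM (pmpow _ e P2q) (pmM Ps Pao).
have [t2 T2] := negM Ps Pao.
have [t3 T3] := negpow _ e P2q.
have [t4 T4] := negM (pmpow _ e P2a) Pao.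
have [t5 T5] := negpow _ e P2a.
have [t6 T6] := negM P2a P2q.
have T7 : sbit (qrsgn (Z.of_nat o) q) = (sbit (chi4 m) * (if (q mod 4 =? 3)%Z then 1 else 0))%Z.
  rewrite neg_qrsgn // /chi4 -/e -/o -[4%Z]/(Z.of_nat 4) modn_Z //.
  have -> : (Z.of_nat (o %% 4) =? 3)%Z = (o %% 4 == 3) by apply/idP/idP; lia.
  by case: eqP; case: Z.eqb.
exists (t1 + t2 + t3 - t4 - t5 - (t6 + sbit (kron a 2)) * Z.of_nat e)%Z.
rewrite T7 in T2 T1.
have -> : sbit (kron 2 (Z.abs_nat q) ^ Z.of_nat e * (qrsgn (Z.of_nat o) q * kron a o)) = (t1 * 2 + (sbit (kron 2 (Z.abs_nat q) ^ Z.of_nat e) + sbit (qrsgn (Z.of_nat o) q * kron a o)))%Z by lia.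
have -> : sbit (kron a 2 * kron 2 (Z.abs_nat q)) = (t6 * 2 + (sbit (kron a 2) + sbit (kron 2 (Z.abs_nat q))))%Z by lia.
lia.
Qed.

End PsiKronecker.

(** * The two Psi values attached to one divisor of N *)

Module PsiPairs.

Require Import Defs.
Import DedekindSums GaussLemma KroneckerSymbol DedekindKronecker PsiIntegrality PsiKronecker.
From Stdlib Require Import Reals ZArith Lia Lra Zdiv.
From mathcomp Require Import all_boot.
From mathcomp Require Import zify.
Delimit Scope R_scope with R.
Set Implicit Arguments. Unset Strict Implicit. Unset Printing Implicit Defensive.
Local Arguments Z.mul : simpl never.
Local Arguments Z.add : simpl never.
Local Arguments Z.sub : simpl never.
Local Arguments Z.of_nat : simpl never.

(** For [m = N / n] the two matrices of the Hecke coefficient have lower left entries [- m d] and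
    [m]; the negative one enters through [Psi_neg], hence the minus sign. *)
Definition psi_pair (N a b x y : Z) (m d : nat) : Z :=
  (psiZ (a * y) (Z.of_nat m) x - psiZ (- N * b + a * x) (Z.of_nat m * Z.of_nat d) y)%Z.

Lemma abs_nat_mul m d : Z.abs_nat (Z.of_nat m * Z.of_nat d) = (m * d)%N.
Proof. by rewrite -Nat2Z.inj_mul Zabs2Nat.id. Qed.

Section Pair.
Variables (N n a b x y z : Z) (m d : nat).
Hypotheses (EN : N = (n * Z.of_nat m)%Z) (m0 : 0 < m) (d0 : 0 < d).
Hypothesis xyzE : ((- N * b + a * x) * y + N * Z.of_nat d * z = 1)%Z.
Let M := Z.of_nat m.
Let D := Z.of_nat d.
Let t := (b * y - D * z)%Z.
Let E := psi_pair N a b x y m d.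

Lemma pair_det1 : ((- N * b + a * x) * y - (- (z * n)) * (M * D) = 1)%Z.
Proof.
have -> : ((- N * b + a * x) * y - (- (z * n)) * (M * D) = (- N * b + a * x) * y + (n * M) * D * z)%Z by ring.
by rewrite /M -EN.
Qed.

Lemma pair_det2 : (a * y * x - (t * n) * M = 1)%Z.
Proof.
have -> : (a * y * x - (t * n) * M = a * y * x - (n * M) * t)%Z by ring.
by rewrite /M -EN /t; have := xyzE; rewrite -/D; lia.
Qed.

(** Modulo every divisor of [N] the numbers [a] and [x y] are inverse; this is how the auxiliary [x]
    and [y] are removed from the symbols. *)
Lemma axyE : (a * (x * y) = 1 + N * t)%Z.
Proof. by have := pair_det2; rewrite EN -/M; lia. Qed.

Let M0 : (0 < M)%Z. Proof. by rewrite /M; lia. Qed.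
Let MD0 : (0 < M * D)%Z. Proof. by rewrite /M /D; nia. Qed.
Let H1 := psiZP pair_det1 MD0.
Let H2 := psiZP pair_det2 M0.

Lemma Psi_pair : (0 < n)%Z ->
  (Psi (- N * b + a * x) (z * n) (- N * D / n) y + Psi (a * y) (t * n) (N / n) x = IZR E)%R.
Proof.
move=> n0.
have -> : (- N * D / n = - (M * D))%Z.
  have -> : (- N * D = - (M * D) * n)%Z by rewrite EN /M /D; ring.
  by rewrite Z.div_mul //; lia.
have -> : (N / n = M)%Z by rewrite EN Z.mul_comm Z.div_mul //; lia.
rewrite (Psi_pos pair_det2 M0 H2).
rewrite (@Psi_neg _ _ _ _ (psiZ (- N * b + a * x) (M * D) y)).
- rewrite /E /psi_pair -/M -/D; move: (psiZ (a * y) M x) (psiZ _ (M * D) y) => p q.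
  by rewrite minus_IZR opp_IZR; ring.
- by have := pair_det1; lia.
- by lia.
- by rewrite Z.opp_involutive; exact: H1.
Qed.

Lemma pair_mod3 : (3 | E - (M * ((a * y + x) - t * x * N - D * (a * x - N * b + y) - z * y * D * D * N)
    + n * (t * x + z * y)))%Z.
Proof.
have [q1 Q1] := psi_mod3 pair_det1 MD0 H1; have [q2 Q2] := psi_mod3 pair_det2 M0 H2.
exists (q2 - q1)%Z; rewrite /E /psi_pair -/M -/D.
rewrite Z.mul_sub_distr_r -Q1 -Q2; rewrite EN -/M; ring.
Qed.

Lemma pair_coprime_y : coprime (Z.abs_nat y) (m * d).
Proof. by rewrite -abs_nat_mul; apply: (@bezout_coprime _ _ (- N * b + a * x) (z * n)); have := pair_det1; lia. Qed.

Lemma pair_coprime_x : coprime (Z.abs_nat x) m.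
Proof. by rewrite -(Zabs2Nat.id m); apply: (@bezout_coprime _ _ (a * y) (- (t * n))); have := pair_det2; rewrite /M; lia. Qed.

Lemma pair_coprime_a : coprime (Z.abs_nat a) m.
Proof. by rewrite -(Zabs2Nat.id m); apply: (@bezout_coprime _ _ (x * y) (- (t * n))); have := pair_det2; rewrite /M; lia. Qed.

Let cym : coprime (Z.abs_nat y) m.
Proof. by move: pair_coprime_y; rewrite coprimeMr => /andP[]. Qed.
Let cyd : coprime (Z.abs_nat y) d.
Proof. by move: pair_coprime_y; rewrite coprimeMr => /andP[]. Qed.
Let Pym := pm_kron m0 cym.
Let Pxm := pm_kron m0 pair_coprime_x.
Let Pam := pm_kron m0 pair_coprime_a.

Lemma kron_xy_a : odd m -> (kron x m * kron y m = kron a m)%Z.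
Proof.
move=> om.
have : (kron a m * (kron x m * kron y m) = 1)%Z.
  rewrite -!kronMl // axyE; transitivity (kron 1 m); last exact: kron1n.
  apply: kron_mod => //.
  by exists (n * t)%Z; rewrite EN; ring.
by case: Pym => ->; case: Pxm => ->; case: Pam => ->; lia.
Qed.

Lemma kron_opp u k : 0 < k -> kron (- u) k = (kron (-1) k * kron u k)%Z.
Proof. by move=> k0; rewrite -kronMl //; congr kron; ring. Qed.

Lemma pm_kronN1 k : 0 < k -> pm (kron (-1) k).
Proof. by move=> k0; apply: pm_kron => //; rewrite coprime1n. Qed.

(** The entries [m d] and [m] are both odd, so each value is read from the symbol modulo that entry;
    the symbols of [x] and [y] modulo [m] combine to that of [a]. *)
Lemma pair_mod8_odd : odd m -> odd d ->
  (8 | E - (M * (a * y + x - D * (a * x - N * b + y) + (D - 1)) + 4 * sbit (kron a m) + 4 * sbit (kron (- y) d)))%Z.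
Proof.
move=> om od.
have oM := odd_Zmod om; have oD := odd_Zmod od.
have oMD : ((M * D) mod 2 = 1)%Z by rewrite /M /D -Nat2Z.inj_mul; apply: odd_Zmod; rewrite oddM om.
have [q1 Q1] := psi_mod8_oddC pair_det1 MD0 H1 oMD; have [q2 Q2] := psi_mod8_oddC pair_det2 M0 H2 oM.
rewrite abs_nat_mul kronM // in Q1; rewrite Zabs2Nat.id in Q2.
have P1 := pm_kronN1 m0.
have Pyd : pm (kron (- y) d) by apply: pm_kron => //; rewrite Zabs_nat_opp.
rewrite !(@kron_opp _ m) // in Q1 Q2.
have Eu : (kron (-1) m * kron y m * kron (- y) d = (kron (-1) m * kron x m) * (kron a m * kron (- y) d))%Z.
  rewrite -kron_xy_a //.
  have -> : (kron (-1) m * kron x m * (kron x m * kron y m * kron (- y) d) = kron (-1) m * kron y m * kron (- y) d * (kron x m * kron x m))%Z by ring.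
  by case: Pxm => ->; ring.
rewrite Eu in Q1.
move: (pmE (pmM P1 Pxm)) (negM (pmM P1 Pxm) (pmM Pam Pyd)) (negM Pam Pyd) (pmE (pmM (pmM P1 Pxm) (pmM Pam Pyd))).
move: Q1 Q2; move: (kron (-1) m * kron x m)%Z => v.
move: (kron a m * kron (- y) d)%Z => w.
move: (v * w)%Z => u.
rewrite /E /psi_pair -/M -/D.
move: (sbit (kron a m)) (sbit (kron (- y) d)) (sbit u) (sbit v) (sbit w) => na ny nu nv nw Q1 Q2 Ev [s1 S1] [s2 S2] Eu'.
have [M' EM'] : exists M', M = (2 * M' + 1)%Z by exists (M / 2)%Z; mlia.
have [D' ED'] : exists D', D = (2 * D' + 1)%Z by exists (D / 2)%Z; mlia.
rewrite Eu' in Q1; rewrite Ev in Q2.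
have {}S1 : nu = (nv + nw + 2 * s1)%Z by lia.
have {}S2 : nw = (na + ny + 2 * s2)%Z by lia.
subst nu nw.
have -> : psiZ (a * y) M x = (q2 * 8 + (M * (a * y + x) + M - 2 - 2 * M * (1 - 2 * nv)))%Z by lia.
have -> : psiZ (- N * b + a * x) (M * D) y = (q1 * 8 + (M * D * (- N * b + a * x + y) + M * D - 2 - 2 * (M * D) * (1 - 2 * (nv + (na + ny + 2 * s2) + 2 * s1))))%Z by lia.
exists (q2 - q1 - M * D * (s1 + s2) - M * nv * D' - (2 * M' * D' + M' + D' + 1) * (na + ny))%Z.
by rewrite EM' ED'; ring.
Qed.

(** [m d] may be even, so the first matrix goes through its odd entry [y] and the second still
    through [m]. The sign of reciprocity between [m] and [y], together with (-1/m), leaves the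
    [chi4] term. *)
Lemma pair_mod8_mid : odd m -> (y mod 2 = 1)%Z ->
  (8 | y * E - (M * (y * (a * y + x) - y + D) + z * n + (y + 5) + 4 * sbit (kron D (Z.abs_nat y))
     + 4 * sbit (kron a m) + 4 * (sbit (chi4 m) * (if (y mod 4 =? 1)%Z then 1 else 0))))%Z.
Proof.
move=> om oy.
have oM := odd_Zmod om.
have y0 : 0 < Z.abs_nat y by apply: odd_gt0; apply: odd_abs_nat.
have [q1 Q1] := psi_mod8_oddD pair_det1 MD0 H1 oy; have [q2 Q2] := psi_mod8_oddC pair_det2 M0 H2 oM.
rewrite Zabs2Nat.id kron_opp // in Q2.
have cmy : coprime m (Z.abs_nat y) by rewrite coprime_sym.
rewrite kronMl // signed_reciprocity // in Q1.
have Pq : pm (qrsgn (Z.of_nat m) y) by rewrite /qrsgn; case: andb; [right|left].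
have Pd : pm (kron D (Z.abs_nat y)) by apply: pm_kron => //; rewrite /D Zabs2Nat.id coprime_sym.
have P1 := pm_kronN1 m0.
have Eq : sbit (qrsgn (Z.of_nat m) y) = (sbit (chi4 m) * (if (y mod 4 =? 3)%Z then 1 else 0))%Z.
  rewrite neg_qrsgn // /chi4 (_ : logn 2 m = 0); last by rewrite lognE dvdn2 om !andbF.
  rewrite expn0 divn1 -[4%Z]/(Z.of_nat 4) modn_Z //.
  have -> : (Z.of_nat (m %% 4) =? 3)%Z = (m %% 4 == 3) by apply/idP/idP; lia.
  by case: eqP; case: Z.eqb.
have E1 : sbit (kron (-1) m) = sbit (chi4 m).
  rewrite /chi4 (_ : logn 2 m = 0); last by rewrite lognE dvdn2 om !andbF.
  rewrite expn0 divn1; have [w W] := kronN1 om.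
  have : m %% 4 = 1 \/ m %% 4 = 3 by lia.
  by case=> h; rewrite h /=; case: P1 W => -> W //; lia.
have [s1 S1] := negM P1 Pxm.
have [s2 S2] := negM (pmM Pq Pym) Pd.
have [s3 S3] := negM Pq Pym.
have [s4 S4] := negM Pxm Pym.
rewrite kron_xy_a // in S4.
have Ev := pmE (pmM P1 Pxm); have Eu := pmE (pmM (pmM Pq Pym) Pd).
rewrite Eu in Q1; rewrite Ev in Q2.
have [j Ej] : exists j, (y * M = 2 * j + 1)%Z.
  have [u ->] : exists u, y = (2 * u + 1)%Z by exists (y / 2)%Z; mlia.
  have [v ->] : exists v, M = (2 * v + 1)%Z by exists (M / 2)%Z; mlia.
  by exists (2 * u * v + u + v)%Z; ring.
have Ei : ((if (y mod 4 =? 1)%Z then 1 else 0) = 1 - (if (y mod 4 =? 3)%Z then 1 else 0))%Z.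
  by have [->|->] : (y mod 4 = 1 \/ y mod 4 = 3)%Z by mlia.
rewrite Ei; rewrite Eq in S3; rewrite E1 in S1.
move: S1 S2 S3 S4 Q1 Q2; rewrite /E /psi_pair -/M -/D.
move: (sbit (kron (-1) m * kron x m)) (sbit (qrsgn _ _ * _ * _)) (sbit (qrsgn _ _ * _)) => nv nu nM.
move: (sbit (kron a m)) (sbit (kron x m)) (sbit (kron y m)) (sbit (kron D (Z.abs_nat y))) (sbit (chi4 m)) (if (y mod 4 =? 3)%Z then 1 else 0)%Z => na nx ny nd nc h S1 S2 S3 S4 Q1 Q2.
have {}Q2 : psiZ (a * y) M x = (q2 * 8 + (M * (a * y + x) + M - 2 - 2 * M * (1 - 2 * nv)))%Z by lia.
have {}Q1 : (y * psiZ (- N * b + a * x) (M * D) y = q1 * 8 + (- (z * n) - M * D - 3 - 2 * (1 - 2 * nu) - 3 * y))%Z by lia.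
rewrite Z.mul_sub_distr_l Q1 Q2.
exists (y * q2 - q1 + (j * nv + s1 - nd - ny - s2 - s3 - s4))%Z.
have -> : nu = (nM + nd + 2 * s2)%Z by lia.
have -> : nM = (nc * h + ny + 2 * s3)%Z by lia.
have -> : na = (nx + ny + 2 * s4)%Z by lia.
have -> : (y * (q2 * 8 + (M * (a * y + x) + M - 2 - 2 * M * (1 - 2 * nv))) = y * q2 * 8 + y * M * (a * y + x) - y * M - 2 * y + 4 * (y * M) * nv)%Z by ring.
rewrite Ej; have -> : nv = (nc + nx + 2 * s1)%Z by lia.
have -> : (M * (y * (a * y + x) - y + D) = y * M * (a * y + x) - y * M + M * D)%Z by ring.
rewrite Ej; ring.
Qed.

(** [m] may be even, so both matrices go through the odd entries [x] and [y]. [kron_flip] turns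
    (m/|x y|) into a symbol modulo [m], at the price of the terms with the 2-adic valuation and
    [chi4]. *)
Lemma pair_mod8_even : (a mod 2 = 1)%Z -> (x mod 2 = 1)%Z -> (y mod 2 = 1)%Z ->
  (8 | x * y * E - (n * (x * z + y * t) + M * (x * D - y) + 5 * (x - y) + 4 * sbit (kron D (Z.abs_nat y))
     + 4 * sbit (kron a m) + 4 * (Z.of_nat (logn 2 m) * sbit (kron (a * (x * y)) 2))
     + 4 * (sbit (chi4 m) * (if ((x * y) mod 4 =? 3)%Z then 1 else 0))))%Z.
Proof.
move=> oa ox oy.
have y0 : 0 < Z.abs_nat y by apply: odd_gt0; apply: odd_abs_nat.
have x0 : 0 < Z.abs_nat x by apply: odd_gt0; apply: odd_abs_nat.
have [q1 Q1] := psi_mod8_oddD pair_det1 MD0 H1 oy; have [q2 Q2] := psi_mod8_oddD pair_det2 M0 H2 ox.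
rewrite kronMl // in Q1.
have Pd : pm (kron D (Z.abs_nat y)) by apply: pm_kron => //; rewrite /D Zabs2Nat.id coprime_sym.
have PMy : pm (kron M (Z.abs_nat y)) by apply: pm_kron => //; rewrite /M Zabs2Nat.id coprime_sym.
have PMx : pm (kron M (Z.abs_nat x)).
  by apply: pm_kron => //; rewrite /M Zabs2Nat.id coprime_sym; exact: pair_coprime_x.
have [x' Ex] : exists x', x = (2 * x' + 1)%Z by exists (x / 2)%Z; mlia.
have [y' Ey] : exists y', y = (2 * y' + 1)%Z by exists (y / 2)%Z; mlia.
have oxy : ((x * y) mod 2 = 1)%Z by rewrite Z.mul_mod // ox oy.
have [s3 S3] : (2 | sbit (kron M (Z.abs_nat (x * y))) - (sbit (kron a m)
     + Z.of_nat (logn 2 m) * sbit (kron (a * (x * y)) 2) + sbit (chi4 m) * (if ((x * y) mod 4 =? 3)%Z then 1 else 0)))%Z.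
  by apply: kron_flip => //; exists (n * t)%Z; rewrite axyE EN; ring.
rewrite Zabs2Nat.inj_mul multE kronM // in S3.
have [s2 S2] := negM PMx PMy.
have [s1 S1] := negM PMy Pd.
rewrite (pmE PMx) in Q2; rewrite (pmE (pmM PMy Pd)) in Q1.
move: S1 S2 S3 Q1 Q2; rewrite /E /psi_pair -/M -/D.
move: (sbit (kron M (Z.abs_nat y) * _)) (sbit (kron M (Z.abs_nat x) * _)) => nu nMM.
move: (sbit (kron M (Z.abs_nat x))) (sbit (kron M (Z.abs_nat y))) (sbit (kron D _)) => nv nM nd.
move: (sbit (kron a m)) (Z.of_nat (logn 2 m) * _)%Z (sbit (chi4 m) * _)%Z => na n2 nc S1 S2 S3 Q1 Q2.
have {}Q1 : (y * psiZ (- N * b + a * x) (M * D) y = q1 * 8 + (- (z * n) - M * D - 3 - 2 * (1 - 2 * nu) - 3 * y))%Z by lia.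
have {}Q2 : (x * psiZ (a * y) M x = q2 * 8 + (t * n - M - 3 - 2 * (1 - 2 * nv) - 3 * x))%Z by lia.
have -> : (x * y * (psiZ (a * y) M x - psiZ (- N * b + a * x) (M * D) y) = y * (x * psiZ (a * y) M x) - x * (y * psiZ (- N * b + a * x) (M * D) y))%Z by ring.
rewrite Q1 Q2.
have -> : nu = (nM + nd + 2 * s1)%Z by lia.
have -> : nM = (na + n2 + nc + 2 * s3 - nv - 2 * s2)%Z by lia.
move: (t) => t'.
exists (y * q2 - x * q1 + y' * nv - x' * (na + n2 + nc + 2 * s3 - nv - 2 * s2 + nd + 2 * s1) + (- nd - (na + n2 + nc) - s3 + s2 - s1 + nv))%Z.
rewrite Ex Ey; ring.
Qed.
End Pair.

End PsiPairs.

(** * Residual congruences modulo 8 by finite checks *)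

Module CongruencesMod8.

Require Import Defs.
Import DedekindSums GaussLemma KroneckerSymbol DedekindKronecker PsiIntegrality PsiKronecker PsiPairs.
From Stdlib Require Import Reals ZArith Lia Lra Zdiv.
From mathcomp Require Import all_boot.
From mathcomp Require Import zify.
Delimit Scope R_scope with R.
Set Implicit Arguments. Unset Strict Implicit. Unset Printing Implicit Defensive.
Local Arguments Z.mul : simpl never.
Local Arguments Z.add : simpl never.
Local Arguments Z.sub : simpl never.
Local Arguments Z.of_nat : simpl never.

(** Quantification over residues as a boolean conjunction, so that computation decides it. *)
Definition all8 (P : Z -> bool) : bool :=
  [&& P 0, P 1, P 2, P 3, P 4, P 5, P 6 & P 7]%Z.

Lemma all8P P : all8 P -> forall z, P (z mod 8)%Z.
Proof.
do 7![case/andP => ?] => ? z.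
have : (0 <= z mod 8 < 8)%Z by apply: Z.mod_pos_bound.
move: (z mod 8)%Z => w W.
have [|[|[|[|[|[|[|]]]]]]] : (w = 0 \/ w = 1 \/ w = 2 \/ w = 3 \/ w = 4 \/ w = 5 \/ w = 6 \/ w = 7)%Z by lia.
all: by move=> ->.
Qed.

Definition all01 (P : Z -> bool) : bool := P 0%Z && P 1%Z.

Lemma all01P P : all01 P -> forall z, (z = 0 \/ z = 1)%Z -> P z.
Proof. by case/andP => ? ? z [] ->. Qed.

Lemma dcong_refl k u : (k | u - u)%Z.
Proof. by rewrite Z.sub_diag; exact: Z.divide_0_r. Qed.
Lemma dcong_add k u u' v v' : (k | u - u')%Z -> (k | v - v')%Z -> (k | (u + v) - (u' + v'))%Z.
Proof. by move=> [p P] [q Q]; exists (p + q)%Z; lia. Qed.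
Lemma dcong_mul k u u' v v' : (k | u - u')%Z -> (k | v - v')%Z -> (k | (u * v) - (u' * v'))%Z.
Proof.
move=> [p P] [q Q]; exists (p * v + u' * q)%Z.
have -> : (u * v - u' * v' = (u - u') * v + u' * (v - v'))%Z by ring.
by rewrite P Q; ring.
Qed.
Lemma dcong_opp k u u' : (k | u - u')%Z -> (k | (- u) - (- u'))%Z.
Proof. by move=> [p P]; exists (- p)%Z; lia. Qed.
Lemma dcong_mod8 u : (8 | u - u mod 8)%Z.
Proof. by exists (u / 8)%Z; have := Z.div_mod u 8; lia. Qed.
Ltac dcong := repeat first [exact: dcong_mod8 | exact: dcong_refl | apply: dcong_add | apply: dcong_opp | apply: dcong_mul].

(** What is left, multiplied by [x y], when 4 divides [N] and [d] is odd. Here [t] stands for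
    [(N / 4) (b y - d z)]; it enters as [4 t], so only its parity counts. *)
Definition f1 (a d x y t R e : Z) : Z := (0 - 4 * t * R + 5 * (x - y) * R + R * (a - 1) * (y - 1)
  + 2 * e * (x * y - 1) - 3 * (x * y) * (R + 2 * e) * ((d - 1) + (a * d - 1)))%Z.
Definition zodd (z : Z) := (z mod 2 =? 1)%Z.
Definition z8 (z : Z) := (z mod 8 =? 0)%Z.

Lemma zoddP z : (z mod 2 = 1)%Z -> zodd (z mod 8).
Proof. by move=> o; apply/Z.eqb_eq; mlia. Qed.
Lemma z8P u v : (8 | u - v)%Z -> (8 | u)%Z -> z8 v.
Proof. by move=> [w W] [p P]; apply/Z.eqb_eq; mlia. Qed.
Lemma z8E u v : (8 | u - v)%Z -> z8 v -> (8 | u)%Z.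
Proof. by move=> [w W] /Z.eqb_eq H; apply/Z.mod_divide => //; mlia. Qed.
Lemma zodd_parity z : zodd (z mod 8) -> (z mod 2 = 1)%Z.
Proof. by move/Z.eqb_eq; mlia. Qed.

Definition check1 := all8 (fun a => zodd a ==> all8 (fun d => zodd d ==> all8 (fun x => zodd x ==>
  all8 (fun y => zodd y ==> all01 (fun t => z8 (a * (x * y) - (1 + 4 * t)) ==>
   all01 (fun e => all8 (fun R => (zodd R ==> z8 (a * d - 1)) ==> z8 (f1 a d x y t R e))) ))))).
Lemma check1T : check1. Proof. by vm_compute. Qed.

(** The last hypothesis carries the square condition on [l]: an odd [R] means half-integral weight,
    and then [a d] is an odd square. *)
Lemma f1_dvd a d x y t R e : (a mod 2 = 1)%Z -> (d mod 2 = 1)%Z -> (x mod 2 = 1)%Z -> (y mod 2 = 1)%Z ->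
  (8 | a * (x * y) - (1 + 4 * t))%Z -> (e = 0 \/ e = 1)%Z -> ((R mod 2 = 1)%Z -> (8 | a * d - 1)%Z) ->
  (8 | f1 a d x y t R e)%Z.
Proof.
move=> oa od ox oy ht he hR.
wlog ht01 : t ht / (t = 0 \/ t = 1)%Z.
  move=> W; have [w [W0|W0]] : exists w, (t = 2 * w \/ t = 2 * w + 1)%Z by exists (t / 2)%Z; mlia.
    have [|q Q] := W 0%Z _ (or_introl erefl); first by case: ht => q Q; exists (q + w)%Z; lia.
    by exists (q - w * R)%Z; rewrite Z.mul_sub_distr_r -Q /f1 W0; ring.
  have [|q Q] := W 1%Z _ (or_intror erefl); first by case: ht => q Q; exists (q + w)%Z; lia.
  by exists (q - w * R)%Z; rewrite Z.mul_sub_distr_r -Q /f1 W0; ring.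
move: check1T; rewrite /check1 => /all8P/(_ a); rewrite zoddP // implyTb => /all8P/(_ d); rewrite zoddP // implyTb.
move/all8P/(_ x); rewrite zoddP // implyTb => /all8P/(_ y); rewrite zoddP // implyTb => /all01P/(_ t ht01).
rewrite (z8P _ ht) ?implyTb; last by dcong.
move/all01P/(_ e he)/all8P/(_ R).
have -> : zodd (R mod 8) ==> z8 (a mod 8 * (d mod 8) - 1).
  by apply/implyP => /zodd_parity/hR H; apply: z8P H; dcong.
rewrite implyTb; apply: z8E; rewrite /f1; dcong.
Qed.

Definition isq (i j q : Z) : Z := if ((q mod 8 =? i) || (q mod 8 =? j))%Z then 1%Z else 0%Z.

Lemma isq_cong i j q q' : (8 | q - q')%Z -> isq i j q = isq i j q'.
Proof. by move=> [w W]; rewrite /isq; have -> : (q mod 8 = q' mod 8)%Z by mlia. Qed.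

(** The analogue for [N] twice an odd [N1], with [V = N1 X] and [R] eliminated by a moment relation
    modulo 4. At odd [q], [isq 3 7 q] detects 3 modulo 4 and [isq 3 5 q] is the bit of (q/2). *)
Definition f2 (a d x y V S e : Z) : Z :=
  let R := (- (V + S) - 2 * e)%Z in
  (- (2 * isq 3 7 (a * (x * y)) * y * V) + y * (a * (x * y) - 1) * S + 5 * (x - y) * R
   + R * (a - 1) * (y - 1) + 2 * e * (x * y - 1) + 4 * V * isq 3 5 (a * (x * y))
   - 3 * (x * y) * (R + 2 * e) * ((d - 1) - (a * d - 1)))%Z.

Definition f2V (a d x y : Z) : Z := (4 * isq 3 5 (a * (x * y)) - 2 * isq 3 7 (a * (x * y)) * y
   - 5 * (x - y) - (a - 1) * (y - 1) + 3 * (x * y) * ((d - 1) - (a * d - 1)))%Z.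
Definition f2S (a d x y : Z) : Z := (y * (a * (x * y) - 1)
   - 5 * (x - y) - (a - 1) * (y - 1) + 3 * (x * y) * ((d - 1) - (a * d - 1)))%Z.
Definition f2e (a x y : Z) : Z := (2 * (x * y - 1) - 10 * (x - y) - 2 * (a - 1) * (y - 1))%Z.

(* [f2] is affine in [V], [S] and [e]; the first two coefficients are multiples of [a d - 1] mod 8. *)
Definition check2 := all8 (fun a => zodd a ==> all8 (fun d => zodd d ==> all8 (fun x => zodd x ==>
  all8 (fun y => zodd y ==> [&& ~~ all8 (fun u => ~~ z8 (f2V a d x y - u * (a * d - 1))),
    ~~ all8 (fun u => ~~ z8 (f2S a d x y - u * (a * d - 1))) & z8 (f2e a x y)])))).
Lemma check2T : check2. Proof. by vm_compute. Qed.

Lemma nall8 f : ~~ all8 (fun u => ~~ f u) -> exists u, f u.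
Proof. by rewrite /all8 !negb_and !negbK; do 7![case/orP => [H|]; first by eexists; exact: H]; eexists; eassumption. Qed.

Lemma f2_dvd a d x y V S e : (a mod 2 = 1)%Z -> (d mod 2 = 1)%Z -> (x mod 2 = 1)%Z -> (y mod 2 = 1)%Z ->
  (8 | (a * d - 1) * V)%Z -> (8 | (a * d - 1) * S)%Z -> (8 | f2 a d x y V S e)%Z.
Proof.
move=> oa od ox oy [v hV] [s hS].
move: check2T; rewrite /check2 => /all8P/(_ a); rewrite zoddP // implyTb => /all8P/(_ d); rewrite zoddP // implyTb.
move/all8P/(_ x); rewrite zoddP // implyTb => /all8P/(_ y); rewrite zoddP // implyTb.
have EV : (8 | f2V a d x y - f2V (a mod 8) (d mod 8) (x mod 8) (y mod 8))%Z.
  by rewrite /f2V -!(@isq_cong _ _ (a * (x * y))); by dcong.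
have ES : (8 | f2S a d x y - f2S (a mod 8) (d mod 8) (x mod 8) (y mod 8))%Z by rewrite /f2S; dcong.
have Ee : (8 | f2e a x y - f2e (a mod 8) (x mod 8) (y mod 8))%Z by rewrite /f2e; dcong.
case/and3P => /nall8 [u1 U1] /nall8 [u2 U2] U3.
have {EV} [w1 W1] : (8 | f2V a d x y - u1 * (a * d - 1))%Z by apply: z8E U1; apply: (dcong_add EV); dcong.
have {ES} [w2 W2] : (8 | f2S a d x y - u2 * (a * d - 1))%Z by apply: z8E U2; apply: (dcong_add ES); dcong.
have [w3 W3] : (8 | f2e a x y)%Z by apply: z8E U3.
exists (w1 * V + u1 * v + w2 * S + u2 * s + w3 * e)%Z.
have -> : f2 a d x y V S e = ((f2V a d x y - u1 * (a * d - 1)) * V + u1 * ((a * d - 1) * V)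
   + (f2S a d x y - u2 * (a * d - 1)) * S + u2 * ((a * d - 1) * S) + f2e a x y * e)%Z.
  by rewrite /f2 /f2V /f2S /f2e; ring.
by rewrite W1 W2 W3 hV hS; ring.
Qed.

(** The analogue for [N] and [d] both even. If 4 divides [N], [t] is the bit telling [a x y] from 1
    modulo 8; if not, [t = 0] and the moments supply 4 | [R + 2 e]. *)
Definition f3 (a x y t R e : Z) : Z := (5 * (x - y) * R + R * (a - 1) * (y - 1) - 4 * t * R
   + 2 * e * (x * y - 1) - 3 * (x * y) * (R + 2 * e) * (a - 1))%Z.

Definition check3 := all8 (fun a => zodd a ==> all8 (fun x => zodd x ==>
  all8 (fun y => zodd y ==> all8 (fun R => all01 (fun e => all01 (fun t =>
    ((z8 (a * (x * y) - (1 + 4 * t))) || ((t =? 0)%Z && z8 (2 * (R + 2 * e)))) ==>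
    z8 (f3 a x y t R e))))))).
Lemma check3T : check3. Proof. by vm_compute. Qed.

Lemma f3_dvd a x y t R e : (a mod 2 = 1)%Z -> (x mod 2 = 1)%Z -> (y mod 2 = 1)%Z ->
  (8 | a * (x * y) - (1 + 4 * t))%Z \/ (t = 0%Z /\ (4 | R + 2 * e)%Z) -> (e = 0 \/ e = 1)%Z -> (t = 0 \/ t = 1)%Z ->
  (8 | f3 a x y t R e)%Z.
Proof.
move=> oa ox oy h he ht.
move: check3T; rewrite /check3 => /all8P/(_ a); rewrite zoddP // implyTb.
move/all8P/(_ x); rewrite zoddP // implyTb => /all8P/(_ y); rewrite zoddP // implyTb => /all8P/(_ R)/all01P/(_ e he)/all01P/(_ t ht).
have -> : (z8 (a mod 8 * (x mod 8 * (y mod 8)) - (1 + 4 * t)))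
             || ((t =? 0)%Z && z8 (2 * (R mod 8 + 2 * e))).
  case: h => [h|[-> [w W]]]; apply/orP; [left|right].
    by apply: z8P h; dcong.
  by apply/andP; split=> //; apply: (z8P (u := (2 * (R + 2 * e))%Z)); [dcong|exists w; lia].
by rewrite implyTb; apply: z8E; rewrite /f3; dcong.
Qed.

(** Dividing by the gcd leaves two coprime factors whose product is a square, so each is a
    square. *)
Lemma square_split a d s : 0 < a -> 0 < d -> a * d = s * s ->
  exists a1 d1, a = gcdn a d * (a1 * a1) /\ d = gcdn a d * (d1 * d1).
Proof.
move=> a0 d0 E; set g := gcdn a d.
have g0 : 0 < g by rewrite gcdn_gt0 a0.
have [a' Ea] := dvdnP (dvdn_gcdl a d); have [d' Ed] := dvdnP (dvdn_gcdr a d).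
rewrite -/g in Ea Ed.
have cad : coprime a' d'.
  have : gcdn a d = g by []. rewrite {1}Ea {1}Ed -muln_gcdl /coprime => H.
  by rewrite -(eqn_pmul2r g0) mul1n H.
have gs : g %| s.
  rewrite -(@dvdn_pexp2r _ _ 2) // -!mulnn -E {1}Ea {1}Ed.
  by apply/dvdnP; exists (a' * d'); lia.
have [s' Es] := dvdnP gs.
have E' : a' * d' = s' * s'.
  have : (a' * d') * (g * g) = (s' * s') * (g * g) by move: E; rewrite {1}Ea {1}Ed Es; lia.
  by move/eqP; rewrite eqn_pmul2r ?muln_gt0 ?g0 // => /eqP.
(* [gcd(u,w)^2 = gcd(u^2, u w, u v) = u gcd(u, w, v) = u]. *)
have sq u v w : coprime u v -> u * v = w * w -> u = gcdn u w * gcdn u w.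
  move=> c e; rewrite -[RHS]/(gcdn u w * gcdn u w).
  rewrite muln_gcdl !muln_gcdr.
  have -> : gcdn (gcdn (u * u) (u * w)) (gcdn (w * u) (w * w)) = gcdn (u * gcdn u w) (u * gcdn w v).
    rewrite -e (mulnC w u) !muln_gcdr; by rewrite -!gcdnA.
  rewrite -muln_gcdr; have -> : gcdn (gcdn u w) (gcdn w v) = 1; last by rewrite muln1.
  apply/eqP; rewrite -dvdn1 -(eqP c) dvdn_gcd.
  by rewrite (dvdn_trans (dvdn_gcdl _ _) (dvdn_gcdl _ _)) (dvdn_trans (dvdn_gcdr _ _) (dvdn_gcdr _ _)).
exists (gcdn a' s'), (gcdn d' s').
rewrite -(sq _ _ _ cad E') -(sq d' a' s') 1?coprime_sym //; last by rewrite mulnC.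
by rewrite !(mulnC g).
Qed.

End CongruencesMod8.

(** * Moments of r over the divisors of N and relations between them *)

Module Moments.

Require Import Defs.
Import DedekindSums GaussLemma KroneckerSymbol DedekindKronecker PsiIntegrality PsiKronecker PsiPairs CongruencesMod8.
From Stdlib Require Import Reals ZArith Lia Lra Zdiv.
From mathcomp Require Import all_boot.
From mathcomp Require Import zify.
Delimit Scope R_scope with R.
Set Implicit Arguments. Unset Strict Implicit. Unset Printing Implicit Defensive.
Local Arguments Z.mul : simpl never.
Local Arguments Z.add : simpl never.
Local Arguments Z.sub : simpl never.
Local Arguments Z.of_nat : simpl never.

Definition moment (N : nat) (r f : nat -> Z) : Z := sumZ (divisors N) (fun n => f n * r n)%Z.

Lemma moment_cong k N r f g : (forall n, n %| N -> (k | f n - g n)%Z) ->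
  0 < N -> (k | moment N r f - moment N r g)%Z.
Proof.
move=> H N0; rewrite /moment /sumZ.
have {}H : forall n, n \in divisors N -> (k | f n - g n)%Z by move=> n; rewrite -dvdn_divisors //; exact: H.
elim: (divisors N) H => [|n s IH] H /=; first by exists 0%Z.
have [u U] := H n (mem_head _ _).
have [v V] := IH (fun m ms => H m (mem_behead (s := n :: s) ms)).
by exists (u * r n + v)%Z; lia.
Qed.

Lemma moment_lin N r c0 c1 c2 c3 c4 c5 g1 g2 g3 g4 g5 :
  (moment N r (fun n => c0 + c1 * g1 n + c2 * g2 n + c3 * g3 n + c4 * g4 n + c5 * g5 n)
   = c0 * sumr N r + c1 * moment N r g1 + c2 * moment N r g2 + c3 * moment N r g3
     + c4 * moment N r g4 + c5 * moment N r g5)%Z.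
Proof.
rewrite /moment /sumr /sumZ; elim: (divisors N) => [|n s IH] /=; first by ring.
by rewrite IH; ring.
Qed.

(** [varpi] has the exponents [|r n|], of the same parity as [r n]; modulo 2 the weighted sum of
    bits is therefore the bit of the multiplicative sign [g] at [varpi]. *)
Lemma moment_bit N r (g : nat -> Z) : 0 < N -> g 1 = 1%Z ->
  (forall u v, 0 < u -> 0 < v -> g (u * v) = (g u * g v)%Z) ->
  (forall n, n %| N -> pm (g (N %/ n))) ->
  (2 | moment N r (fun n => sbit (g (N %/ n))) - sbit (g (varpi N r)))%Z.
Proof.
move=> N0 g1 gM gpm; rewrite /moment /varpi /sumZ /prodN.
have {}gpm : forall n, n \in divisors N -> pm (g (N %/ n)) /\ 0 < N %/ n.
  move=> n; rewrite -dvdn_divisors // => D; split; first exact: gpm.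
  by rewrite divn_gt0 ?(dvdn_leq N0 D) // (dvdn_gt0 N0 D).
suff [] : [/\ 0 < foldr (fun n acc => ((N %/ n) ^ Z.abs_nat (r n) * acc)%N) 1%N (divisors N),
   pm (g (foldr (fun n acc => ((N %/ n) ^ Z.abs_nat (r n) * acc)%N) 1%N (divisors N))) &
   (2 | foldr (fun n acc => sbit (g (N %/ n)%N) * r n + acc)%Z 0%Z (divisors N) -
        sbit (g (foldr (fun n acc => ((N %/ n) ^ Z.abs_nat (r n) * acc)%N) 1%N (divisors N))))%Z] by [].
elim: (divisors N) gpm => [|n s IH] H /=; first by split=> //; rewrite g1; [left|exists 0%Z].
have [U u0] := H n (mem_head _ _).
have [w0 W [v V]] := IH (fun m ms => H m (mem_behead (s := n :: s) ms)).
have pw i : [/\ 0 < (N %/ n) ^ i, pm (g ((N %/ n) ^ i)) & (2 | sbit (g ((N %/ n) ^ i)%N) - Z.of_nat i * sbit (g (N %/ n)%N))%Z].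
  elim: i => [|i [p0 Pi [q Q]]]; first by split=> //; rewrite g1; [left|exists 0%Z].
  have [t T] := negM U Pi.
  rewrite expnS gM //; split; [by rewrite muln_gt0 u0|exact: pmM|].
  by exists (q + t)%Z; lia.
have [p0 Pi [q Q]] := pw (Z.abs_nat (r n)).
have [t T] := negM Pi W.
rewrite gM //; split; [by rewrite muln_gt0 p0|exact: pmM|].
have [h Hh] : exists h, (Z.of_nat (Z.abs_nat (r n)) = r n + 2 * h)%Z.
  by rewrite Zabs2Nat.id_abs; exists (if (0 <=? r n)%Z then 0 else - r n)%Z; case: Z.leb_spec; lia.
rewrite Hh in Q.
exists (v - t - q - h * sbit (g (N %/ n)%N))%Z; lia.
Qed.

Lemma moment_log N r : 0 < N ->
  (2 | moment N r (fun n => Z.of_nat (logn 2 (N %/ n))) - Z.of_nat (logn 2 (varpi N r)))%Z.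
Proof.
move=> N0; rewrite /moment /varpi /sumZ /prodN.
have H : forall n, n \in divisors N -> 0 < N %/ n.
  by move=> n; rewrite -dvdn_divisors // => D; rewrite divn_gt0 ?(dvdn_leq N0 D) // (dvdn_gt0 N0 D).
suff [] : 0 < foldr (fun n acc => ((N %/ n) ^ Z.abs_nat (r n) * acc)%N) 1%N (divisors N) /\
   (2 | foldr (fun n acc => Z.of_nat (logn 2 (N %/ n)%N) * r n + acc)%Z 0%Z (divisors N) -
        Z.of_nat (logn 2 (foldr (fun n acc => ((N %/ n) ^ Z.abs_nat (r n) * acc)%N) 1%N (divisors N))))%Z by [].
elim: (divisors N) H => [|n s IH] H /=; first by split=> //; rewrite logn1; exists 0%Z.
have u0 := H n (mem_head _ _).
have [w0 [v V]] := IH (fun m ms => H m (mem_behead (s := n :: s) ms)).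
have p0 : 0 < (N %/ n) ^ Z.abs_nat (r n) by rewrite expn_gt0 u0.
rewrite lognM // lognX; split; first by rewrite muln_gt0 p0.
have [h Hh] : exists h, (Z.of_nat (Z.abs_nat (r n)) = r n + 2 * h)%Z.
  by rewrite Zabs2Nat.id_abs; exists (if (0 <=? r n)%Z then 0 else - r n)%Z; case: Z.leb_spec; lia.
rewrite Nat2Z.inj_add Nat2Z.inj_mul Hh.
exists (v - h * Z.of_nat (logn 2 (N %/ n)%N))%Z; lia.
Qed.

Lemma odd_part n : 0 < n -> exists2 o, odd o & n = 2 ^ logn 2 n * o.
Proof.
move=> n0; have [o co E] := pfactor_coprime (isT : prime 2) n0.
by exists o; [rewrite -coprime2n|rewrite mulnC].
Qed.

Lemma chi4_pm n : pm (chi4 n).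
Proof. by rewrite /chi4; case: ifP; [right|left]. Qed.

Lemma chi4_odd e o : odd o -> chi4 (2 ^ e * o) = if o %% 4 == 3 then (-1)%Z else 1%Z.
Proof.
move=> oo; have L : logn 2 (2 ^ e * o) = e.
  rewrite lognM ?expn_gt0 ?(odd_gt0 oo) // pfactorK // (_ : logn 2 o = 0) ?addn0 //.
  by rewrite lognE dvdn2 oo !andbF.
by rewrite /chi4 L mulKn // expn_gt0.
Qed.

Lemma chi4M u v : 0 < u -> 0 < v -> chi4 (u * v) = (chi4 u * chi4 v)%Z.
Proof.
move=> u0 v0; have [o oo Eu] := odd_part u0; have [o' oo' Ev] := odd_part v0.
rewrite {1}Eu {1}Ev mulnACA -expnD [in chi4 u]Eu [in chi4 v]Ev !chi4_odd ?oddM ?oo //.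
rewrite -modnMm; have : o %% 4 = 1 \/ o %% 4 = 3 by lia.
have : o' %% 4 = 1 \/ o' %% 4 = 3 by lia.
by case=> ->; case=> ->.
Qed.

Lemma chi4_cong o e : odd o -> (4 | 1 + 2 * sbit (chi4 (2 ^ e * o)) - Z.of_nat o)%Z.
Proof.
move=> oo; rewrite chi4_odd //; apply/Z.mod_divide => //.
have [h|h] : o %% 4 = 1 \/ o %% 4 = 3 by lia.
all: by rewrite h /sbit /=; mlia.
Qed.

Lemma odd_sqr8 o : odd o -> exists f, (Z.of_nat o * Z.of_nat o = 1 + 8 * f)%Z.
Proof.
move=> oo; have [u U] := odd_mod8 (odd_Zmod oo).
by case: U => [|[|[|]]] ->; [exists (8 * u * u + 2 * u)%Z | exists (8 * u * u + 6 * u + 1)%Z | exists (8 * u * u + 10 * u + 3)%Z | exists (8 * u * u + 14 * u + 6)%Z]; ring.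
Qed.

Section Relations.
Variables (N : nat) (r : nat -> Z).
Hypothesis N0 : 0 < N.
Let X := moment N r Z.of_nat.
Let S := moment N r (fun n => Z.of_nat (N %/ n)).
Let R := sumr N r.
Let e := sbit (chi4 (varpi N r)).
Let al := Z.of_nat (logn 2 (varpi N r)).

Lemma moment_chi4 : (2 | moment N r (fun n => sbit (chi4 (N %/ n))) - e)%Z.
Proof.
by apply: moment_bit => //; [exact: chi4M|move=> n _; exact: chi4_pm].
Qed.

(** A linear congruence that holds at every divisor [n] sums to one between the moments; each
    relation below is such a termwise congruence. *)
Lemma moment_rel k c0 c1 c2 c3 c4 :
  (forall n, n %| N -> (k | c0 + c1 * Z.of_nat n + c2 * Z.of_nat (N %/ n)
     + c3 * sbit (chi4 (N %/ n)) + c4 * Z.of_nat (logn 2 (N %/ n)))%Z) ->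
  (k | c0 * R + c1 * X + c2 * S + c3 * moment N r (fun n => sbit (chi4 (N %/ n)))
     + c4 * moment N r (fun n => Z.of_nat (logn 2 (N %/ n))))%Z.
Proof.
move=> H.
have := @moment_cong k N r (fun n => c0 + c1 * Z.of_nat n + c2 * Z.of_nat (N %/ n)
     + c3 * sbit (chi4 (N %/ n)) + c4 * Z.of_nat (logn 2 (N %/ n)) + 0 * 0)%Z (fun n => 0 + 0 * 0 + 0 * 0 + 0 * 0 + 0 * 0 + 0 * 0)%Z.
rewrite (@moment_lin N r 0 0 0 0 0 0 (fun _ => 0) (fun _ => 0) (fun _ => 0) (fun _ => 0) (fun _ => 0))%Z.
rewrite (@moment_lin N r c0 c1 c2 c3 c4 0 Z.of_nat (fun n => Z.of_nat (N %/ n)) (fun n => sbit (chi4 (N %/ n))) (fun n => Z.of_nat (logn 2 (N %/ n))) (fun _ => 0%Z)).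
case=> //.
  by move=> n /H [w W]; exists w; lia.
by rewrite -/X -/S -/R => w W; exists w; lia.
Qed.

(** If [n^2 = 1] modulo [k], then [N / n = n^2 (N / n) = N n] modulo [k]. *)
Lemma rel_coprime k : (forall n, n %| N -> exists f, (Z.of_nat n * Z.of_nat n = 1 + k * f)%Z) ->
  (k | S - Z.of_nat N * X)%Z.
Proof.
move=> H; have [|w W] := @moment_rel k 0 (- Z.of_nat N) 1 0 0; last by exists w; lia.
move=> n D; have [f F] := H n D; exists (- f * Z.of_nat (N %/ n))%Z.
have E : (Z.of_nat N = Z.of_nat n * Z.of_nat (N %/ n))%Z by rewrite -{1}(divnK D) Nat2Z.inj_mul Z.mul_comm.
rewrite E; nia.
Qed.

(** The second relation sums [N / n = 1 + 2 sbit (chi4 (N / n))] modulo 4, valid for odd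
    cofactors. *)
Lemma rel_oddN : odd N -> (8 | S - Z.of_nat N * X)%Z /\ (4 | S - (R + 2 * e))%Z.
Proof.
move=> oN; split.
  by apply: rel_coprime => n D; apply: odd_sqr8; exact: dvdn_odd D oN.
have [w0 W0] := moment_chi4.
have [|w W] := @moment_rel 4 (-1) 0 1 (-2) 0; last by exists (w + w0)%Z; lia.
move=> n D; have on : odd (N %/ n).
  by apply: (dvdn_odd _ oN); apply: dvdn_div.
by have [w W] := chi4_cong 0 on; rewrite expn0 mul1n in W; exists (- w)%Z; lia.
Qed.

(** The divisors form two classes, [n = o] with cofactor [2 o'] and [n = 2 o] with cofactor [o'],
    where [o o' = N1]; both congruences are checked on each class. *)
Lemma rel_2N1 N1 : odd N1 -> N = 2 * N1 ->
  (4 | R + 2 * e + Z.of_nat N1 * X + S)%Z /\ (2 | al - X)%Z.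
Proof.
move=> oN1 EN.
have dec n : n %| N -> exists o o', [/\ odd o, odd o', N1 = o * o' &
    (n = o /\ N %/ n = 2 * o' /\ logn 2 (N %/ n) = 1) \/ (n = 2 * o /\ N %/ n = o' /\ logn 2 (N %/ n) = 0)].
  move=> D; have n0 := dvdn_gt0 N0 D.
  have m0 : 0 < N %/ n by rewrite divn_gt0 ?(dvdn_leq N0 D).
  have [o oo En] := odd_part n0; have [o' oo' Em] := odd_part m0.
  have L : logn 2 n + logn 2 (N %/ n) = 1.
    by rewrite -lognM // mulnC divnK // EN lognM ?(odd_gt0 oN1) // (_ : logn 2 N1 = 0) // lognE dvdn2 oN1 !andbF.
  have E : N = n * (N %/ n) by rewrite mulnC divnK.
  exists o, o'; move: L Em E; move: (N %/ n) => m.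
  case: (logn 2 m) => [|[|q]]; case: (logn 2 n) En => [|[|q']] //= En _ Em E;
    rewrite ?expn0 ?expn1 ?mul1n in Em En; subst n m.
    by split=> //; [lia|right].
  by split=> //; [lia|left].
have [w0 W0] := moment_chi4; have [w1 W1] := moment_log r N0.
split.
  have [|w W] := @moment_rel 4 1 (Z.of_nat N1) 1 2 0; last by exists (w - w0)%Z; lia.
  move=> n /dec [o [o' [oo oo' EN1 C]]]; have [f F] := odd_sqr8 oo.
  rewrite EN1 Nat2Z.inj_mul.
  case: C => - [-> [-> _]].
    have := chi4_cong 1 oo'; rewrite expn1 => - [w W].
    by exists (w + Z.of_nat o' + 2 * f * Z.of_nat o')%Z; nia.
  have := chi4_cong 0 oo'; rewrite expn0 mul1n => - [w W].
  by exists (w + Z.of_nat o' + 4 * f * Z.of_nat o')%Z; nia.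
have [|w W] := @moment_rel 2 0 (-1) 0 0 1; last by rewrite /al; exists (w - w1)%Z; lia.
move=> n /dec [o [o' [oo oo' EN1 C]]]; apply/Z.mod_divide => //.
have := odd_Zmod oo.
by case: C => - [-> [_ ->]]; rewrite ?Nat2Z.inj_mul; mlia.
Qed.

(** For each of the three valuations of [n], the number [1 + n + N / n + v_2(N / n)] is even. This
    parity is behind the condition on [v_2(varpi)] in [delta1]. *)
Lemma rel_4N1 N1 : odd N1 -> N = 4 * N1 -> (2 | R + X + S + al)%Z.
Proof.
move=> oN1 EN; have [w1 W1] := moment_log r N0.
have [|w W] := @moment_rel 2 1 1 1 0 1; last by rewrite /al; exists (w - w1)%Z; lia.
move=> n D; have n0 := dvdn_gt0 N0 D.
have m0 : 0 < N %/ n by rewrite divn_gt0 ?(dvdn_leq N0 D).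
have [o oo En] := odd_part n0; have [o' oo' Em] := odd_part m0.
have L : logn 2 n + logn 2 (N %/ n) = 2.
  rewrite -lognM // mulnC divnK // EN lognM ?(odd_gt0 oN1) // (_ : logn 2 N1 = 0) ?(pfactorK 2 (isT : prime 2)) //.
  by rewrite lognE dvdn2 oN1 !andbF.
apply/Z.mod_divide => //; have := odd_Zmod oo; have := odd_Zmod oo'.
move: L Em; move: (N %/ n) => m.
case: (logn 2 m) => [|[|[|q]]]; case: (logn 2 n) En => [|[|[|q']]] //= En _ Em;
  rewrite ?expn0 ?expn1 ?mul1n -?[2 ^ 2]/4 in Em En; subst n m; rewrite ?Nat2Z.inj_mul; mlia.
Qed.
End Relations.

End Moments.

(** * The total exponent of the two multipliers modulo 24 *)

Module PairCongruence.

Require Import Defs.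
Import DedekindSums GaussLemma KroneckerSymbol DedekindKronecker PsiIntegrality PsiKronecker PsiPairs CongruencesMod8 Moments.
From Stdlib Require Import Reals ZArith Lia Lra Zdiv.
From mathcomp Require Import all_boot.
From mathcomp Require Import zify.
Delimit Scope R_scope with R.
Set Implicit Arguments. Unset Strict Implicit. Unset Printing Implicit Defensive.
Local Arguments Z.mul : simpl never.
Local Arguments Z.add : simpl never.
Local Arguments Z.sub : simpl never.
Local Arguments Z.of_nat : simpl never.

Lemma Zodd_ex x : (x mod 2 = 1)%Z -> exists u, x = (2 * u + 1)%Z.
Proof. by move=> o; exists (x / 2)%Z; mlia. Qed.
Lemma Zeven_ex x : (x mod 2 <> 1)%Z -> exists u, x = (2 * u)%Z.
Proof. by move=> o; exists (x / 2)%Z; mlia. Qed.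
Lemma Zsqr8 x : (x mod 2 = 1)%Z -> exists f, (x * x = 1 + 8 * f)%Z.
Proof.
move=> oo; have [u U] := odd_mod8 oo.
by case: U => [|[|[|]]] ->; [exists (8 * u * u + 2 * u)%Z | exists (8 * u * u + 6 * u + 1)%Z | exists (8 * u * u + 10 * u + 3)%Z | exists (8 * u * u + 14 * u + 6)%Z]; ring.
Qed.
Lemma odd_cancel8 y u : (y mod 2 = 1)%Z -> (8 | y * u)%Z -> (8 | u)%Z.
Proof.
move=> oy [w W]; have [f F] := Zsqr8 oy; exists (y * w - f * u)%Z.
have E : u = (y * (y * u) - (y * y - 1) * u)%Z by ring.
by rewrite {1}E F W; ring.
Qed.

Lemma sbit_qrsgn u y : (u mod 2 = 1)%Z -> (y mod 2 = 1)%Z ->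
  (8 | 4 * sbit (qrsgn u y) - (u - 1) * (y - 1))%Z.
Proof.
move=> ou oy; rewrite neg_qrsgn //; apply/Z.mod_divide => //.
have [v [EU|EU]] : exists v, (u = 4 * v + 1 \/ u = 4 * v + 3)%Z by exists (u / 4)%Z; mlia.
all: have [w [EV|EV]] : exists w, (y = 4 * w + 1 \/ y = 4 * w + 3)%Z by exists (y / 4)%Z; mlia.
all: have -> : (u mod 4 = u - 4 * v)%Z by mlia.
all: have -> : (y mod 4 = y - 4 * w)%Z by mlia.
all: rewrite EU EV.
all: repeat (case: Z.eqb_spec => ?); try lia.
all: mlia.
Qed.

Definition all3 (P : Z -> bool) : bool := [&& P 0, P 1 & P 2]%Z.
Lemma all3P P : all3 P -> forall z, P (z mod 3)%Z.
Proof.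
case/and3P => ? ? ? z; have : (0 <= z mod 3 < 3)%Z by apply: Z.mod_pos_bound.
move: (z mod 3)%Z => w Hw.
have [|[|]] : (w = 0 \/ w = 1 \/ w = 2)%Z by lia.
all: by move=> ->.
Qed.

Definition z3 (z : Z) := (z mod 3 =? 0)%Z.
Lemma z3P u v : (3 | u - v)%Z -> (3 | u)%Z -> z3 v.
Proof. by move=> [w Hw] [p P]; apply/Z.eqb_eq; mlia. Qed.
Lemma z3E u v : (3 | u - v)%Z -> z3 v -> (3 | u)%Z.
Proof. by move=> [w Hw] /Z.eqb_eq H; apply/Z.mod_divide => //; mlia. Qed.
Lemma dcong_mod3 u : (3 | u - u mod 3)%Z.
Proof. by exists (u / 3)%Z; have := Z.div_mod u 3; lia. Qed.
Ltac dcong3 := repeat first [exact: dcong_mod3 | exact: dcong_refl | apply: dcong_add | apply: dcong_opp | apply: dcong_mul].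

(** [g3S] and [g3X] are the coefficients of [S] and [X] modulo 3 in the total exponent minus
    [b d X]. *)
Definition g3S (a d x y b z n : Z) : Z :=
  ((a * y + x) - (b * y - d * z) * x * n - d * (a * x - n * b + y) - z * y * d * d * n)%Z.
Definition g3X (d x y b z : Z) : Z := ((b * y - d * z) * x + z * y - b * d)%Z.

Definition check_mod3 := all3 (fun a => all3 (fun d => z3 (a * d - 1) ==> all3 (fun x => all3 (fun y =>
  all3 (fun b => all3 (fun z => all3 (fun n => z3 (a * (x * y) - (1 + n * (b * y - d * z))) ==>
  (if z3 n then z3 (g3S a d x y b z n) && z3 (g3X d x y b z)
   else z3 (g3S a d x y b z n * n + g3X d x y b z))))))))).
Lemma check_mod3T : check_mod3. Proof. by vm_compute. Qed.

Lemma mod3_dvd a d x y b z n S X : (a * (x * y) = 1 + n * (b * y - d * z))%Z ->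
  (3 | (a * d - 1) * X)%Z -> (3 | (a * d - 1) * S)%Z -> (~~ z3 n -> (3 | S - n * X)%Z) ->
  (3 | g3S a d x y b z n * S + g3X d x y b z * X)%Z.
Proof.
move=> E [u U] [v V] H.
case: (boolP (z3 (a * d - 1))) => [/Z.eqb_eq c3|/negP c3n]; last first.
  have c3 : ((a * d - 1) mod 3 <> 0)%Z by move=> E0; apply: c3n; apply/Z.eqb_eq.
  have cp k : (3 | (a * d - 1) * k)%Z -> (3 | k)%Z.
    move=> Hk; apply: (Z.gauss _ _ _ Hk); apply/Z.bezout_1_gcd.
    have [q [Q|Q]] : exists q, (a * d - 1 = 3 * q + 1 \/ a * d - 1 = 3 * q + 2)%Z by exists ((a * d - 1) / 3)%Z; mlia.
      by exists (- q)%Z, 1%Z; lia.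
    by exists (q + 1)%Z, (-1)%Z; lia.
  have [X' EX] : (3 | X)%Z by apply: cp; exists u.
  have [S' ES] : (3 | S)%Z by apply: cp; exists v.
  by exists (g3S a d x y b z n * S' + g3X d x y b z * X')%Z; rewrite EX ES; ring.
have E3 : (3 | a * (x * y) - (1 + n * (b * y - d * z)))%Z by exists 0%Z; lia.
have A3 : (3 | a * d - 1)%Z by apply/Z.mod_divide.
move: check_mod3T; rewrite /check_mod3 => /all3P/(_ a)/all3P/(_ d).
rewrite (z3P _ A3) ?implyTb; last by dcong3.
move/all3P/(_ x)/all3P/(_ y)/all3P/(_ b)/all3P/(_ z)/all3P/(_ n).
rewrite (z3P _ E3) ?implyTb; last by dcong3.
have C1 : (3 | g3S a d x y b z n - g3S (a mod 3) (d mod 3) (x mod 3) (y mod 3) (b mod 3) (z mod 3) (n mod 3))%Z.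
  by rewrite /g3S; dcong3.
have C2 : (3 | g3X d x y b z - g3X (d mod 3) (x mod 3) (y mod 3) (b mod 3) (z mod 3))%Z.
  by rewrite /g3X; dcong3.
case: ifP => [n3 /andP[/(z3E C1) [p P] /(z3E C2) [q Q]]|/negbT n3].
  by exists (p * S + q * X)%Z; rewrite P Q; ring.
move/(z3E (dcong_add (dcong_mul C1 (dcong_mod3 n)) C2)) => [p P].
have [|w Hw] := H; first by move: n3; rewrite /z3 Z.mod_mod.
exists (p * X + g3S a d x y b z n * w)%Z.
have -> : S = (n * X + w * 3)%Z by lia.
have -> : (g3S a d x y b z n * (n * X + w * 3) + g3X d x y b z * X = (g3S a d x y b z n * n + g3X d x y b z) * X + g3S a d x y b z n * w * 3)%Z by ring.
by rewrite P; ring.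
Qed.

Section Main.
Variables (N a b d : nat) (r : nat -> Z) (K x y z : Z).
Hypotheses (N0 : 0 < N) (a0 : 0 < a) (d0 : 0 < d).
Let A := Z.of_nat a.
Let B := Z.of_nat b.
Let D := Z.of_nat d.
Let NZ := Z.of_nat N.
Hypothesis xyzE : ((- NZ * B + A * x) * y + NZ * D * z = 1)%Z.
Let X := xN N r.
Let S := moment N r (fun n => Z.of_nat (N %/ n)).
Let R := sumr N r.
Let W := varpi N r.
Hypotheses (HX : (24 | (A * D - 1) * X)%Z) (HS : (24 | (A * D - 1) * S)%Z) (K4 : (4 | K - R)%Z).
Hypothesis sq : (R mod 2 = 1)%Z -> exists s, a * d = s * s.
(** The two inverse multiplier values in a Hecke coefficient have product [e (- Tot / 24)]. *)
Let Tot := moment N r (fun n => psi_pair NZ A B x y (N %/ n) d).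
Let g := gcdn a d.
Let kb := sbit (kron (- NZ * B) g).
Let ka := sbit (kron A W).
Let e := sbit (chi4 W).
Let al := Z.of_nat (logn 2 W).
Let t := (B * y - D * z)%Z.
Let Ma := moment N r (fun n => sbit (kron A (N %/ n))).
Let Mc := moment N r (fun n => sbit (chi4 (N %/ n))).
Let Ml := moment N r (fun n => Z.of_nat (logn 2 (N %/ n))).

Lemma cofactor n : n %| N -> NZ = (Z.of_nat n * Z.of_nat (N %/ n))%Z.
Proof. by move=> Dn; rewrite /NZ -{1}(divnK Dn) Nat2Z.inj_mul Z.mul_comm. Qed.

Lemma cofactor_gt0 n : n %| N -> 0 < N %/ n.
Proof. by move=> Dn; rewrite divn_gt0 ?(dvdn_leq N0 Dn) // (dvdn_gt0 N0 Dn). Qed.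

Lemma main_axy : (A * (x * y) = 1 + NZ * t)%Z.
Proof. by rewrite /t; have := xyzE; lia. Qed.

Lemma e01 : (e = 0 \/ e = 1)%Z. Proof. exact: neg01. Qed.

Lemma Tot_cong k o c0 c1 c2 c3 c4 c5 :
  (forall n, n %| N -> (k | o * psi_pair NZ A B x y (N %/ n) d
    - (c0 + c1 * Z.of_nat n + c2 * Z.of_nat (N %/ n) + c3 * sbit (kron A (N %/ n))
       + c4 * sbit (chi4 (N %/ n)) + c5 * Z.of_nat (logn 2 (N %/ n))))%Z) ->
  (k | o * Tot - (c0 * R + c1 * X + c2 * S + c3 * Ma + c4 * Mc + c5 * Ml))%Z.
Proof.
move=> H.
have := @moment_lin N r 0 o 0 0 0 0 (fun n => psi_pair NZ A B x y (N %/ n) d) (fun _ => 0%Z) (fun _ => 0%Z) (fun _ => 0%Z) (fun _ => 0%Z).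
have := @moment_lin N r c0 c1 c2 c3 c4 c5 Z.of_nat (fun n => Z.of_nat (N %/ n)) (fun n => sbit (kron A (N %/ n))) (fun n => sbit (chi4 (N %/ n))) (fun n => Z.of_nat (logn 2 (N %/ n))).
set F1 := moment N r (fun n => c0 + _ + _ + _ + _ + _)%Z.
set F2 := moment N r (fun n => 0 + _ + _ + _ + _ + _)%Z.
have [w Hw] : (k | F2 - F1)%Z.
  by apply: moment_cong => // n Dn; have [w Hw] := H n Dn; exists w; lia.
move=> E1 E2; exists w; rewrite -Hw E1 E2 -/Tot -/X -/S -/R -/Ma -/Mc -/Ml.
have -> : moment N r Z.of_nat = X by [].
by ring.
Qed.

Lemma Ma_par : exists w, (Ma = ka + 2 * w)%Z.
Proof.
have [w Hw] : (2 | Ma - ka)%Z; last by exists w; lia.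
apply: (@moment_bit N r (kron A)) => //; first by move=> u v; exact: kronM.
move=> n Dn; apply: pm_kron; first exact: cofactor_gt0.
exact: (pair_coprime_a (cofactor Dn) (cofactor_gt0 Dn) d0 xyzE).
Qed.

Lemma Mc_par : exists w, (Mc = e + 2 * w)%Z.
Proof. by have [w Hw] := moment_chi4 r N0; exists w; rewrite /Mc /e /W; lia. Qed.

Lemma Ml_par : exists w, (Ml = al + 2 * w)%Z.
Proof. by have [w Hw] := moment_log r N0; exists w; rewrite /Ml /al /W; lia. Qed.

Lemma g_gt0 : 0 < g. Proof. by rewrite gcdn_gt0 a0. Qed.

Lemma main_coprime_y : coprime (Z.abs_nat y) d.
Proof.
by rewrite -(Zabs2Nat.id d); apply: (@bezout_coprime _ _ (- NZ * B + A * x) (NZ * z)); have := xyzE; rewrite /D; lia.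
Qed.

Lemma main_coprime_yg : coprime (Z.abs_nat y) g.
Proof. by apply: coprime_dvdr main_coprime_y; exact: dvdn_gcdr. Qed.

Lemma g_cong : (Z.of_nat g | y * (- NZ * B) - 1)%Z.
Proof.
have [u U] := dvdnP (dvdn_gcdl a d); have [v V] := dvdnP (dvdn_gcdr a d).
exists (- Z.of_nat u * x * y - NZ * Z.of_nat v * z)%Z; have := xyzE.
have -> : A = (Z.of_nat u * Z.of_nat g)%Z by rewrite /A {1}U Nat2Z.inj_mul.
have -> : D = (Z.of_nat v * Z.of_nat g)%Z by rewrite /D {1}V Nat2Z.inj_mul.
lia.
Qed.

Lemma pm_kron_NB : pm (kron (- NZ * B) g).
Proof.
apply: pm_kron g_gt0 _; rewrite -(Zabs2Nat.id g).
by have [w Hw] := g_cong; apply: (@bezout_coprime _ _ y (- w)); lia.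
Qed.

Lemma kron_y_g : odd g -> kron y g = kron (- NZ * B) g.
Proof.
move=> og; have : (kron y g * kron (- NZ * B) g = 1)%Z.
  rewrite -kronMl ?g_gt0 //; transitivity (kron 1 g); last exact: kron1n.
  by apply: kron_mod => //; exact: g_cong.
have := pm_kron g_gt0 main_coprime_yg.
by case: pm_kron_NB => ->; case=> ->; lia.
Qed.

Lemma pmsq u : pm u -> (u * u = 1)%Z. Proof. by case=> ->. Qed.

(** For even [R] every term is a multiple of 8. For odd [R] the product [a d] is a square, so [d] is
    [g] times a square and (y/d) = (y/g); and [y] is inverse to [- N b] modulo [g]. *)
Lemma F_odd : odd d -> (8 | 4 * R * sbit (kron (- y) d) - (2 * R * (D - 1) + 4 * (K * kb)))%Z.
Proof.
move=> od; have [D' ED] := Zodd_ex (odd_Zmod od); rewrite -/D in ED.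
have [w4 W4] := K4.
case: (Z.eq_dec (R mod 2) 1) => [oR|/Zeven_ex [R' ER]]; last first.
  have EK : K = (2 * R' + 4 * w4)%Z by lia.
  by rewrite EK ER ED; exists (R' * sbit (kron (- y) d) - R' * D' - (R' + 2 * w4) * kb)%Z; ring.
have [s Es] := sq oR; have [a1 [d1 [Ea Ed]]] := square_split a0 d0 Es.
rewrite -/g in Ea Ed.
have d10 : 0 < d1 by case: (posnP d1) d0 => // E; rewrite Ed E !muln0.
have cd1 : coprime (Z.abs_nat y) d1.
  by apply: coprime_dvdr main_coprime_y; rewrite Ed; apply: dvdn_mull; apply: dvdn_mulr.
have og : odd g by move: od; rewrite Ed oddM => /andP[].
have P1 := pm_kronN1 d0.
have E1 : kron (- y) d = (kron (-1) d * kron (- NZ * B) g)%Z.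
  rewrite kron_opp //; congr (_ * _)%Z.
  rewrite {1}Ed kronM ?g_gt0 ?muln_gt0 ?d10 // kronM // pmsq ?Z.mul_1_r ?kron_y_g //.
  exact: pm_kron.
rewrite E1; have [t1 T1] := negM P1 pm_kron_NB; have [t2 T2] := neg_kronN1 od.
rewrite -/kb -/D in T1 T2.
have [R' ER] := Zodd_ex oR.
have -> : sbit (kron (-1) d * kron (- NZ * B) g) = (sbit (kron (-1) d) + kb + 2 * t1)%Z by lia.
have -> : K = (R + 4 * w4)%Z by lia.
exists (R * t2 + R * t1 - 2 * w4 * kb)%Z.
have -> : (4 * R * (sbit (kron (-1) d) + kb + 2 * t1) = R * (4 * sbit (kron (-1) d)) + 4 * R * kb + 8 * R * t1)%Z by ring.
have -> : (4 * sbit (kron (-1) d) = t2 * 8 + 2 * (D - 1))%Z by lia.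
ring.
Qed.

(** The same descent to [g], with [d] now the upper entry: reciprocity exchanges [g] and [y], and
    its sign gives [R (A - 1) (y - 1)] because [A] is [g] times an odd square. *)
Lemma F_even : odd a -> (y mod 2 = 1)%Z ->
  (8 | 4 * R * sbit (kron D (Z.abs_nat y)) - (4 * (K * kb) + R * (A - 1) * (y - 1)))%Z.
Proof.
move=> oa oy; have [A' EA] := Zodd_ex (odd_Zmod oa); rewrite -/A in EA.
have [y' Ey] := Zodd_ex oy.
have [w4 W4] := K4.
case: (Z.eq_dec (R mod 2) 1) => [oR|/Zeven_ex [R' ER]]; last first.
  have EK : K = (2 * R' + 4 * w4)%Z by lia.
  rewrite EK ER EA {2}Ey; move: (sbit (kron D _)) => sd.
  by exists (R' * sd - (R' + 2 * w4) * kb - R' * A' * y')%Z; ring.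
have [s Es] := sq oR; have [a1 [d1 [Ea Ed]]] := square_split a0 d0 Es.
rewrite -/g in Ea Ed.
have og : odd g by move: oa; rewrite Ea oddM => /andP[].
have oa1 : odd a1 by move: oa; rewrite Ea !oddM => /andP[_ /andP[]].
have y0 : 0 < Z.abs_nat y by apply: odd_gt0; apply: odd_abs_nat.
have cd1 : coprime d1 (Z.abs_nat y).
  by rewrite coprime_sym; apply: coprime_dvdr main_coprime_y; rewrite Ed; apply: dvdn_mull; apply: dvdn_mulr.
have cg : coprime g (Z.abs_nat y) by rewrite coprime_sym main_coprime_yg.
have E1 : kron D (Z.abs_nat y) = (qrsgn (Z.of_nat g) y * kron (- NZ * B) g)%Z.
  rewrite /D {1}Ed !Nat2Z.inj_mul (kronMl (Z.of_nat g)) // (kronMl (Z.of_nat d1)) //.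
  have Pd1 : pm (kron (Z.of_nat d1) (Z.abs_nat y)) by apply: pm_kron => //; rewrite Zabs2Nat.id.
  by rewrite (pmsq Pd1) Z.mul_1_r signed_reciprocity // kron_y_g.
have Pq : pm (qrsgn (Z.of_nat g) y) by rewrite /qrsgn; case: andb; [right|left].
rewrite E1; have [t1 T1] := negM Pq pm_kron_NB; rewrite -/kb in T1.
have [R' ER] := Zodd_ex oR.
have [f Ef] := odd_sqr8 oa1.
have [t2 T2] : (8 | 4 * sbit (qrsgn (Z.of_nat g) y) - (A - 1) * (y - 1))%Z.
  have -> : (A - 1 = Z.of_nat g - 1 + 8 * (f * Z.of_nat g))%Z.
    by rewrite /A {1}Ea !Nat2Z.inj_mul Ef; ring.
  have [v V] := sbit_qrsgn (odd_Zmod og) oy; exists (v - f * Z.of_nat g * (y - 1))%Z; lia.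
have -> : sbit (qrsgn (Z.of_nat g) y * kron (- NZ * B) g) = (sbit (qrsgn (Z.of_nat g) y) + kb + 2 * t1)%Z by lia.
have -> : K = (R + 4 * w4)%Z by lia.
exists (R * t2 + R * t1 - 2 * w4 * kb)%Z.
move: (sbit (qrsgn _ _)) T2 => sq' T2.
have -> : (4 * R * (sq' + kb + 2 * t1) = R * (4 * sq') + 4 * R * kb + 8 * R * t1)%Z by ring.
have -> : (4 * sq' = t2 * 8 + (A - 1) * (y - 1))%Z by lia.
ring.
Qed.

Variable d1 : Z.
Hypothesis d1E : d1 = (if [&& ~~ odd (a * d), 4 %| N, Z.odd K & odd (logn 2 W)] then 1 else 0)%Z.
(** The numerator of the exponent of [psi] over 24: with [K = 2 k], the factor [(k + delta) / 4]
    equals [3 (K + 2 e) / 24]. *)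
Definition psi_num : Z :=
  (if odd (a * d) then 3 * (K + 2 * e) * (- (D - 1) + (A * D - 1) * (NZ - 1))
   else if ~~ odd N then - (3 * (K + 2 * e) * (A - 1)) - 3 * NZ * (K + 2 * e) * (1 + d1) * B
   else 0)%Z.
(** The part modulo 8 of the comparison of [- Tot] with the exponents of the two symbols, of
    [e (- b d x_N / 24)] and of [psi]. A sign contributes 12 times its bit, which is 4 times it
    modulo 8. *)
Definition goal8 := (8 | Tot - (B * D * X - psi_num + 4 * ka + 4 * (K * kb)))%Z.

Lemma HX8 : exists w, ((A * D - 1) * X = 8 * w)%Z.
Proof. by have [w Hw] := HX; exists (3 * w)%Z; lia. Qed.
Lemma HS8 : exists w, ((A * D - 1) * S = 8 * w)%Z.
Proof. by have [w Hw] := HS; exists (3 * w)%Z; lia. Qed.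

Lemma even_X8 : ~~ odd (a * d) -> exists w, X = (8 * w)%Z.
Proof.
move=> el; have [w [Hw]] : (8 | X)%Z; last by exists w; lia.
apply: (@odd_cancel8 (A * D - 1)); last by have [w Hw] := HX8; exists w; lia.
by rewrite /A /D -Nat2Z.inj_mul; have := odd_double_half (a * d); rewrite (negPf el) -muln2 multE; mlia.
Qed.
Lemma even_S8 : ~~ odd (a * d) -> exists w, S = (8 * w)%Z.
Proof.
move=> el; have [w [Hw]] : (8 | S)%Z; last by exists w; lia.
apply: (@odd_cancel8 (A * D - 1)); last by have [w Hw] := HS8; exists w; lia.
by rewrite /A /D -Nat2Z.inj_mul; have := odd_double_half (a * d); rewrite (negPf el) -muln2 multE; mlia.
Qed.

Lemma Rodd_sq8 : (R mod 2 = 1)%Z -> odd (a * d) -> exists w, (A * D - 1 = 8 * w)%Z.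
Proof.
move=> oR ol; have [s Es] := sq oR.
have os : odd s by move: ol; rewrite Es oddM => /andP[].
have [f F] := odd_sqr8 os; exists f.
by rewrite /A /D -Nat2Z.inj_mul multE Es Nat2Z.inj_mul F; ring.
Qed.

Lemma case_oddN_oddd : odd N -> odd d -> goal8.
Proof.
move=> oN od; rewrite /goal8.
have [[w2 W2] [w3 W3]] := rel_oddN r N0 oN.
rewrite -/R -/S -/NZ in W2 W3; have EX : moment N r Z.of_nat = X by []. rewrite EX in W2.
rewrite -/W -/e in W3.
have [D' ED] := Zodd_ex (odd_Zmod od); rewrite -/D in ED.
have [N' EN'] := Zodd_ex (odd_Zmod oN); rewrite -/NZ in EN'.
have [w HT] : (8 | 1 * Tot - ((4 * sbit (kron (- y) d)) * R + 0 * X + (A * y + x - D * (A * x - NZ * B + y) + (D - 1)) * S + 4 * Ma + 0 * Mc + 0 * Ml))%Z.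
  apply: Tot_cong => n Dn.
  have on : odd (N %/ n) by apply: (dvdn_odd _ oN); apply: dvdn_div.
  have [v V] := pair_mod8_odd (cofactor Dn) (cofactor_gt0 Dn) d0 xyzE on od.
  by exists v; rewrite -/D in V; lia.
have [wa Wa] := Ma_par; have [wf Wf] := F_odd od; have [w4 W4] := K4.
have [w1 W1] := HS8.
have [fD FD] := Zsqr8 (odd_Zmod od); rewrite -/D in FD.
have [fN FN] := Zsqr8 (odd_Zmod oN); rewrite -/NZ in FN.
(* Written so that every summand on the right has one of the factors [(A D - 1) S], [D^2 - 1],
   [N^2 - 1], [S - N X], all divisible by 8. *)
have E1 : (S * (A * y + x - D * (A * x - NZ * B + y)) - B * D * X =
  y * (D * ((A * D - 1) * S) - A * (D * D - 1) * S) - x * ((A * D - 1) * S) + D * B * (NZ * (S - NZ * X) + (NZ * NZ - 1) * X))%Z by ring.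
rewrite W1 W2 FD FN in E1.
have EK : K = (R + 4 * w4)%Z by lia.
have ES : S = (R + 2 * e + 4 * w3)%Z by lia.
rewrite /psi_num; case: ifP => [ol|/negbT el].
  (* [(A D - 1) (N - 1)] is a multiple of 4. The missing factor 2 comes from [K + 2 e] when [R] is
     even; when [R] is odd, [A D] is an odd square, so 8 divides [A D - 1]. *)
  have [w5 W5] : exists w5, ((K + 2 * e) * ((A * D - 1) * (NZ - 1)) = 8 * w5)%Z.
    have [a' Ea] : exists a', (A * D = 2 * a' + 1)%Z.
      by apply: Zodd_ex; rewrite /A /D -Nat2Z.inj_mul; apply: odd_Zmod.
    case: (Z.eq_dec (R mod 2) 1) => [oR|/Zeven_ex [R' ER]].
      by have [v V] := Rodd_sq8 oR ol; rewrite V; exists ((K + 2 * e) * v * (NZ - 1))%Z; ring.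
    by rewrite Ea EN' EK ER; exists ((R' + 2 * w4 + e) * a' * N')%Z; ring.
  exists (w + wf + wa + (y * (D * w1 - A * fD * S) - x * w1 + D * B * (NZ * w2 + fN * X)) + D' * (- e + w3 - 3 * w4) + 3 * w5)%Z.
  have -> : Tot = (w * 8 + (4 * R * sbit (kron (- y) d) + S * (A * y + x - D * (A * x - NZ * B + y)) + (D - 1) * S + 4 * Ma))%Z by lia.
  have -> : (3 * (K + 2 * e) * (- (D - 1) + (A * D - 1) * (NZ - 1)) = 3 * ((K + 2 * e) * ((A * D - 1) * (NZ - 1))) - 3 * (K + 2 * e) * (D - 1))%Z by ring.
  rewrite W5 Wa.
  have -> : (4 * R * sbit (kron (- y) d) = wf * 8 + (2 * R * (D - 1) + 4 * (K * kb)))%Z by lia.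
  have -> : (S * (A * y + x - D * (A * x - NZ * B + y)) = B * D * X + (y * (D * (8 * w1) - A * (1 + 8 * fD - 1) * S) - x * (8 * w1) + D * B * (NZ * (w2 * 8) + (1 + 8 * fN - 1) * X)))%Z by lia.
  have -> : ((D - 1) * S = (D - 1) * (R + 2 * e + 4 * w3))%Z by rewrite -ES.
  have -> : (3 * (K + 2 * e) * (D - 1) = 3 * (R + 4 * w4 + 2 * e) * (D - 1))%Z by rewrite -EK.
  have -> : (D - 1 = 2 * D')%Z by lia.
  ring.
have [X' EX'] := even_X8 el; have [S' ES'] := even_S8 el.
rewrite oN /=.
have [R' ER] : exists R', R = (2 * R')%Z by exists (4 * S' - e - 2 * w3)%Z; lia.
exists (w + wf + wa + (A * y + x - D * (A * x - NZ * B + y) + (D - 1)) * S' + R' * D' - B * D * X')%Z.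
have -> : Tot = (w * 8 + (4 * R * sbit (kron (- y) d) + (A * y + x - D * (A * x - NZ * B + y) + (D - 1)) * S + 4 * Ma))%Z by lia.
have -> : (4 * R * sbit (kron (- y) d) = wf * 8 + (2 * R * (D - 1) + 4 * (K * kb)))%Z by lia.
rewrite Wa EX' ES' ER.
have -> : (2 * (2 * R') * (D - 1) = 8 * R' * D')%Z by rewrite ED; ring.
ring.
Qed.

Lemma case_oddN_evend : odd N -> ~~ odd d -> goal8.
Proof.
move=> oN ed; have el : ~~ odd (a * d) by rewrite oddM negb_and ed orbT.
have [X' EX'] := even_X8 el; have [S' ES'] := even_S8 el.
have [_ [w3 W3]] := rel_oddN r N0 oN.
rewrite -/R -/S -/W -/e in W3.
have oy : (y mod 2 = 1)%Z.
  have := main_coprime_y; have : 2 %| d by rewrite dvdn2.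
  move=> H /(coprime_dvdr H); rewrite coprimen2.
  by have := Zabs2Nat.id_abs y; have := odd_double_half (Z.abs_nat y); rewrite -muln2; case: odd => //; mlia.
rewrite /goal8 /psi_num (negPf el) oN /=; apply: (odd_cancel8 oy).
set io := (if (y mod 4 =? 1)%Z then 1 else 0)%Z.
set sd := sbit (kron D (Z.abs_nat y)).
have [w HT] : (8 | y * Tot - ((y + 5 + 4 * sd) * R + z * X + (y * (A * y + x) - y + D) * S + 4 * Ma + (4 * io) * Mc + 0 * Ml))%Z.
  apply: Tot_cong => n Dn.
  have on : odd (N %/ n) by apply: (dvdn_odd _ oN); apply: dvdn_div.
  have [v V] := pair_mod8_mid (cofactor Dn) (cofactor_gt0 Dn) d0 xyzE on oy.
  by exists v; rewrite -/D -/io -/sd in V; lia.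
have [wa Wa] := Ma_par; have [wc Wc] := Mc_par; have [w4 W4] := K4.
have [j Ej] : exists j, R = (4 * j - 2 * e)%Z by exists (2 * S' - w3)%Z; lia.
have [y' Ey] := Zodd_ex oy.
have EK : K = (4 * j - 2 * e + 4 * w4)%Z by lia.
(* With [R = 4 j - 2 e] the term [- 2 e (y + 5)] is a multiple of 8 when [y] is 3 modulo 4;
   otherwise the [chi4] bit [4 io e] makes up for it. *)
have [u U] : exists u, ((y + 5) * R + 4 * io * e = 8 * u)%Z.
  have [v [V|V]] : exists v, (y = 4 * v + 1 \/ y = 4 * v + 3)%Z by exists (y / 4)%Z; mlia.
    have -> : io = 1%Z by rewrite /io V; have -> : ((4 * v + 1) mod 4 = 1)%Z by mlia.
    by exists (2 * v * j - v * e + 3 * j - e)%Z; rewrite Ej V; ring.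
  have -> : io = 0%Z by rewrite /io V; have -> : ((4 * v + 3) mod 4 = 3)%Z by mlia.
  by exists (2 * v * j - v * e + 4 * j - 2 * e)%Z; rewrite Ej V; ring.
exists (w + u + sd * (2 * j - e) + z * X' + (y * (A * y + x) - y + D) * S' + wa + io * wc - y' * ka - y * (2 * j - e + 2 * w4) * kb - y * B * D * X')%Z.
have -> : (y * (Tot - (B * D * X - 0 + 4 * ka + 4 * (K * kb))) = y * Tot - y * (B * D * X) - 4 * y * ka - 4 * y * K * kb)%Z by ring.
have -> : (y * Tot = w * 8 + (((y + 5) * R + 4 * io * e) + 4 * sd * R + z * X + (y * (A * y + x) - y + D) * S + 4 * Ma + 4 * io * (2 * wc)))%Z by rewrite Wc in HT; lia.
rewrite U Wa EX' ES' Ej EK.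
have -> : (4 * y * ka = 4 * (2 * y' + 1) * ka)%Z by rewrite -Ey.
ring.
Qed.

Lemma evenN_parity : ~~ odd N -> [/\ (A mod 2 = 1)%Z, (x mod 2 = 1)%Z & (y mod 2 = 1)%Z].
Proof.
move=> eN; have := main_axy; have [n ->] : exists n, NZ = (2 * n)%Z.
  by exists (Z.of_nat N./2); have := odd_double_half N; rewrite (negPf eN) -muln2 /NZ; lia.
move: A => A0 E.
have M u v : ((u * v) mod 2 = 1 -> u mod 2 = 1 /\ v mod 2 = 1)%Z.
  rewrite Z.mul_mod //.
  have [->|->] : (u mod 2 = 0 \/ u mod 2 = 1)%Z by mlia.
    by [].
  by have [->|->] : (v mod 2 = 0 \/ v mod 2 = 1)%Z by mlia.
have /M [oA /M [ox oy]] : ((A0 * (x * y)) mod 2 = 1)%Z by rewrite E; mlia.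
by split.
Qed.

Let Lam := sbit (kron (A * (x * y)) 2).
(** The part of [x y Tot] modulo 8 that involves neither [X] and [S] nor the symbols of the final
    formula. *)
Let rest := (5 * (x - y) * R + R * (A - 1) * (y - 1) + 2 * e * (x * y - 1) + 4 * Lam * al)%Z.

Lemma evenN_Tot : ~~ odd N -> exists w, (x * y * Tot = 8 * w + (rest + 4 * (K * kb) + 4 * ka
  + (x * z + y * t) * X + (x * D - y) * S))%Z.
Proof.
move=> eN; have [oA ox oy] := evenN_parity eN.
set i3 := (if ((x * y) mod 4 =? 3)%Z then 1 else 0)%Z.
set sd := sbit (kron D (Z.abs_nat y)).
have [w HT] : (8 | x * y * Tot - ((5 * (x - y) + 4 * sd) * R + (x * z + y * t) * X + (x * D - y) * S + 4 * Ma + (4 * i3) * Mc + (4 * Lam) * Ml))%Z.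
  apply: Tot_cong => n Dn.
  have [v V] := pair_mod8_even (cofactor Dn) (cofactor_gt0 Dn) d0 xyzE oA ox oy.
  by exists v; rewrite -/D -/i3 -/sd -/Lam -/t in V; lia.
have oa : odd a by have := odd_double_half a; rewrite -muln2; case: odd => // Ea; move: oA; rewrite /A; mlia.
have [wa Wa] := Ma_par; have [wc Wc] := Mc_par; have [wl Wl] := Ml_par; have [wf Wf] := F_even oa oy.
rewrite -/sd in Wf.
have [v V] : exists v, (4 * i3 = 2 * (x * y - 1) + 8 * v)%Z.
  have : ((x * y) mod 2 = 1)%Z by rewrite Z.mul_mod // ox oy.
  rewrite /i3; move: (x * y)%Z => q oq.
  exists ((4 * (if (q mod 4 =? 3)%Z then 1 else 0) - 2 * (q - 1)) / 8)%Z.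
  by case: Z.eqb_spec => ?; mlia.
exists (w + wf + wa + i3 * wc + v * e + Lam * wl)%Z.
have -> : (x * y * Tot = w * 8 + ((5 * (x - y) + 4 * sd) * R + (x * z + y * t) * X + (x * D - y) * S + 4 * Ma + (4 * i3) * Mc + (4 * Lam) * Ml))%Z by lia.
rewrite Wa Wc Wl /rest.
have -> : ((5 * (x - y) + 4 * sd) * R = 5 * (x - y) * R + 4 * R * sd)%Z by ring.
have -> : (4 * R * sd = wf * 8 + (4 * (K * kb) + R * (A - 1) * (y - 1)))%Z by lia.
have -> : (4 * i3 * (e + 2 * wc) = (4 * i3) * e + 8 * i3 * wc)%Z by ring.
rewrite {1}V; ring.
Qed.

(** [goal8] may be multiplied by the odd number [x y]; the symbol bits carry a factor 4 and do not
    feel it. *)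
Lemma evenN_reduce : ~~ odd N ->
  (8 | rest + (x * z + y * t) * X + (x * D - y) * S - x * y * (B * D * X) + x * y * psi_num)%Z -> goal8.
Proof.
move=> eN [u U]; have [oA ox oy] := evenN_parity eN; have [w Hw] := evenN_Tot eN.
have oxy : ((x * y) mod 2 = 1)%Z by rewrite Z.mul_mod // ox oy.
apply: (odd_cancel8 oxy); have [v V] := Zodd_ex oxy.
exists (w + u - v * (ka + K * kb))%Z.
have -> : (x * y * (Tot - (B * D * X - psi_num + 4 * ka + 4 * (K * kb))) = x * y * Tot - x * y * (B * D * X) + x * y * psi_num - x * y * (4 * ka + 4 * (K * kb)))%Z by ring.
rewrite Hw.
have -> : (x * y * (4 * ka + 4 * (K * kb)) = (2 * v + 1) * (4 * ka + 4 * (K * kb)))%Z by rewrite -V.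
lia.
Qed.

Lemma Lam_isq : ~~ odd N -> Lam = isq 3 5 (A * (x * y)).
Proof.
move=> eN; have [oA ox oy] := evenN_parity eN.
have : ((A * (x * y)) mod 2 = 1)%Z by rewrite Z.mul_mod // (Z.mul_mod x) // oA ox oy.
rewrite /Lam; move: (A * (x * y))%Z => q oq; rewrite kron_2_even // /isq.
have [|[|[|]]] : (q mod 8 = 1 \/ q mod 8 = 3 \/ q mod 8 = 5 \/ q mod 8 = 7)%Z by mlia.
all: by move=> ->.
Qed.

(* [D X = A X] and [D S = A S] modulo 8. *)
Lemma evenN_oddl : ~~ odd N -> odd d -> let q := (A * (x * y))%Z in
  exists w, ((x * z + y * t) * X + (x * D - y) * S - x * y * (B * D * X)
    = (1 - q) * (B + x * z) * X + y * (q - 1) * S + 8 * w)%Z.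
Proof.
move=> eN od q; have [oA ox oy] := evenN_parity eN.
have [w1 W1] := HX8; have [w2 W2] := HS8.
have [fD FD] := Zsqr8 (odd_Zmod od); rewrite -/D in FD.
have [fx Fx] := Zsqr8 ox; have [fy Fy] := Zsqr8 oy.
have EX : (D * X = A * X - D * ((A * D - 1) * X) + A * (D * D - 1) * X)%Z by ring.
have ES : (D * S = A * S - D * ((A * D - 1) * S) + A * (D * D - 1) * S)%Z by ring.
rewrite W1 FD in EX; rewrite W2 FD in ES.
exists (fy * B * X - (x * y * B + y * z) * (A * fD * X - D * w1) + z * A * y * fx * X + x * (A * fD * S - D * w2) - A * x * fy * S)%Z.
have -> : ((x * z + y * t) * X + (x * D - y) * S - x * y * (B * D * X) = (x * z + B * (y * y)) * X - (x * y * B + y * z) * (D * X) + x * (D * S) - y * S)%Z by rewrite /t; ring.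
rewrite EX ES.
have -> : ((1 - q) * (B + x * z) * X + y * (q - 1) * S = (B * (1 - q) + z * (x - A * y * (x * x))) * X + (A * x * (y * y) - y) * S)%Z by rewrite /q; ring.
rewrite Fx Fy /q; ring.
Qed.

Lemma odd_ad_l : odd d -> ~~ odd N -> odd (a * d).
Proof.
move=> od eN; have [oA _ _] := evenN_parity eN; rewrite oddM od andbT.
by have := odd_double_half a; rewrite -muln2; case: odd => // Ea; move: oA; rewrite /A; mlia.
Qed.

Lemma AD_odd : odd (a * d) -> exists c, (A * D - 1 = 2 * c)%Z.
Proof.
move=> ol; have [c C] := Zodd_ex (odd_Zmod ol); exists c.
by rewrite /A /D; rewrite Nat2Z.inj_mul in C; lia.
Qed.

Lemma t_parity x' y' D' : x = (2 * x' + 1)%Z -> y = (2 * y' + 1)%Z -> D = (2 * D' + 1)%Z ->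
  (B + x * z = t + 2 * (- y' * B + z * (x' + D' + 1)))%Z.
Proof. by move=> Ex Ey ED; rewrite /t Ex Ey ED; ring. Qed.

(** Now [A x y = 1 + 4 ta], so [Lam] has the parity of [ta], and besides [f1] there remains
    [4 ta (R + X + S + al)]. The bracket is even by [rel_4N1] if [N / 4] is odd; otherwise [ta] is
    even. *)
Lemma case_4N_oddd N2 : N = 4 * N2 -> odd d -> goal8.
Proof.
move=> EN od; have eN : ~~ odd N by rewrite EN oddM.
have ol := odd_ad_l od eN; have [c C] := AD_odd ol.
have [oA ox oy] := evenN_parity eN.
have [x' Ex] := Zodd_ex ox; have [y' Ey] := Zodd_ex oy; have [D' ED] := Zodd_ex (odd_Zmod od).
rewrite -/D in ED.
apply: (evenN_reduce eN); have [w Hw] := evenN_oddl eN od.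
have EN' : NZ = (4 * Z.of_nat N2)%Z by rewrite /NZ EN Nat2Z.inj_mul.
set n2 := Z.of_nat N2 in EN'; set ta := (n2 * t)%Z.
have Eq : (A * (x * y) = 1 + 4 * ta)%Z by rewrite main_axy EN' /ta; ring.
have [v Ev] : exists v, (Lam = ta + 2 * v)%Z.
  rewrite (Lam_isq eN) Eq /isq.
  have [u [U|U]] : exists u, (ta = 2 * u \/ ta = 2 * u + 1)%Z by exists (ta / 2)%Z; mlia.
    by rewrite U (_ : ((1 + 4 * (2 * u)) mod 8 = 1)%Z); [exists (- u)%Z; rewrite /=; lia|mlia].
  by rewrite U (_ : ((1 + 4 * (2 * u + 1)) mod 8 = 5)%Z); [exists (- u)%Z; rewrite /=; lia|mlia].
have [m Em] : exists m, (t * t + t = 2 * m)%Z.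
  have [u [U|U]] : exists u, (t = 2 * u \/ t = 2 * u + 1)%Z by exists (t / 2)%Z; mlia.
    by rewrite U; exists (2 * u * u + u)%Z; ring.
  by rewrite U; exists (2 * u * u + 3 * u + 1)%Z; ring.
have [w4 W4] := K4; have EK : K = (R + 4 * w4)%Z by lia.
have [w1 W1] : (8 | f1 A D x y ta R e)%Z.
  apply: f1_dvd => //; [exact: odd_Zmod|by rewrite Eq; exists 0%Z; ring|exact: e01|].
  by move=> oR; have [u U] := Rodd_sq8 oR ol; exists u; lia.
have [j Ej] : exists j, (ta * (R + X + S + al) = 2 * j)%Z.
  case: (boolP (odd N2)) => oN2.
    have [j Hj] := rel_4N1 r N0 oN2 EN.
    exists (ta * j)%Z; rewrite (_ : (R + X + S + al = j * 2)%Z); [ring|exact: Hj].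
  have [n3 N3] : exists n3, n2 = (2 * n3)%Z.
    by exists (Z.of_nat N2./2); have := odd_double_half N2; rewrite (negPf oN2) -muln2 /n2; lia.
  by exists (n3 * t * (R + X + S + al))%Z; rewrite /ta N3; ring.
have -> : (rest + (x * z + y * t) * X + (x * D - y) * S - x * y * (B * D * X) + x * y * psi_num = rest + ((x * z + y * t) * X + (x * D - y) * S - x * y * (B * D * X)) + x * y * psi_num)%Z by ring.
rewrite Hw (t_parity Ex Ey ED) Eq /psi_num ol; set h := (- y' * B + z * (x' + D' + 1))%Z.
exists (w + w1 + j + (- n2 * m * X - ta * h * X + y' * ta * S + v * al) + 3 * (x * y) * ((R + 2 * e) * c * n2 + w4 * (- D' + c * (4 * n2 - 1))))%Z.
have -> : rest = (f1 A D x y ta R e + 4 * ta * R + 3 * (x * y) * (R + 2 * e) * (D - 1 + (A * D - 1)) + 4 * Lam * al)%Z by rewrite /rest /f1; ring.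
rewrite W1 Ev EN' C EK.
have -> : (D - 1 = 2 * D')%Z by lia.
have -> : ((1 - (1 + 4 * ta)) * (t + 2 * h) * X = - 4 * n2 * (t * t + t) * X + 4 * ta * X - 8 * ta * h * X)%Z by rewrite /ta; ring.
have -> : (y * (1 + 4 * ta - 1) * S = 4 * ta * S + 8 * y' * ta * S)%Z by rewrite Ey; ring.
rewrite Em.
have -> : (w1 * 8 + 4 * ta * R = w1 * 8 + 4 * (ta * (R + X + S + al)) - 4 * ta * (X + S + al))%Z by ring.
rewrite Ej; ring.
Qed.

Lemma case_2N_oddd N1 : odd N1 -> N = 2 * N1 -> odd d -> goal8.
Proof.
move=> oN1 EN od; have eN : ~~ odd N by rewrite EN oddM.
have ol := odd_ad_l od eN; have [c C] := AD_odd ol.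
have [oA ox oy] := evenN_parity eN.
have [x' Ex] := Zodd_ex ox; have [y' Ey] := Zodd_ex oy; have [D' ED] := Zodd_ex (odd_Zmod od).
have [A' EA] := Zodd_ex oA.
rewrite -/D in ED.
apply: (evenN_reduce eN); have [w Hw] := evenN_oddl eN od.
have EN' : NZ = (2 * Z.of_nat N1)%Z by rewrite /NZ EN Nat2Z.inj_mul.
have [n1' En1] := Zodd_ex (odd_Zmod oN1).
set n1 := Z.of_nat N1 in EN' En1.
have Eq : (A * (x * y) = 1 + 2 * n1 * t)%Z by rewrite main_axy EN'; ring.
have [[j Hj] [v2 Hv2]] := rel_2N1 r N0 oN1 EN.
rewrite -/R -/S -/W -/e -/n1 -/al in Hj Hv2.
have EX : moment N r Z.of_nat = X by []. rewrite EX in Hj Hv2.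
have [w4 W4] := K4.
set kp := isq 3 7 (A * (x * y)).
(* Removes [B] and [z] from the [X] term. The case of odd [t] splits again: if [A D - 1] is 2 modulo
   4, then 4 divides [X]; otherwise [x + D y] is 0 modulo 4, which turns [B + x z] into [y t] modulo
   4. *)
have [u1 U1] : exists u1, ((1 - A * (x * y)) * (B + x * z) * X = - (2 * kp * y * (n1 * X)) + 8 * u1)%Z.
  have [t' [Et|Et]] : exists u, (t = 2 * u \/ t = 2 * u + 1)%Z by exists (t / 2)%Z; mlia.
    have -> : kp = 0%Z.
      rewrite /kp Eq Et /isq; set m := (n1 * t')%Z.
      have -> : (1 + 2 * n1 * (2 * t') = 4 * m + 1)%Z by rewrite /m; ring.
      by case: Z.eqb_spec => ?; [mlia|case: Z.eqb_spec => ? //; mlia].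
    rewrite Eq (t_parity Ex Ey ED) Et; set h := (- y' * B + _)%Z.
    by exists (- n1 * t' * (t' + h) * X)%Z; ring.
  have kp1 : kp = 1%Z.
    rewrite /kp Eq Et En1 /isq; set m := (2 * n1' * t' + n1' + t')%Z.
    have -> : (1 + 2 * (2 * n1' + 1) * (2 * t' + 1) = 4 * m + 3)%Z by rewrite /m; ring.
    have [o [O|O]] : exists o, (m = 2 * o \/ m = 2 * o + 1)%Z by exists (m / 2)%Z; mlia.
      by rewrite O (_ : ((4 * (2 * o) + 3) mod 8 = 3)%Z); [|mlia].
    by rewrite O (_ : ((4 * (2 * o + 1) + 3) mod 8 = 7)%Z); [|mlia].
  rewrite kp1; have [w5 W5] := HX8; rewrite C in W5.
  have [c' [Ec|Ec]] : exists u, (c = 2 * u + 1 \/ c = 2 * u)%Z by exists (c / 2)%Z; mlia.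
    have [X' EX'] : (8 | 2 * X)%Z.
      by apply: (@odd_cancel8 (2 * c' + 1)); [mlia|exists w5; rewrite Ec in W5; lia].
    have {}EX' : X = (4 * X')%Z by lia.
    by exists (- n1 * t * (B + x * z) * X' + y * n1 * X')%Z; rewrite Eq EX'; ring.
  have [s0 S0] : (8 | 2 * (x + D * y))%Z.
    apply: (@odd_cancel8 (A * y)); first by rewrite Z.mul_mod // oA oy.
    have [fy Fy] := Zsqr8 oy.
    exists (1 + n1' * (2 * t' + 1) + t' + c' * (y * y) + 2 * fy)%Z.
    have -> : (A * y * (2 * (x + D * y)) = 2 * (A * (x * y)) + 2 * (A * D - 1) * (y * y) + 2 * (y * y))%Z by ring.
    by rewrite Eq C Ec Et En1 Fy; ring.
  have [fy Fy] := Zsqr8 oy.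
  have E4 : (B + x * z = y * t + 4 * (s0 * z - 2 * fy * B))%Z.
    have -> : (y * t = B * (y * y) - D * y * z)%Z by rewrite /t; ring.
    have -> : x = (4 * s0 - D * y)%Z by lia.
    by rewrite Fy; ring.
  exists (- n1 * (y * (t' * t' + t') + t * (s0 * z - 2 * fy * B)) * X)%Z.
  by rewrite E4 Eq Et; ring.
have [w1 W1] : (8 | f2 A D x y (n1 * X) S e)%Z.
  apply: f2_dvd => //; first exact: odd_Zmod.
    by have [v V] := HX8; exists (n1 * v)%Z; rewrite Z.mul_assoc (Z.mul_comm _ n1) -Z.mul_assoc V; ring.
  by have [v V] := HS8; exists v; lia.
have -> : (rest + (x * z + y * t) * X + (x * D - y) * S - x * y * (B * D * X) + x * y * psi_num = rest + ((x * z + y * t) * X + (x * D - y) * S - x * y * (B * D * X)) + x * y * psi_num)%Z by ring.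
rewrite Hw U1 /psi_num ol.
(* The moment relation determines [R] only modulo 4; the difference [4 j] is carried along
   explicitly. *)
set R0 := (- (n1 * X + S) - 2 * e)%Z.
have ER : R = (R0 + 4 * j)%Z by rewrite /R0; lia.
have EK : K = (R0 + 4 * j + 4 * w4)%Z by lia.
set lam := isq 3 5 (A * (x * y)).
exists (w + w1 + u1 + 5 * (x' - y') * j + 2 * j * A' * y' + lam * v2 - lam * n1' * X + 3 * (x * y) * (c * n1' * (R0 + 2 * e) + (j + w4) * (- D' + c * (4 * n1' + 1))))%Z.
have -> : rest = (f2 A D x y (n1 * X) S e + 2 * kp * y * (n1 * X) - y * (A * (x * y) - 1) * S + 5 * (x - y) * (4 * j) + 4 * j * (A - 1) * (y - 1) + 4 * lam * (al - n1 * X) + 3 * (x * y) * (R0 + 2 * e) * (D - 1 - (A * D - 1)))%Z.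
  by rewrite /rest /f2 (Lam_isq eN) -/kp -/lam -/R0 ER; ring.
rewrite W1 EK EN'.
have -> : al = (X + 2 * v2)%Z by lia.
have -> : (x - y = 2 * (x' - y'))%Z by lia.
have -> : (y - 1 = 2 * y')%Z by lia.
have -> : (A - 1 = 2 * A')%Z by lia.
have -> : (4 * lam * (X + 2 * v2 - n1 * X) = 8 * (lam * v2 - lam * n1' * X))%Z by rewrite En1; ring.
rewrite C; have -> : (D - 1 = 2 * D')%Z by lia.
have -> : (2 * n1 - 1 = 4 * n1' + 1)%Z by lia.
move: (n1 * X)%Z R0 {W1 ER EK U1} => V R0'; ring.
Qed.

(** If [N / 2] is odd, 4 divides [K + 2 e]. If 4 divides [N], one more factor 2 is wanted: it comes
    from even [K], from [d1 = 1], or from 8 | [N]. In the one remaining case [K] is odd and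
    [v_2(varpi)] even with [N / 4] odd, against [rel_4N1]. *)
Lemma psi_b_dvd : ~~ odd N -> ~~ odd (a * d) -> exists p, (NZ * (K + 2 * e) * (1 + d1) = 8 * p)%Z.
Proof.
move=> eN el; have [X' EX'] := even_X8 el; have [S' ES'] := even_S8 el.
have [w4 W4] := K4; have EK : K = (R + 4 * w4)%Z by lia.
have [N1 EN] : exists N1, N = 2 * N1 by exists N./2; rewrite mul2n -{1}(odd_double_half N) (negPf eN).
have EX : moment N r Z.of_nat = X by [].
case: (boolP (odd N1)) => [oN1|eN1].
  have [[j Hj] _] := rel_2N1 r N0 oN1 EN.
  rewrite -/R -/S -/W -/e EX in Hj; set n1 := Z.of_nat N1 in Hj.
  exists (n1 * (j - 2 * n1 * X' - 2 * S' + w4) * (1 + d1))%Z.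
  have -> : (K + 2 * e = 4 * (j - 2 * n1 * X' - 2 * S' + w4))%Z by lia.
  by rewrite /NZ EN Nat2Z.inj_mul -/n1; ring.
have [N2 EN2] : exists N2, N = 4 * N2.
  by exists N1./2; rewrite EN -{1}(odd_double_half N1) (negPf eN1) add0n -muln2; lia.
have EN' : NZ = (4 * Z.of_nat N2)%Z by rewrite /NZ EN2 Nat2Z.inj_mul.
set n2 := Z.of_nat N2 in EN'.
rewrite EN'; case: (Z.eq_dec (K mod 2) 1) => [oK|/Zeven_ex [K' EK']]; last first.
  by exists (n2 * (K' + e) * (1 + d1))%Z; rewrite EK'; ring.
have ZK : Z.odd K by rewrite Zodd_mod oK.
have d4 : 4 %| N by rewrite EN2 dvdn_mulr.
case: (boolP (odd (logn 2 W))) => oal.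
  by exists (n2 * (K + 2 * e))%Z; rewrite d1E el d4 ZK oal /=; ring.
case: (boolP (odd N2)) => [oN2|eN2]; last first.
  exists (Z.of_nat N2./2 * (K + 2 * e) * (1 + d1))%Z.
  rewrite (_ : n2 = 2 * Z.of_nat N2./2)%Z; first by ring.
  by have := odd_double_half N2; rewrite (negPf eN2) -muln2 /n2; lia.
exfalso; have [j Hj] := rel_4N1 r N0 oN2 EN2.
rewrite -/R -/S -/W -/al EX in Hj.
have : (al mod 2 = 0)%Z.
  by have := odd_double_half (logn 2 W); rewrite (negPf oal) -muln2 /al; mlia.
mlia.
Qed.

Lemma case_evenN_evenl : ~~ odd N -> ~~ odd d -> goal8.
Proof.
move=> eN ed; have el : ~~ odd (a * d) by rewrite oddM negb_and ed orbT.
have [X' EX'] := even_X8 el; have [S' ES'] := even_S8 el.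
have [oA ox oy] := evenN_parity eN; have [A' EA] := Zodd_ex oA.
have [w4 W4] := K4; have EK : K = (R + 4 * w4)%Z by lia.
apply: (evenN_reduce eN).
have [p Hp] := psi_b_dvd eN el.
(* [ta] is 0 if [N / 2] is odd and [Lam] if 4 divides [N]; either way [4 Lam al] is [- 4 ta R]
   modulo 8, a term that [f3] contains. *)
have [ta [v [w1 [W1 Hv]]]] : exists ta v w1, f3 A x y ta R e = (8 * w1)%Z /\ (Lam * al + ta * R = 2 * v)%Z.
  have [N1 EN] : exists N1, N = 2 * N1 by exists N./2; rewrite mul2n -{1}(odd_double_half N) (negPf eN).
  case: (boolP (odd N1)) => [oN1|eN1].
    have [[j Hj] [v2 Hv2]] := rel_2N1 r N0 oN1 EN.
    rewrite -/R -/S -/W -/e -/al in Hj Hv2.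
    have EX : moment N r Z.of_nat = X by []. rewrite EX in Hj Hv2.
    set n1 := Z.of_nat N1 in Hj.
    have [w1 W1] : (8 | f3 A x y 0 R e)%Z.
      apply: f3_dvd => //; [right; split=> //; exists (j - 2 * n1 * X' - 2 * S')%Z; lia|exact: e01|by left].
    exists 0%Z, (Lam * (4 * X' + v2))%Z, w1.
    split; first by rewrite W1; ring.
    have -> : al = (2 * (4 * X' + v2))%Z by lia.
    by ring.
  have [N2 EN2] : exists N2, N = 4 * N2.
    by exists N1./2; rewrite EN -{1}(odd_double_half N1) (negPf eN1) add0n -muln2; lia.
  have EN' : NZ = (4 * Z.of_nat N2)%Z by rewrite /NZ EN2 Nat2Z.inj_mul.
  set n2 := Z.of_nat N2 in EN'; set ta := (n2 * t)%Z.
  have Eq : (A * (x * y) = 1 + 4 * ta)%Z by rewrite main_axy EN' /ta; ring.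
  have [u Eu] : exists u, (Lam = ta + 2 * u)%Z.
    rewrite (Lam_isq eN) Eq /isq.
    have [u [U|U]] : exists u, (ta = 2 * u \/ ta = 2 * u + 1)%Z by exists (ta / 2)%Z; mlia.
      by rewrite U (_ : ((1 + 4 * (2 * u)) mod 8 = 1)%Z); [exists (- u)%Z; rewrite /=; lia|mlia].
    by rewrite U (_ : ((1 + 4 * (2 * u + 1)) mod 8 = 5)%Z); [exists (- u)%Z; rewrite /=; lia|mlia].
  have [w1 W1] : (8 | f3 A x y Lam R e)%Z.
    by apply: f3_dvd => //; [left; rewrite Eq Eu; exists (- u)%Z; ring|exact: e01|exact: neg01].
  have alR : odd N2 -> exists j, (al + R = 2 * j)%Z.
    move=> oN2; have [j Hj] := rel_4N1 r N0 oN2 EN2.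
    rewrite -/R -/S -/W -/al in Hj; have EX : moment N r Z.of_nat = X by []. rewrite EX in Hj.
    by exists (j - 4 * X' - 4 * S')%Z; lia.
  have e2 : ~~ odd N2 -> exists n3, n2 = (2 * n3)%Z.
    by move=> oN2; exists (Z.of_nat N2./2); have := odd_double_half N2; rewrite (negPf oN2) -muln2 /n2; lia.
  have [v Hv] : exists v, (Lam * al + Lam * R = 2 * v)%Z.
    case: (boolP (odd N2)) => [/alR [j Hj]|/e2 [n3 N3]].
      by exists (Lam * j)%Z; rewrite -Z.mul_add_distr_l Hj; ring.
    exists ((n3 * t + u) * (al + R))%Z; rewrite Eu /ta N3; ring.
  by exists Lam, v, w1; split=> //; rewrite W1; ring.
exists (w1 + v + (x * z + y * t) * X' + (x * D - y) * S' - x * y * B * D * X' - 3 * (x * y) * w4 * A' - 3 * (x * y) * p * B)%Z.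
rewrite /psi_num (negPf el) eN.
have -> : rest = (f3 A x y ta R e + 4 * (Lam * al + ta * R) + 3 * (x * y) * (R + 2 * e) * (A - 1))%Z by rewrite /rest /f3; ring.
have -> : (3 * NZ * (K + 2 * e) * (1 + d1) * B = 3 * (NZ * (K + 2 * e) * (1 + d1)) * B)%Z by ring.
rewrite W1 Hv Hp EX' ES' EK.
have -> : (A - 1 = 2 * A')%Z by lia.
ring.
Qed.

Lemma main_mod8 : goal8.
Proof.
case: (boolP (odd N)) => [oN|eN]; case: (boolP (odd d)) => [od|ed].
- exact: case_oddN_oddd.
- exact: case_oddN_evend.
- have [N1 EN] : exists N1, N = 2 * N1 by exists N./2; rewrite mul2n -{1}(odd_double_half N) (negPf eN).
  case: (boolP (odd N1)) => [oN1|eN1]; first exact: (case_2N_oddd oN1 EN od).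
  apply: (@case_4N_oddd N1./2) => //.
  by rewrite EN -{1}(odd_double_half N1) (negPf eN1) add0n -muln2; lia.
- exact: case_evenN_evenl.
Qed.

Lemma main_mod3 : (3 | Tot - B * D * X)%Z.
Proof.
have [w HT] : (3 | 1 * Tot - (0 * R + (t * x + z * y) * X + (A * y + x - t * x * NZ - D * (A * x - NZ * B + y) - z * y * D * D * NZ) * S + 0 * Ma + 0 * Mc + 0 * Ml))%Z.
  apply: Tot_cong => n Dn.
  have [v V] := pair_mod3 (cofactor Dn) (cofactor_gt0 Dn) d0 xyzE.
  by exists v; rewrite -/D -/t in V; lia.
have [u U] : (3 | g3S A D x y B z NZ * S + g3X D x y B z * X)%Z.
  apply: mod3_dvd; first by rewrite main_axy.
  - by have [u U] := HX; exists (8 * u)%Z; lia.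
  - by have [u U] := HS; exists (8 * u)%Z; lia.
  move=> n3; apply: rel_coprime => // n Dn.
  have nn : (Z.of_nat n mod 3 <> 0)%Z.
    move=> E0; case/negP: n3; apply/Z.eqb_eq; rewrite (cofactor Dn) Z.mul_mod // E0.
    by [].
  have [q [Q|Q]] : exists q, (Z.of_nat n = 3 * q + 1 \/ Z.of_nat n = 3 * q + 2)%Z by exists (Z.of_nat n / 3)%Z; mlia.
    by exists (3 * q * q + 2 * q)%Z; rewrite Q; ring.
  by exists (3 * q * q + 4 * q + 1)%Z; rewrite Q; ring.
exists (w + u)%Z; rewrite /g3S /g3X -/t in U; lia.
Qed.

Lemma psi_num_mod3 : exists q, psi_num = (3 * q)%Z.
Proof.
rewrite /psi_num; case: ifP => _; [|case: ifP => _].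
- by exists ((K + 2 * e) * (- (D - 1) + (A * D - 1) * (NZ - 1)))%Z; ring.
- by exists (- ((K + 2 * e) * (A - 1)) - NZ * (K + 2 * e) * (1 + d1) * B)%Z; ring.
- by exists 0%Z.
Qed.

Lemma main_mod24 : exists q, (Tot = B * D * X - psi_num + 12 * ka + 12 * (K * kb) + 24 * q)%Z.
Proof.
have [u U] := main_mod8; have [v V] := main_mod3; have [p P] := psi_num_mod3.
(* Chinese remainders: a number equal to both [8 U] and [3 V] is
   [9 * 8 U - 8 * 3 V = 24 (3 U - V)]. *)
exists (3 * (u - ka - K * kb) - (v + p - 4 * ka - 4 * (K * kb)))%Z; lia.
Qed.
End Main.

End PairCongruence.

(** * The multiplier values in a Hecke coefficient *)

Module HeckeMultipliers.

Require Import Defs.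
Import DedekindSums GaussLemma KroneckerSymbol DedekindKronecker PsiIntegrality PsiKronecker PsiPairs CongruencesMod8 Moments PairCongruence.
From Stdlib Require Import Reals ZArith Lia Lra Zdiv ClassicalEpsilon.
From Coquelicot Require Import Coquelicot.
From mathcomp Require Import all_boot.
From mathcomp Require Import zify.
Delimit Scope R_scope with R.
Set Implicit Arguments. Unset Strict Implicit. Unset Printing Implicit Defensive.
Local Open Scope nat_scope.
Local Arguments Z.mul : simpl never.
Local Arguments Z.add : simpl never.
Local Arguments Z.sub : simpl never.
Local Arguments Z.of_nat : simpl never.

Lemma cexp_add z w : cexp (z + w)%C = (cexp z * cexp w)%C.
Proof.
case: z w => [a b] [c d]; rewrite /cexp /Cplus /Cmult /=.
by rewrite exp_plus cos_plus sin_plus; f_equal; ring.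
Qed.

Lemma e_add z w : e (z + w)%C = (e z * e w)%C.
Proof. by rewrite /e Cmult_plus_distr_l cexp_add. Qed.

Lemma eR_add x y : eR (x + y)%R = (eR x * eR y)%C.
Proof. by rewrite /eR RtoC_plus e_add. Qed.

Lemma eRE x : eR x = (cos (2 * PI * x), sin (2 * PI * x))%R.
Proof.
have E : (RtoC (2 * PI) * Ci * RtoC x)%C = (0%R, (2 * PI * x)%R).
  by rewrite /RtoC /Ci /Cmult /=; f_equal; ring.
by rewrite /eR /e E /cexp /= exp_0; f_equal; ring.
Qed.

Lemma eR_0 : eR 0%R = RtoC 1%R.
Proof. by rewrite eRE Rmult_0_r cos_0 sin_0. Qed.

Lemma eR_oppM x : (eR (- x)%R * eR x = RtoC 1%R)%C.
Proof. by rewrite -eR_add Rplus_opp_l eR_0. Qed.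

Lemma eR_neq0 x : eR x <> RtoC 0%R.
Proof.
move=> E; have := eR_oppM x; rewrite E Cmult_0_r => H; apply: R1_neq_R0.
by apply: RtoC_inj.
Qed.

Lemma eR_nat n : eR (INR n) = RtoC 1%R.
Proof.
rewrite eRE; have -> : (2 * PI * INR n = 0 + 2 * INR n * PI)%R by ring.
by rewrite cos_period sin_period cos_0 sin_0.
Qed.

Lemma eR_int n : eR (IZR n) = RtoC 1%R.
Proof.
case: (Z.le_ge_cases 0 n) => s.
  by rewrite -(Z2Nat.id n) // -INR_IZR_INZ eR_nat.
have := eR_oppM (IZR n); rewrite -opp_IZR -(Z2Nat.id (- n)); last lia.
by rewrite -INR_IZR_INZ eR_nat Cmult_1_l.
Qed.

Lemma eR_inv x : Cinv (eR x) = eR (- x)%R.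
Proof.
rewrite -[LHS]Cmult_1_l -(eR_oppM x) -Cmult_assoc Cinv_r ?Cmult_1_r //; exact: eR_neq0.
Qed.

Lemma eR_half : eR (- (1 / 2))%R = RtoC (-1)%R.
Proof.
rewrite eRE; have -> : (2 * PI * - (1 / 2) = - PI)%R by field.
by rewrite cos_neg sin_neg cos_PI sin_PI Ropp_0.
Qed.

Lemma eR_sign u : pm u -> eR (- (IZR (sbit u) / 2))%R = RtoC (IZR u).
Proof.
case=> ->; rewrite /sbit /=; last exact: eR_half.
by rewrite (_ : (- (0 / 2) = 0)%R) ?eR_0 //; field.
Qed.

Lemma eR_signK u K : pm u -> eR (- (IZR (K * sbit u) / 2))%R = RtoC (powerRZ (IZR u) K).
Proof.
case=> ->; rewrite /sbit /=.
  rewrite Z.mul_0_r powerRZ_R1 (_ : (- (0 / 2) = 0)%R) ?eR_0 //; field.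
rewrite Z.mul_1_r.
have sq j : (powerRZ (-1) j * powerRZ (-1) j = 1)%R.
  rewrite -powerRZ_mult_distr_depr; last by right; lra.
  by rewrite (_ : (-1 * -1 = 1)%R) ?powerRZ_R1 //; ring.
have [j [Ej|Ej]] : exists j, (K = j + j \/ K = j + j + 1)%Z by exists (K / 2)%Z; mlia.
  rewrite Ej powerRZ_add ?sq; last lra.
  by rewrite (_ : (- (IZR (j + j) / 2) = IZR (- j))%R) ?eR_int // opp_IZR plus_IZR; field.
rewrite Ej powerRZ_add ?powerRZ_add ?sq; try lra.
rewrite powerRZ_1 Rmult_1_l (_ : (- (IZR (j + j + 1) / 2) = IZR (- j) + - (1 / 2))%R).
  by rewrite eR_add eR_int eR_half Cmult_1_l.
by rewrite opp_IZR !plus_IZR; field.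
Qed.

Lemma Cpowz1 n : Cpowz (RtoC 1%R) n = RtoC 1%R.
Proof.
case: n => [//|p|p] /=; rewrite Cpow_1_l // -{1}(Cmult_1_l (/ RtoC 1%R)%C) Cinv_r //.
by move=> /RtoC_inj; lra.
Qed.

Lemma dvd_nat_Z (p n : nat) : (Z.of_nat p | Z.of_nat n)%Z -> p %| n.
Proof. by move=> [q Q]; apply/dvdnP; exists (Z.abs_nat q); nia. Qed.

Lemma xyz_exists (N a b d : nat) : 0 < N -> 0 < a -> 0 < d -> coprime a N -> gcdn (gcdn a b) d = 1 ->
  exists x y z : Z, ((- Z.of_nat N * Z.of_nat b + Z.of_nat a * x) * y + Z.of_nat N * Z.of_nat d * z = 1)%Z.
Proof.
move=> N0 a0 d0 caN cabd.
suff [x cx] : exists x : nat, coprime (Z.abs_nat (- Z.of_nat N * Z.of_nat b + Z.of_nat a * Z.of_nat x)) (Z.abs_nat (Z.of_nat N * Z.of_nat d)).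
  by have [u [v uv]] := coprime_bezout cx; exists (Z.of_nat x), u, v.
rewrite abs_nat_mul.
(* For [b = 0] the list of primes of [N b] would be empty; there [x = 1] works, since [a] is prime
   to [d]. *)
case: (posnP b) => [b0|b0].
  exists 1; have -> : (- Z.of_nat N * Z.of_nat b + Z.of_nat a * Z.of_nat 1 = Z.of_nat a)%Z by rewrite b0; lia.
  have cad : gcdn a d = 1 by rewrite b0 gcdn0 in cabd.
  by rewrite Zabs2Nat.id coprimeMr caN /coprime cad.
have v0 : 0 < N * b by rewrite muln_gt0 N0.
have w0 : 0 < N * d by rewrite muln_gt0 N0.
(* The part of [N d] built from primes not dividing [N b], so a prime of [N d] divides exactly one
   of [N b] and [x]. A prime dividing [N b] cannot divide [a]: it would not divide [N], hence would
   divide [b] and [d]. *)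
exists ((N * d)`_(\pi(N * b)^')).
set x := (_)`_ _.
apply/negPn/negP => nc.
set g := gcdn (Z.abs_nat (- Z.of_nat N * Z.of_nat b + Z.of_nat a * Z.of_nat x)) (N * d).
have gp : 0 < g by rewrite gcdn_gt0 w0 orbT.
have g1 : 1 < g by rewrite ltn_neqAle gp andbT eq_sym; exact: nc.
have pp := pdiv_prime g1; set p := pdiv g in pp.
have pw : p %| N * d by apply: dvdn_trans (pdiv_dvd g) (dvdn_gcdr _ _).
have [q Q] : (Z.of_nat p | - Z.of_nat N * Z.of_nat b + Z.of_nat a * Z.of_nat x)%Z.
  have /dvdnP [q Q] : p %| Z.abs_nat (- Z.of_nat N * Z.of_nat b + Z.of_nat a * Z.of_nat x).
    exact: dvdn_trans (pdiv_dvd g) (dvdn_gcdl _ _).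
  apply/Z.divide_abs_r; rewrite -Zabs2Nat.id_abs Q Nat2Z.inj_mul; exists (Z.of_nat q); ring.
have px : p %| a * x -> p %| N * b.
  case/dvdnP => u U; apply: dvd_nat_Z; exists (Z.of_nat u - q)%Z; rewrite Nat2Z.inj_mul.
  by have := congr1 Z.of_nat U; rewrite !Nat2Z.inj_mul; lia.
have xp : p %| N * b -> p %| a * x.
  case/dvdnP => u U; apply: dvd_nat_Z; exists (Z.of_nat u + q)%Z; rewrite Nat2Z.inj_mul.
  by have := congr1 Z.of_nat U; rewrite !Nat2Z.inj_mul; lia.
have pin : (p \in \pi(N * b)) = (p %| N * b) by rewrite mem_primes pp v0.
have pxE : (p %| x) = (p \notin \pi(N * b)).
  have := @mem_primes p x.
  rewrite /x primes_part mem_filter !mem_primes pp part_gt0 w0 pw /= andbT => <-.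
  by rewrite !inE /= mem_primes pp v0.
case: (boolP (p %| N * b)) => pv; last first.
  by move/negP: (pv); apply; apply: px; rewrite dvdn_mull // pxE pin.
have := xp pv; rewrite Euclid_dvdM // pxE pin pv /= orbF => pa.
have nN : ~~ (p %| N).
  apply/negP => pN; have : p %| gcdn a N by rewrite dvdn_gcd pa.
  by rewrite (eqP caN) dvdn1 => /eqP p1; move: pp; rewrite p1.
move: pv pw; rewrite !Euclid_dvdM // (negPf nN) /= => pb pd.
have : p %| gcdn (gcdn a b) d by rewrite !dvdn_gcd pa pb.
by rewrite cabd dvdn1 => /eqP p1; move: pp; rewrite p1.
Qed.

Lemma xyzP (N a b d : nat) : 0 < N -> 0 < a -> 0 < d -> coprime a N -> gcdn (gcdn a b) d = 1 ->
  let '(x, y, z) := xyz (Z.of_nat N) (Z.of_nat a) (Z.of_nat b) (Z.of_nat d) in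
  ((- Z.of_nat N * Z.of_nat b + Z.of_nat a * x) * y + Z.of_nat N * Z.of_nat d * z = 1)%Z.
Proof.
move=> N0 a0 d0 c1 c2; rewrite /xyz; have [x [y [z E]]] := xyz_exists N0 a0 d0 c1 c2.
set P := fun t : Z * Z * Z => _.
have : P (epsilon (inhabits (0%Z, 0%Z, 0%Z)) P) by apply: epsilon_spec; exists (x, y, z).
by [].
Qed.

(** With [g] the gcd in [m_r], the number [24 / g] divides [l - 1] and [g] divides both moments. *)
Lemma in_Lr_dvd N r l : in_Lr N r l ->
  (24 | (Z.of_nat l - 1) * xN N r)%Z /\ (24 | (Z.of_nat l - 1) * moment N r (fun n => Z.of_nat (N %/ n)))%Z.
Proof.
case=> [l0 [+ _]]; rewrite /m_r.
set S := sumZ _ _; set g := Z.gcd 24 _ => H.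
have [u U] : (g | 24)%Z by exact: Z.gcd_divide_l.
have G : (g | Z.gcd S (xN N r))%Z by exact: Z.gcd_divide_r.
have [v V] := Z.divide_trans _ _ _ G (Z.gcd_divide_l _ _).
have [w Hw] := Z.divide_trans _ _ _ G (Z.gcd_divide_r _ _).
have g0 : (g <> 0)%Z by move=> E; rewrite E in U; lia.
have Eg : (24 / g = u)%Z by rewrite U Z.div_mul.
rewrite Eg in H.
have [q Q] : (u | Z.of_nat l - 1)%Z by apply/Z.mod_divide => // E; rewrite E in U; lia.
rewrite Q; split.
  by exists (q * w)%Z; rewrite Hw U; ring.
have -> : moment N r (fun n => Z.of_nat (N %/ n)) = S by [].
by exists (q * v)%Z; rewrite V U; ring.
Qed.

Section Coef.
Variables (N : nat) (r : nat -> Z) (K : Z) (l a b : nat).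
Hypotheses (N0 : 0 < N) (HK : ((K - sumr N r) mod 4 = 0)%Z) (Hl : in_Lr N r l).
Hypotheses (al : a %| l) (caN : coprime a N).
Let d := l %/ a.
Hypothesis cabd : gcdn (gcdn a b) d = 1.

Lemma Coef_l0 : 0 < l. Proof. by case: Hl. Qed.
Lemma Coef_a0 : 0 < a. Proof. exact: dvdn_gt0 Coef_l0 al. Qed.
Lemma Coef_d0 : 0 < d. Proof. by rewrite divn_gt0 ?Coef_a0 // dvdn_leq // Coef_l0. Qed.
Lemma Coef_l : l = a * d. Proof. by rewrite mulnC divnK. Qed.

Definition delta1Z : Z :=
  (if [&& ~~ odd (a * d), 4 %| N, Z.odd K & odd (logn 2 (varpi N r))] then 1 else 0)%Z.

Lemma psi_eR : psi N r K l a b = eR (IZR (psi_num N a b d r K delta1Z) / 24).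
Proof.
rewrite /psi /psi_num -/d.
have Edl : delta N r = IZR (sbit (chi4 (varpi N r))) by rewrite /delta /chi4; case: ifP.
have Ed1 : delta1 N r K l = IZR delta1Z by rewrite /delta1 /delta1Z -Coef_l; case: ifP.
rewrite Edl Ed1 -Coef_l.
have El : (INR l = IZR (Z.of_nat a) * IZR (Z.of_nat d))%R.
  by rewrite {1}Coef_l -mult_IZR -Nat2Z.inj_mul INR_IZR_INZ.
case: ifP => _; last case: ifP => _.
- rewrite El !INR_IZR_INZ !(mult_IZR, plus_IZR, minus_IZR, opp_IZR).
  by congr eR; field.
- rewrite !INR_IZR_INZ !(mult_IZR, plus_IZR, minus_IZR, opp_IZR).
  by congr eR; field.
- by rewrite (_ : (0 / 24 = 0)%R) ?eR_0 //; field.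
Qed.

(** [main_mod24] read through the exponential. The right side does not mention [x], [y], [z], which
    proves that the coefficient is independent of their choice. *)
Lemma chi_pair x y z :
  ((- Z.of_nat N * Z.of_nat b + Z.of_nat a * x) * y + Z.of_nat N * Z.of_nat d * z = 1)%Z ->
  (Cinv (chi N r (- Z.of_nat N * Z.of_nat b + Z.of_nat a * x) z (- Z.of_nat N * Z.of_nat d) y 1) *
   Cinv (chi N r (Z.of_nat a * y) (Z.of_nat b * y - Z.of_nat d * z) (Z.of_nat N) x 1)
  = RtoC (IZR (kron (Z.of_nat a) (varpi N r))) *
    RtoC (powerRZ (IZR (kron (- Z.of_nat N * Z.of_nat b) (gcdn a d))) K) *
    eR (- (INR b * INR d * IZR (xN N r) / 24)) * psi N r K l a b)%C.
Proof.
move=> E; have d0 := Coef_d0; have a0 := Coef_a0.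
rewrite /chi !Cpowz1 !Cmult_1_l !eR_inv -eR_add.
have [HX HS] := in_Lr_dvd Hl; rewrite Coef_l Nat2Z.inj_mul in HX HS.
have K4 : (4 | K - sumr N r)%Z by apply/Z.mod_divide.
have sq : (sumr N r mod 2 = 1)%Z -> exists s, a * d = s * s.
  by move=> o; case: Hl => _ [_ H]; have [|s Es] := H; [rewrite Zodd_mod o|exists s; rewrite -Coef_l].
have [q Q] := main_mod24 N0 a0 d0 E HX HS K4 sq (erefl delta1Z).
have Esum : (sumR (divisors N) (fun n => IZR (r n) * Psi (- Z.of_nat N * Z.of_nat b + Z.of_nat a * x) (z * Z.of_nat n) (- Z.of_nat N * Z.of_nat d / Z.of_nat n) y)
   + sumR (divisors N) (fun n => IZR (r n) * Psi (Z.of_nat a * y) ((Z.of_nat b * y - Z.of_nat d * z) * Z.of_nat n) (Z.of_nat N / Z.of_nat n) x)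
   = IZR (moment N r (fun n => psi_pair (Z.of_nat N) (Z.of_nat a) (Z.of_nat b) x y (N %/ n) d)))%R.
  rewrite /moment /sumR /sumZ.
  have H : forall n, n \in divisors N -> n %| N by move=> n; rewrite -dvdn_divisors.
  elim: (divisors N) H => [|n s IH] H /=; first by rewrite Rplus_0_r.
  rewrite plus_IZR mult_IZR -IH; last by move=> m ms; apply: H; rewrite inE ms orbT.
  have Dn := H n (mem_head _ _).
  have n0 : (0 < Z.of_nat n)%Z by have := dvdn_gt0 N0 Dn; lia.
  have EN : Z.of_nat N = (Z.of_nat n * Z.of_nat (N %/ n))%Z by rewrite -{1}(divnK Dn) Nat2Z.inj_mul Z.mul_comm.
  have m0 : 0 < N %/ n by rewrite divn_gt0 ?(dvdn_leq N0 Dn) // (dvdn_gt0 N0 Dn).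
  by rewrite -(Psi_pair EN m0 d0 E n0); ring.
rewrite (_ : forall u v, - (/ 24 * u) + - (/ 24 * v) = - (/ 24 * (u + v)))%R; last by move=> u v; ring.
rewrite Esum Q psi_eR.
have Pa : pm (kron (Z.of_nat a) (varpi N r)).
  apply: pm_kron; last first.
    rewrite Zabs2Nat.id /varpi /prodN.
    have H : forall n, n \in divisors N -> n %| N by move=> n; rewrite -dvdn_divisors.
    elim: (divisors N) H => [|n s IH] H /=; first by rewrite coprimen1.
    rewrite coprimeMr IH ?andbT; last by move=> m ms; apply: H; rewrite inE ms orbT.
    apply: coprimeXr; apply: coprime_dvdr caN; apply: dvdn_div; apply: H; exact: mem_head.
  rewrite /varpi /prodN.
  have H : forall n, n \in divisors N -> n %| N by move=> n; rewrite -dvdn_divisors.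
  elim: (divisors N) H => [|n s IH] H //=.
  rewrite muln_gt0 IH ?andbT; last by move=> m ms; apply: H; rewrite inE ms orbT.
  have Dn := H n (mem_head _ _).
  by rewrite expn_gt0 divn_gt0 ?(dvdn_leq N0 Dn) // (dvdn_gt0 N0 Dn).
have Pb : pm (kron (- Z.of_nat N * Z.of_nat b) (gcdn a d)) by eapply (pm_kron_NB r); eassumption.
rewrite -(eR_sign Pa) -(eR_signK K Pb) -!eR_add.
set ka := sbit _; set kb := (K * sbit _)%Z; set Qn := psi_num _ _ _ _ _ _ _.
rewrite (_ : (- (/ 24 * IZR (Z.of_nat b * Z.of_nat d * xN N r - Qn + 12 * ka + 12 * kb + 24 * q)) =
  (- (IZR ka / 2) + - (IZR kb / 2) + - (INR b * INR d * IZR (xN N r) / 24) + IZR Qn / 24) + IZR (- q))%R).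
  by rewrite [in LHS]eR_add eR_int Cmult_1_r.
by rewrite !INR_IZR_INZ !(mult_IZR, plus_IZR, minus_IZR, opp_IZR); field.
Qed.
End Coef.

End HeckeMultipliers.

(** * Series over the integers, re-indexing and uniqueness of coefficients *)

Module LaurentSeries.

Require Import Defs.
Import DedekindSums GaussLemma KroneckerSymbol DedekindKronecker PsiIntegrality PsiKronecker PsiPairs CongruencesMod8 Moments PairCongruence HeckeMultipliers.
From Stdlib Require Import Reals ZArith Lia Lra Zdiv ClassicalEpsilon FunctionalExtensionality.
From Coquelicot Require Import Coquelicot.
From mathcomp Require Import all_boot.
From mathcomp Require Import zify.
Delimit Scope R_scope with R.
Set Implicit Arguments. Unset Strict Implicit. Unset Printing Implicit Defensive.
Local Open Scope nat_scope.
Local Arguments Z.mul : simpl never.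
Local Arguments Z.add : simpl never.
Local Arguments Z.sub : simpl never.
Local Arguments Z.of_nat : simpl never.

Definition cser (u : nat -> C) (s : C) : Prop := @is_series C_AbsRing C_NormedModule u s.

Lemma cser_ext u v s : (forall n, u n = v n) -> cser u s -> cser v s.
Proof.
move=> H; apply: is_series_ext; exact: H.
Qed.

Lemma cser_scal c u s : cser u s -> cser (fun n => c * u n)%C (c * s)%C.
Proof.
move=> H; exact: (@is_series_scal_l C_AbsRing C_NormedModule c u s H).
Qed.

Lemma cser_plus u v s t : cser u s -> cser v t -> cser (fun n => u n + v n)%C (s + t)%C.
Proof.
move=> H1 H2; exact: (@is_series_plus C_AbsRing C_NormedModule u v s t H1 H2).
Qed.

Lemma cser_zero : cser (fun _ => RtoC 0%R) (RtoC 0%R).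
Proof.
apply: (filterlim_ext (fun _ : nat => RtoC 0%R)); last exact: filterlim_const.
move=> n; elim: n => [|n IH]; first by rewrite sum_O.
rewrite sum_Sn -IH; symmetry; exact: (@plus_zero_r C_AbelianMonoid).
Qed.

Lemma cser_unique u s t : cser u s -> cser u t -> s = t.
Proof.
move=> H1 H2; exact: (@filterlim_locally_unique _ C_AbsRing C_NormedModule eventually _ _ _ _ H1 H2).
Qed.

Lemma cser_cv u s : cser u s -> forall eps : R, (0 < eps)%R ->
  exists n0 : nat, forall n, (n0 <= n)%coq_nat -> (Cmod (sum_n u n - s)%C < eps)%R.
Proof.
move=> H eps e0.
have H' := proj1 (@filterlim_locally_ball_norm C_AbsRing nat C_NormedModule eventually _ (sum_n u) s) H.
have [n0 Hn] := H' (@filter_filter _ _ eventually_filter) (mkposreal eps e0).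
by exists n0 => n Hnn; exact: (Hn n Hnn).
Qed.

Lemma sum_n_stretch (q : nat) (u : nat -> C) n : 0 < q -> (forall i, ~~ (q %| i) -> u i = RtoC 0%R) ->
  sum_n u n = sum_n (fun j => u (q * j)) (n %/ q).
Proof.
move=> q0 H; elim: n => [|n IH]; first by rewrite div0n !sum_O muln0.
rewrite sum_Sn divnS // IH; case: (boolP (q %| n.+1)) => [D|nD].
  rewrite add1n sum_Sn (_ : q * (n %/ q).+1 = n.+1) //.
  by have := divnK D; rewrite divnS // D add1n mulnC.
rewrite add0n (H _ nD); exact: (@plus_zero_r C_AbelianMonoid).
Qed.

Lemma cser_stretch1 (q : nat) (u : nat -> C) s : 0 < q -> (forall i, ~~ (q %| i) -> u i = RtoC 0%R) ->
  cser u s -> cser (fun j => u (q * j)) s.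
Proof.
move=> q0 H Hs.
apply: (filterlim_ext (fun n => sum_n u (q * n))).
  by move=> n; rewrite (sum_n_stretch _ q0 H) mulKn.
apply: (filterlim_comp _ _ _ (fun n => q * n) (sum_n u) eventually eventually); last exact: Hs.
move=> P [n0 HP]; exists n0 => n Hn; apply: HP.
by apply/leP; apply: leq_trans (leq_pmull n q0); apply/leP.
Qed.

Lemma cser_stretch2 (q : nat) (u : nat -> C) s : 0 < q -> (forall i, ~~ (q %| i) -> u i = RtoC 0%R) ->
  cser (fun j => u (q * j)) s -> cser u s.
Proof.
move=> q0 H Hs.
apply: (filterlim_ext (fun n => sum_n (fun j => u (q * j)) (n %/ q))).
  by move=> n; rewrite (sum_n_stretch _ q0 H).
apply: (filterlim_comp _ _ _ (fun n => n %/ q) (sum_n (fun j => u (q * j))) eventually eventually); last exact: Hs.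
move=> P [n0 HP]; exists (n0 * q) => n /leP Hn; apply: HP.
by apply/leP; rewrite leq_divRL.
Qed.

Lemma cser_shift (k : nat) (u : nat -> C) s : (forall i, i < k -> u i = RtoC 0%R) ->
  (cser u s <-> cser (fun i => u (k + i)) s).
Proof.
elim: k u => [|k IH] u H; first by [].
have H0 : u 0 = RtoC 0%R by apply: H.
have E1 : cser u s <-> cser (fun i => u i.+1) s.
  split=> Hs.
    apply: (@is_series_incr_1 C_AbsRing C_NormedModule u s).
    rewrite H0; have -> : plus s (RtoC 0%R) = s by exact: (@plus_zero_r C_AbelianMonoid).
    exact: Hs.
  apply: (@is_series_decr_1 C_AbsRing C_NormedModule u s).
  rewrite H0; have -> : plus s (opp (RtoC 0%R)) = s.
    change (s + - RtoC 0%R = s)%C; ring.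
  exact: Hs.
rewrite E1; apply: (IH (fun i => u i.+1)) => i ik; exact: H.
Qed.

(** A series indexed by all integers and zero below [- M]; [zs] hides [M]. The start can be lowered
    freely, so series with different starts can be added and re-indexed. *)
Definition zser (M : Z) (u : Z -> C) (s : C) : Prop :=
  (forall j, (j < - M)%Z -> u j = RtoC 0%R) /\ cser (fun i => u (Z.of_nat i - M)%Z) s.
Definition zs (u : Z -> C) (s : C) : Prop := exists M, zser M u s.

Lemma zser_shift M M' u s : (M <= M')%Z -> (forall j, (j < - M)%Z -> u j = RtoC 0%R) ->
  (zser M u s <-> zser M' u s).
Proof.
move=> MM Hz.
have E := @cser_shift (Z.to_nat (M' - M)) (fun i => u (Z.of_nat i - M')%Z) s.
have Hk : forall i, i < Z.to_nat (M' - M) -> u (Z.of_nat i - M')%Z = RtoC 0%R by move=> i ik; apply: Hz; lia.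
move/(_ Hk): E => E.
split=> - [_ Hs]; split=> //.
- move=> j Hj; apply: Hz; lia.
- apply/E; apply: cser_ext Hs => i; congr u; lia.
- move/E: Hs; apply: cser_ext => i; congr u; lia.
Qed.

Lemma zs_zser M u s : (forall j, (j < - M)%Z -> u j = RtoC 0%R) -> zs u s -> zser M u s.
Proof.
move=> Hz [M' [Hz' Hs]].
have H1 : zser (Z.max M M') u s by apply/(@zser_shift M') => //; lia.
by apply/(@zser_shift M (Z.max M M')) => //; lia.
Qed.

Lemma zs_ext u v s : (forall j, u j = v j) -> zs u s -> zs v s.
Proof.
move=> H [M [Hz Hs]]; exists M; split; first by move=> j Hj; rewrite -H Hz.
by apply: cser_ext Hs => i; rewrite H.
Qed.

Lemma zs_scal c u s : zs u s -> zs (fun j => c * u j)%C (c * s)%C.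
Proof.
move=> [M [Hz Hs]]; exists M; split; first by move=> j Hj; rewrite Hz // Cmult_0_r.
exact: cser_scal Hs.
Qed.

Lemma zs_zero : zs (fun _ => RtoC 0%R) (RtoC 0%R).
Proof.
exists 0%Z; split=> //; exact: cser_zero.
Qed.

Lemma zs_plus u v s t : zs u s -> zs v t -> zs (fun j => u j + v j)%C (s + t)%C.
Proof.
move=> [M [Hz Hs]] [M' [Hz' Ht]].
have [H1 H2] : zser (Z.max M M') u s by apply/(@zser_shift M) => //; lia.
have [H3 H4] : zser (Z.max M M') v t by apply/(@zser_shift M') => //; lia.
exists (Z.max M M'); split; last exact: cser_plus.
by move=> j Hj; rewrite H1 // H3 // Cplus_0_r.
Qed.

Lemma zs_unique u s t : zs u s -> zs u t -> s = t.
Proof.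
move=> [M [Hz Hs]] Ht; have [_ Ht'] := zs_zser Hz Ht; exact: cser_unique Hs Ht'.
Qed.

Lemma zs_sumC (I : seq nat) (u : nat -> Z -> C) (S : nat -> C) :
  (forall i, i \in I -> zs (u i) (S i)) -> zs (fun j => sumC I (fun i => u i j)) (sumC I S).
Proof.
elim: I => [|i I IH] H; first exact: zs_zero.
apply: zs_plus; first by apply: H; rewrite mem_head.
by apply: IH => k kI; apply: H; rewrite inE kI orbT.
Qed.

Lemma nat_dvd_Z (q i : nat) (j : Z) : Z.of_nat i = (Z.of_nat q * j)%Z -> q %| i.
Proof.
move=> E; apply/dvdnP; exists (Z.abs_nat j).
by have := Zabs2Nat.id_abs j; nia.
Qed.

(** With its converse [zs_AP2] this changes the lattice of exponents: a series supported on a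
    progression is the series along that progression. *)
Lemma zs_AP1 (q : nat) (c0 : Z) u s : 0 < q ->
  (forall i, (forall j, i <> Z.of_nat q * j + c0)%Z -> u i = RtoC 0%R) ->
  zs u s -> zs (fun j => u (Z.of_nat q * j + c0)%Z) s.
Proof.
move=> q0 H [M [Hz Hs]].
(* The summation has to start at a point of the progression that is not above [- M], namely
   [c0 - q M']. *)
set M' := (Z.abs M + Z.abs c0)%Z.
have B : (M <= Z.of_nat q * M' - c0)%Z by rewrite /M'; nia.
have [_ H2] : zser (Z.of_nat q * M' - c0) u s by apply/(@zser_shift M).
exists M'; split; first by move=> j Hj; apply: Hz; nia.
have := cser_stretch1 q0 _ H2.
have Hsup : forall i, ~~ (q %| i) -> u (Z.of_nat i - (Z.of_nat q * M' - c0))%Z = RtoC 0%R.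
  move=> i /negP nD; apply: H => j E; apply: nD; apply: (@nat_dvd_Z q i (j + M')); lia.
move/(_ Hsup); apply: cser_ext => j; congr u; rewrite Nat2Z.inj_mul; ring.
Qed.

Lemma zs_AP2 (q : nat) (c0 : Z) u s : 0 < q ->
  (forall i, (forall j, i <> Z.of_nat q * j + c0)%Z -> u i = RtoC 0%R) ->
  zs (fun j => u (Z.of_nat q * j + c0)%Z) s -> zs u s.
Proof.
move=> q0 H [M [Hz Hs]].
exists (Z.of_nat q * M - c0)%Z; split.
  move=> i Hi; case: (excluded_middle_informative (exists j, i = (Z.of_nat q * j + c0)%Z)) => [[j Ej]|ne].
    by rewrite Ej; apply: Hz; nia.
  by apply: H => j Ej; apply: ne; exists j.
apply: (@cser_stretch2 q) => //.
  move=> i /negP nD; apply: H => j E; apply: nD; apply: (@nat_dvd_Z q i (j + M)); lia.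
apply: cser_ext Hs => j; congr u; rewrite Nat2Z.inj_mul; ring.
Qed.

Lemma bounded_prefix (f : nat -> R) n0 : exists B : R, (0 <= B)%R /\ forall i, (i <= n0)%coq_nat -> (f i <= B)%R.
Proof.
elim: n0 => [|n [B [B0 HB]]].
  exists (Rmax 0 (f 0)); split; first exact: Rmax_l.
  by move=> i Hi; rewrite (_ : i = 0); [exact: Rmax_r|lia].
exists (Rmax B (f n.+1)); split; first by apply: Rle_trans B0 (Rmax_l _ _).
move=> i Hi; case: (Nat.eq_dec i n.+1) => [->|ne]; first exact: Rmax_r.
by apply: Rle_trans (Rmax_l _ _); apply: HB; lia.
Qed.

Lemma cser_bounded u s : cser u s -> exists B : R, (0 <= B)%R /\ forall i, (Cmod (u i) <= B)%R.
Proof.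
move=> Hs; have [n0 Hn] := cser_cv Hs Rlt_0_1.
have [B [B0 HB]] := bounded_prefix (fun i => Cmod (u i)) n0.
exists (Rmax B 2); split; first by apply: Rle_trans B0 (Rmax_l _ _).
move=> i; case: (Compare_dec.le_lt_dec i n0) => L.
  by apply: Rle_trans (Rmax_l _ _); apply: HB.
apply: Rle_trans (Rmax_r _ _).
case: i L => [|i] L; first lia.
have E : u i.+1 = ((sum_n u i.+1 - s) + - (sum_n u i - s))%C.
  rewrite sum_Sn; change (u i.+1 = ((sum_n u i + u i.+1 - s) + - (sum_n u i - s))%C); ring.
rewrite E; apply: Rle_trans (Cmod_triangle _ _) _; rewrite Cmod_opp.
have := Hn i.+1 ltac:(lia); have := Hn i ltac:(lia); lra.
Qed.

(** Convergence at [w0] bounds the terms by [B], so at [w = q w0] with [q <= 1/2] the sum is within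
    [2 B q] of [a 0]. For small [q] this is at most half of [|a 0|], impossible for a sum 0 unless
    [a 0 = 0]. *)
Lemma pow_coef0 (a : nat -> C) (w0 : R) s0 : (0 < w0)%R -> cser (fun i => a i * RtoC (w0 ^ i)%R)%C s0 ->
  (forall eta : R, (0 < eta)%R -> exists w : R, (0 < w < eta)%R /\ cser (fun i => a i * RtoC (w ^ i)%R)%C (RtoC 0%R)) ->
  a 0%N = RtoC 0%R.
Proof.
move=> w0p Hs0 Hw.
have [B [B0 HB]] := cser_bounded Hs0.
case: (Req_dec (Cmod (a 0%N)) 0%R) => [|ne]; first exact: Cmod_eq_0.
have a0p : (0 < Cmod (a 0%N))%R by have := Cmod_ge_0 (a 0%N); lra.
exfalso.
set q0 := Rmin (1 / 2) (Cmod (a 0%N) / (4 * (B + 1)))%R.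
have q0p : (0 < q0)%R.
  by apply: Rmin_glb_lt; [lra|apply: Rdiv_lt_0_compat; lra].
have [w [[wp wl] Hs]] := Hw (w0 * q0)%R (Rmult_lt_0_compat _ _ w0p q0p).
set q := (w / w0)%R.
have Ew : w = (w0 * q)%R by rewrite /q; field; lra.
have qp : (0 < q)%R by apply: Rdiv_lt_0_compat.
have ql : (q < q0)%R.
  by apply: (Rmult_lt_reg_l w0) => //; rewrite -Ew.
have q2 : (q <= 1 / 2)%R by have := Rmin_l (1 / 2) (Cmod (a 0%N) / (4 * (B + 1)))%R; rewrite -/q0; lra.
have qB : (4 * (B + 1) * q <= Cmod (a 0%N))%R.
  have := Rmin_r (1 / 2) (Cmod (a 0%N) / (4 * (B + 1)))%R; rewrite -/q0 => H.
  have : (4 * (B + 1) * q <= 4 * (B + 1) * (Cmod (a 0%N) / (4 * (B + 1))))%R by apply: Rmult_le_compat_l; lra.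
  by have -> : (4 * (B + 1) * (Cmod (a 0%N) / (4 * (B + 1))) = Cmod (a 0%N))%R by field; lra.
have term i : (Cmod (a i * RtoC (w ^ i)%R)%C <= B * q ^ i)%R.
  have -> : (a i * RtoC (w ^ i)%R = (a i * RtoC (w0 ^ i)%R) * RtoC (q ^ i)%R)%C.
    by rewrite Ew Rpow_mult_distr RtoC_mult; ring.
  rewrite Cmod_mult Cmod_R (Rabs_pos_eq (q ^ i)); last by apply: pow_le; lra.
  by apply: Rmult_le_compat_r; [apply: pow_le; lra|exact: HB].
(* The factor [1 - (1/2)^m] is the partial geometric sum, kept so that the induction closes. *)
have part m : (Cmod (sum_n (fun i => a i * RtoC (w ^ i)%R)%C m - a 0%N)%C <= 2 * B * q * (1 - (1 / 2) ^ m))%R.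
  elim: m => [|m IH].
    rewrite sum_O /= Cmult_1_r (_ : (a 0%N - a 0%N = RtoC 0%R)%C); last by ring.
    by rewrite Cmod_0; lra.
  rewrite sum_Sn.
  have -> : (plus (sum_n (fun i => a i * RtoC (w ^ i)%R)%C m) (a m.+1 * RtoC (w ^ m.+1)%R)%C - a 0%N)%C
    = ((sum_n (fun i => a i * RtoC (w ^ i)%R)%C m - a 0%N) + a m.+1 * RtoC (w ^ m.+1)%R)%C.
    change ((sum_n (fun i => a i * RtoC (w ^ i)%R)%C m + a m.+1 * RtoC (w ^ m.+1)%R - a 0%N)%C = ((sum_n (fun i => a i * RtoC (w ^ i)%R)%C m - a 0%N) + a m.+1 * RtoC (w ^ m.+1)%R)%C); ring.
  apply: Rle_trans (Cmod_triangle _ _) _.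
  have T := term m.+1.
  have : (q ^ m.+1 <= q * (1 / 2) ^ m)%R.
    by rewrite -tech_pow_Rmult; apply: Rmult_le_compat_l; [lra|apply: pow_incr; lra].
  move=> Q; have : (B * q ^ m.+1 <= B * (q * (1 / 2) ^ m))%R by apply: Rmult_le_compat_l.
  rewrite -(tech_pow_Rmult (1 / 2) m); lra.
have [n0 Hn] := @cser_cv _ _ Hs (Cmod (a 0%N) / 4)%R ltac:(lra).
have H1 := Hn n0 (le_n _); have H2 := part n0.
have hp : (0 < (1 / 2) ^ n0)%R by apply: pow_lt; lra.
have H3 : (2 * B * q * (1 - (1 / 2) ^ n0) <= 2 * B * q * 1)%R.
  by apply: Rmult_le_compat_l; [apply: Rmult_le_pos; lra|lra].
have H4 : (Cmod (a 0%N) <= Cmod (sum_n (fun i => a i * RtoC (w ^ i)%R)%C n0 - RtoC 0%R)%C + Cmod (sum_n (fun i => a i * RtoC (w ^ i)%R)%C n0 - a 0%N)%C)%R.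
  rewrite -(Cmod_opp (sum_n _ _ - a 0%N)%C); apply: Rle_trans (Cmod_triangle _ _); apply: Req_le; congr Cmod; ring.
nra.
Qed.

Lemma pow_coef (a : nat -> C) (w0 : R) s0 : (0 < w0)%R -> cser (fun i => a i * RtoC (w0 ^ i)%R)%C s0 ->
  (forall eta : R, (0 < eta)%R -> exists w : R, (0 < w < eta)%R /\ cser (fun i => a i * RtoC (w ^ i)%R)%C (RtoC 0%R)) ->
  forall n, a n = RtoC 0%R.
Proof.
move=> w0p Hs0 Hw; elim/ltn_ind => n IH.
have sc (w : R) s : (0 < w)%R -> cser (fun i => a i * RtoC (w ^ i)%R)%C s ->
    cser (fun i => a (n + i)%N * RtoC (w ^ i)%R)%C (RtoC (/ w ^ n)%R * s)%C.
  move=> wp Hs; have wn : (w ^ n <> 0)%R by apply: pow_nonzero; lra.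
  have := proj1 (@cser_shift n (fun i => a i * RtoC (w ^ i)%R)%C s _) Hs.
  have Hk : forall i, i < n -> (a i * RtoC (w ^ i)%R)%C = RtoC 0%R by move=> i ik; rewrite IH // Cmult_0_l.
  move=> /(_ Hk) /(@cser_scal (RtoC (/ w ^ n)%R)).
  apply: cser_ext => i; rewrite pow_add RtoC_mult.
  have E : (RtoC (/ w ^ n)%R * RtoC (w ^ n)%R = RtoC 1%R)%C by rewrite -RtoC_mult Rinv_l.
  rewrite -[RHS]Cmult_1_l -E; ring.
rewrite -(addn0 n); apply: (@pow_coef0 (fun i => a (n + i)) w0 _ w0p (sc _ _ w0p Hs0)).
move=> eta ep; have [w [wb Hs]] := Hw eta ep; exists w; split=> //.
have := sc w _ (proj1 wb) Hs; by rewrite Cmult_0_r.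
Qed.

Lemma e_it (rho t : R) : e (RtoC rho * (0%R, t))%C = RtoC (exp (- (2 * PI * rho * t))).
Proof.
rewrite /e (_ : (RtoC (2 * PI) * Ci * (RtoC rho * (0%R, t)))%C = RtoC (- (2 * PI * rho * t))%R); last first.
  by rewrite /RtoC /Ci /Cmult /=; f_equal; ring.
by rewrite /cexp /RtoC /= cos_0 sin_0; f_equal; ring.
Qed.

(** On the imaginary axis the series is, up to a positive factor, a power series in
    [exp (- 2 PI be t)]; large heights [t] are small arguments. *)
Lemma zcoef_unique (c : Z -> C) (M : Z) (al be t0 : R) s0 : (0 < be)%R ->
  (forall j, (j < - M)%Z -> c j = RtoC 0%R) ->
  cser (fun i => c (Z.of_nat i - M)%Z * e (RtoC (al + be * IZR (Z.of_nat i - M))%R * (0%R, t0)))%C s0 ->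
  (forall T : R, exists t : R, (T < t)%R /\
    cser (fun i => c (Z.of_nat i - M)%Z * e (RtoC (al + be * IZR (Z.of_nat i - M))%R * (0%R, t)))%C (RtoC 0%R)) ->
  forall j, c j = RtoC 0%R.
Proof.
move=> bp Hz H0 Ht.
have key (t : R) s : cser (fun i => c (Z.of_nat i - M)%Z * e (RtoC (al + be * IZR (Z.of_nat i - M))%R * (0%R, t)))%C s ->
   cser (fun i => c (Z.of_nat i - M)%Z * RtoC (exp (- (2 * PI * be * t)) ^ i)%R)%C (RtoC (exp (2 * PI * (al - be * IZR M) * t)) * s)%C.
  move/(@cser_scal (RtoC (exp (2 * PI * (al - be * IZR M) * t)))); apply: cser_ext => i.
  rewrite e_it Cmult_assoc (Cmult_comm (RtoC _)) -Cmult_assoc -RtoC_mult; congr (_ * RtoC _)%C.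
  rewrite -exp_plus -Rpower_pow ?/Rpower ?ln_exp; last exact: exp_pos.
  congr exp; rewrite minus_IZR -INR_IZR_INZ; ring.
have PP := PI_RGT_0.
have all0 : forall n, c (Z.of_nat n - M)%Z = RtoC 0%R.
  apply: (@pow_coef (fun i => c (Z.of_nat i - M)%Z) (exp (- (2 * PI * be * t0))) _ (exp_pos _) (key _ _ H0)).
  move=> eta ep; have [t [tl Hs]] := Ht (- ln eta / (2 * PI * be))%R.
  exists (exp (- (2 * PI * be * t))); split; last by have := key _ _ Hs; rewrite Cmult_0_r.
  split; first exact: exp_pos.
  rewrite -[X in (_ < X)%R](exp_ln eta ep); apply: exp_increasing.
  have bb : (0 < 2 * PI * be)%R by apply: Rmult_lt_0_compat; lra.
  have := Rmult_lt_compat_l _ _ _ bb tl.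
  have -> : (2 * PI * be * (- ln eta / (2 * PI * be)) = - ln eta)%R by field; lra.
  lra.
move=> j; case: (Z.lt_ge_cases j (- M)) => Hj; first exact: Hz.
have -> : j = (Z.of_nat (Z.to_nat (j + M)) - M)%Z by lia.
exact: all0.
Qed.

End LaurentSeries.

(** * Existence and uniqueness of q-expansions *)

Module QExpansions.

Require Import Defs.
Import DedekindSums GaussLemma KroneckerSymbol DedekindKronecker PsiIntegrality PsiKronecker PsiPairs CongruencesMod8 Moments PairCongruence HeckeMultipliers LaurentSeries.
From Stdlib Require Import Reals ZArith Lia Lra Zdiv ClassicalEpsilon FunctionalExtensionality.
From Coquelicot Require Import Coquelicot.
From mathcomp Require Import all_boot.
From mathcomp Require Import zify.
Delimit Scope R_scope with R.
Set Implicit Arguments. Unset Strict Implicit. Unset Printing Implicit Defensive.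
Local Open Scope nat_scope.
Local Arguments Z.mul : simpl never.
Local Arguments Z.add : simpl never.
Local Arguments Z.sub : simpl never.
Local Arguments Z.of_nat : simpl never.

Lemma e_neq0 z : e z <> RtoC 0%R.
Proof.
move=> E; have := e_add z (- z)%C; rewrite E Cmult_0_l (_ : (z + - z = RtoC 0%R)%C); last by ring.
by rewrite -[e _]/(eR 0) eR_0 => /RtoC_inj; lra.
Qed.

(** The vanishing of the sine gives only a half-integer; the odd halves are excluded because there
    the value is -1. *)
Lemma eR_eq1 w : eR w = RtoC 1%R -> exists n, w = IZR n.
Proof.
move=> E; have := E; rewrite eRE => - [_ /sin_eq_0_0 [k Hk]].
have PP := PI_RGT_0.
have Ew : w = (IZR k / 2)%R.
  by apply: (Rmult_eq_reg_l (2 * PI)); [rewrite Hk; field|lra].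
have [j [Ej|Ej]] : exists j, (k = 2 * j \/ k = 2 * j - 1)%Z by exists ((k + 1) / 2)%Z; mlia.
  by exists j; rewrite Ew Ej mult_IZR; field.
exfalso; move: E; rewrite Ew Ej (_ : (IZR (2 * j - 1) / 2 = IZR j + - (1 / 2))%R).
  by rewrite eR_add eR_int eR_half Cmult_1_l => /RtoC_inj; lra.
by rewrite minus_IZR mult_IZR; field.
Qed.

Lemma e_frac (rho a b d : R) tau : (d <> 0)%R ->
  e (RtoC rho * ((RtoC a * tau + RtoC b) / RtoC d))%C = (e (RtoC (rho * a / d)%R * tau) * eR (rho * b / d)%R)%C.
Proof.
move=> d0; rewrite /eR -e_add; congr e.
rewrite /Rdiv !RtoC_mult RtoC_inv // /Cdiv; ring.
Qed.

Lemma qexp_zs N r g c Y : qexp N r g c Y -> forall tau, (Y < Im tau)%R ->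
  zs (fun j => c j * e (RtoC (IZR (xN N r) / 24 + IZR j)%R * tau))%C (g tau).
Proof.
move=> [M [Hz Hs]] tau Ht; exists M; split; first by move=> j Hj; rewrite Hz // Cmult_0_l.
exact: Hs.
Qed.

(** [qexp] wants one starting index for all [tau]. It is read off at a single point: the exponential
    has no zero, so vanishing terms there mean vanishing coefficients. *)
Lemma zs_qexp N r g c Y : (forall tau, (Y < Im tau)%R ->
  zs (fun j => c j * e (RtoC (IZR (xN N r) / 24 + IZR j)%R * tau))%C (g tau)) -> qexp N r g c Y.
Proof.
move=> H.
have [M [Hz _]] := H (0%R, (Y + 1)%R) ltac:(simpl; lra).
have Hz' : forall j, (j < - M)%Z -> c j = RtoC 0%R.
  move=> j Hj; have := Hz j Hj => E.
  case: (excluded_middle_informative (c j = RtoC 0%R)) => // ne.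
  by exfalso; apply: (Cmult_neq_0 _ _ ne (@e_neq0 _)) E.
exists M; split=> // tau Ht.
have [] // := @zs_zser M _ _ _ (H tau Ht).
by move=> j Hj; rewrite Hz' // Cmult_0_l.
Qed.

Lemma qexp_unique N r g (c c' : Z -> C) (Y Y' : R) : qexp N r g c Y -> qexp N r g c' Y' -> c = c'.
Proof.
move=> H H'.
have Hd t : (Rmax Y Y' < t)%R -> zs (fun j => (c j - c' j) * e (RtoC (IZR (xN N r) / 24 + 1 * IZR j)%R * (0%R, t)))%C (RtoC 0%R).
  move=> Ht.
  have h1 : (Y < Im (0%R, t))%R by apply: Rle_lt_trans Ht; exact: Rmax_l.
  have h2 : (Y' < Im (0%R, t))%R by apply: Rle_lt_trans Ht; exact: Rmax_r.
  have := zs_plus (qexp_zs H h1) (@zs_scal (- RtoC 1%R)%C _ _ (qexp_zs H' h2)).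
  rewrite (_ : (g (0%R, t) + - RtoC 1%R * g (0%R, t))%C = RtoC 0%R); last by ring.
  by apply: zs_ext => j; rewrite Rmult_1_l; ring.
case: H H' => [M [Hz _]] [M' [Hz' _]].
have Hzz : forall j, (j < - Z.max M M')%Z -> (c j - c' j)%C = RtoC 0%R.
  by move=> j Hj; rewrite Hz ?Hz'; try lia; ring.
have cs t (Ht : (Rmax Y Y' < t)%R) := proj2 (@zs_zser (Z.max M M') _ _ (fun j Hj => eq_trans (f_equal (fun u => (u * _)%C) (Hzz j Hj)) (Cmult_0_l _)) (Hd t Ht)).
apply: functional_extensionality => j.
have : (c j - c' j)%C = RtoC 0%R.
  apply: (@zcoef_unique (fun j => c j - c' j)%C (Z.max M M') (IZR (xN N r) / 24)%R 1%R (Rmax Y Y' + 1)%R (RtoC 0%R)) => //; first lra.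
    by apply: cs; lra.
  move=> T; exists (Rmax (Rmax Y Y') T + 1)%R; split.
    by have := Rmax_r (Rmax Y Y') T; lra.
  by apply: cs; have := Rmax_l (Rmax Y Y') T; lra.
move=> E; have -> : c j = ((c j - c' j) + c' j)%C by ring.
by rewrite E Cplus_0_l.
Qed.

Lemma Csqrt1 : Csqrt (RtoC 1%R) = RtoC 1%R.
Proof.
rewrite /Csqrt; destruct (Rlt_dec (Im (RtoC 1%R)) 0) as [H|H]; first by exfalso; move: H => /=; lra.
rewrite Cmod_R Rabs_R1 /=.
have -> : ((1 + 1) / 2 = 1)%R by field.
have -> : ((1 - 1) / 2 = 0)%R by field.
by rewrite sqrt_1 sqrt_0 Rmult_0_r.
Qed.

Lemma slash_T K b f tau : slash K 1 b 0 1 1 f tau = f (tau + RtoC (IZR b))%C.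
Proof.
rewrite /slash /mob (_ : (RtoC 0 * tau + RtoC 1 = RtoC 1)%C); last by ring.
rewrite Csqrt1 (_ : (RtoC 1 * RtoC 1 = RtoC 1)%C); last by ring.
rewrite Cpowz1 Cmult_1_l; congr f.
rewrite /Cdiv (_ : (/ RtoC 1 = RtoC 1)%C); first by ring.
by rewrite -RtoC_inv ?Rinv_1 //; lra.
Qed.

Lemma chi_T N r : chi N r 1 1 0 1 1 = eR (IZR (xN N r) / 24)%R.
Proof.
rewrite /chi Cpowz1 Cmult_1_l; congr eR.
rewrite /xN /sumR /sumZ Rmult_comm /Rdiv; congr (_ * _)%R.
elim: (divisors N) => [//|n s IH] /=.
rewrite IH plus_IZR mult_IZR /Psi; congr (_ + _)%R.
by rewrite Zdiv_0_l /= Z.mul_1_l Rmult_comm.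
Qed.

Lemma zmod24a j : ((24 * j + 0) mod 24 = 0)%Z.
Proof. by rewrite Z.add_0_r Z.mul_comm Z_mod_mult. Qed.

Lemma zdiv24a j : ((24 * j + 0) / 24 = j)%Z.
Proof. by rewrite Z.add_0_r Z.mul_comm Z_div_mult. Qed.

Lemma zdiv24b i : (i mod 24 = 0 -> i = 24 * (i / 24) + 0)%Z.
Proof. by move=> E; have := Z.div_mod i 24 ltac:(lia); lia. Qed.

Lemma ex_nat_Z (z : Z) : (0 < z)%Z -> exists q : nat, Z.of_nat q = z /\ 0 < q.
Proof. by move=> z0; exists (Z.to_nat z); lia. Qed.

(** The lattices (1/h)Z and x_N/24 + Z are compared inside (1/(24 h))Z: the index is first spread
    out by the factor 24, then restricted to the progression [24 h m + h x]. *)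
Lemma qexp_of_hseries N r f (h : nat) (c : Z -> C) (M : Z) (Y : R) : 0 < h ->
  (forall j, (j < - M)%Z -> c j = RtoC 0%R) ->
  (forall tau, (Y < Im tau)%R -> cser (fun i => c (Z.of_nat i - M)%Z * e (RtoC (IZR (Z.of_nat i - M) / INR h)%R * tau))%C (f tau)) ->
  (forall j, c j <> RtoC 0%R -> exists m, (24 * j = Z.of_nat h * xN N r + 24 * Z.of_nat h * m)%Z) ->
  exists cf, qexp N r f cf Y.
Proof.
move=> h0 Hz Hs; set x := xN N r => sup.
have hR : (0 < INR h)%R by apply: lt_0_INR; apply/leP.
set J := fun m : Z => (24 * Z.of_nat h * m + Z.of_nat h * x)%Z.
exists (fun m => if (J m mod 24 =? 0)%Z then c (J m / 24)%Z else RtoC 0%R).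
apply: zs_qexp => tau Ht.
set u' := fun j : Z => if (j mod 24 =? 0)%Z then (c (j / 24)%Z * e (RtoC (IZR (j / 24) / INR h)%R * tau))%C else RtoC 0%R.
have Z1 : zs u' (f tau).
  have [q [Eq q0]] := @ex_nat_Z 24 ltac:(lia).
  apply: (@zs_AP2 q 0%Z _ _ q0); rewrite Eq.
    move=> i Hi; rewrite /u'; case: Z.eqb_spec => E; last by [].
    by exfalso; apply: (Hi (i / 24)%Z); exact: zdiv24b.
  apply: (@zs_ext (fun j => c j * e (RtoC (IZR j / INR h)%R * tau))%C).
    by move=> j; rewrite /u' zmod24a zdiv24a.
  exists M; split; last exact: Hs.
  by move=> j Hj; rewrite Hz // Cmult_0_l.
have [q [Eq q0]] := @ex_nat_Z (24 * Z.of_nat h) ltac:(lia).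
have := @zs_AP1 q (Z.of_nat h * x)%Z u' (f tau) q0; rewrite Eq => H.
apply: (@zs_ext (fun j => u' (J j))); last first.
  apply: H Z1 => i Hi; rewrite /u'; case: Z.eqb_spec => E; last by [].
  case: (excluded_middle_informative (c (i / 24)%Z = RtoC 0%R)) => [->|/sup [m Em]]; first by rewrite Cmult_0_l.
  exfalso; apply: (Hi m); rewrite {1}(zdiv24b E) Em; ring.
move=> m; rewrite /u'; case: Z.eqb_spec => E; last by rewrite Cmult_0_l.
have E2 := f_equal IZR (zdiv24b E); move: E2.
have -> : IZR (J m) = (24 * INR h * IZR m + INR h * IZR x)%R by rewrite /J !(plus_IZR, mult_IZR) -!INR_IZR_INZ.
rewrite plus_IZR mult_IZR Rplus_0_r => E'.
have -> : (IZR (J m / 24) / INR h = IZR x / 24 + IZR m)%R; last by [].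
apply: (Rmult_eq_reg_l (24 * INR h)); last by apply: Rmult_integral_contrapositive; split; lra.
rewrite (_ : 24 * INR h * (IZR (J m / 24) / INR h) = 24 * IZR (J m / 24))%R; last by field; lra.
by rewrite -E'; field.
Qed.

(** f(tau + 1) - e(x_N/24) f(tau) has the coefficients [c_j (e(j/h) - e(x_N/24))]. It vanishes at
    points of arbitrarily large height, so [c_j = 0] unless j/h lies in x_N/24 + Z. *)
Lemma f_qexp_exists N r K f : merom_modform N r K f -> exists Y cf, qexp N r f cf Y.
Proof.
move=> [P [[[PH Pd] _] [Htr Hc]]].
have [h [c [M [Y [h0 [Hz Hs]]]]]] := Hc 1%Z 0%Z 0%Z 1%Z (erefl 1%Z).
have hR : (0 < INR h)%R by apply: lt_0_INR; apply/leP.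
have {}Hs tau : (Y < Im tau)%R -> cser (fun i => c (Z.of_nat i - M)%Z * e (RtoC (IZR (Z.of_nat i - M) / INR h)%R * tau))%C (f tau).
  move=> Ht; have := Hs tau Ht; rewrite slash_T (_ : (tau + RtoC 0 = tau)%C) //; ring.
set x := xN N r.
set c' := fun j => (c j * (eR (IZR j / INR h)%R - eR (IZR x / 24)%R))%C.
have cs t : (Y < t)%R -> cser (fun i => c' (Z.of_nat i - M)%Z * e (RtoC (0 + / INR h * IZR (Z.of_nat i - M))%R * (0%R, t)))%C (f (1%R, t) + - eR (IZR x / 24)%R * f (0%R, t))%C.
  move=> Ht.
  have := cser_plus (Hs (1%R, t) Ht) (@cser_scal (- eR (IZR x / 24)%R)%C _ _ (Hs (0%R, t) Ht)).
  apply: cser_ext => i; set j := (Z.of_nat i - M)%Z.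
  have -> : (RtoC (IZR j / INR h)%R * (1%R, t))%C = (RtoC (IZR j / INR h)%R * (0%R, t) + RtoC (IZR j / INR h)%R)%C.
    by rewrite /RtoC /Cmult /Cplus /=; f_equal; ring.
  rewrite e_add -/(eR _) (_ : (0 + / INR h * IZR j = IZR j / INR h)%R); last by rewrite /Rdiv; ring.
  by rewrite /c'; ring.
have c'0 : forall j, c' j = RtoC 0%R.
  apply: (@zcoef_unique c' M 0%R (/ INR h)%R (Y + 1)%R _ (Rinv_0_lt_compat _ hR) _ (cs (Y + 1)%R ltac:(lra))).
    by move=> j Hj; rewrite /c' Hz // Cmult_0_l.
  move=> T; set T' := (Rmax (Rmax Y T) 0 + 1)%R.
  have T1 : (0 < T')%R by rewrite /T'; have := Rmax_r (Rmax Y T) 0; lra.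
  have T2 : (Y < T')%R by rewrite /T'; have := Rmax_l (Rmax Y T) 0; have := Rmax_l Y T; lra.
  have T3 : (T < T')%R by rewrite /T'; have := Rmax_l (Rmax Y T) 0; have := Rmax_r Y T; lra.
  (* The transformation law holds only off the poles. Discreteness at the two points of height [T']
     over 0 and 1 allows a small upward move after which neither point is a pole. *)
  have [e1 [e1p H1]] := Pd (0%R, T') T1; have [e2 [e2p H2]] := Pd (1%R, T') T1.
  set dl := (Rmin e1 e2 / 2)%R.
  have mp : (0 < Rmin e1 e2)%R by apply: Rmin_glb_lt.
  have dp : (0 < dl)%R by rewrite /dl; lra.
  have d1 : (dl < e1)%R by rewrite /dl; have := Rmin_l e1 e2; lra.
  have d2 : (dl < e2)%R by rewrite /dl; have := Rmin_r e1 e2; lra.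
  have off (u : R) ee : (dl < ee)%R -> (forall p, P p -> p <> (u, T') -> (ee <= Cmod (p - (u, T'))%C)%R) -> ~ P (u, (T' + dl)%R).
    move=> dee H Pp; have := H _ Pp; rewrite (_ : ((u, T' + dl)%R - (u, T'))%C = (0%R, dl)).
      have -> : Cmod (0%R, dl) = dl.
        by rewrite /Cmod /= (_ : (0 * (0 * 1) + dl * (dl * 1) = dl * dl)%R) ?sqrt_square //; [lra|ring].
      move=> HH; suff : (ee <= dl)%R by lra.
      by apply: HH => - []; lra.
    by rewrite /Cminus /Copp /Cplus /=; f_equal; ring.
  exists (T' + dl)%R; split; first lra.
  have Ht : (Y < T' + dl)%R by lra.
  have E1 : ((0%R, (T' + dl)%R) + RtoC 1)%C = (1%R, (T' + dl)%R).
    by rewrite /RtoC /Cplus /=; f_equal; ring.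
  have Emob : mob 1 1 0 1 (0%R, (T' + dl)%R) = (1%R, (T' + dl)%R).
    rewrite -E1 /mob (_ : (RtoC 0 * (0%R, (T' + dl)%R) + RtoC 1 = RtoC 1)%C); last by ring.
    rewrite /Cdiv (_ : (/ RtoC 1 = RtoC 1)%C); first by ring.
    by rewrite -RtoC_inv ?Rinv_1 //; lra.
  have G1 : Gamma0 N 1 1 0 1 by split; [by []|exact: Z.divide_0_r].
  have inh : inH (0%R, (T' + dl)%R) by rewrite /inH /=; lra.
  have Pm : ~ P (mob 1 1 0 1 (0%R, (T' + dl)%R)) by rewrite Emob; exact: (off 1%R e2 d2 H2).
  have := Htr 1%Z 1%Z 0%Z 1%Z 1%Z G1 (or_introl erefl) _ inh (off 0%R e1 d1 H1) Pm.
  rewrite slash_T chi_T E1 -/x => Ef.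
  have := cs _ Ht; rewrite Ef (_ : (eR (IZR x / 24)%R * f (0%R, (T' + dl)%R) + - eR (IZR x / 24)%R * f (0%R, (T' + dl)%R))%C = RtoC 0%R) //.
  by ring.
have sup j : c j <> RtoC 0%R -> exists m, (24 * j = Z.of_nat h * x + 24 * Z.of_nat h * m)%Z.
  move=> ne; have E : (eR (IZR j / INR h)%R - eR (IZR x / 24)%R)%C = RtoC 0%R.
    case: (excluded_middle_informative ((eR (IZR j / INR h)%R - eR (IZR x / 24)%R)%C = RtoC 0%R)) => // ne'.
    by exfalso; apply: (Cmult_neq_0 _ _ ne ne'); exact: c'0.
  have E2 : eR (IZR j / INR h)%R = eR (IZR x / 24)%R.
    have -> : eR (IZR j / INR h)%R = ((eR (IZR j / INR h)%R - eR (IZR x / 24)%R) + eR (IZR x / 24)%R)%C by ring.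
    by rewrite E Cplus_0_l.
  have [n Hn] : exists n, (- (IZR x / 24) + IZR j / INR h)%R = IZR n.
    by apply: eR_eq1; rewrite eR_add E2 eR_oppM.
  exists n; apply: eq_IZR; rewrite !(plus_IZR, mult_IZR) -Hn -INR_IZR_INZ; field; lra.
have [cf Hcf] := qexp_of_hseries h0 Hz Hs sup.
by exists Y, cf.
Qed.

End QExpansions.

(** * The q-expansion of the Hecke image *)

Module HeckeExpansion.

Require Import Defs.
Import DedekindSums GaussLemma KroneckerSymbol DedekindKronecker PsiIntegrality PsiKronecker PsiPairs CongruencesMod8 Moments PairCongruence HeckeMultipliers LaurentSeries QExpansions.
From Stdlib Require Import Reals ZArith Lia Lra Zdiv ClassicalEpsilon FunctionalExtensionality.
From Coquelicot Require Import Coquelicot.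
From mathcomp Require Import all_boot.
From mathcomp Require Import zify.
Delimit Scope R_scope with R.
Set Implicit Arguments. Unset Strict Implicit. Unset Printing Implicit Defensive.
Local Open Scope nat_scope.
Local Arguments Z.mul : simpl never.
Local Arguments Z.add : simpl never.
Local Arguments Z.sub : simpl never.
Local Arguments Z.of_nat : simpl never.

Lemma sumC_ext (s : seq nat) F G : (forall n, n \in s -> F n = G n) -> sumC s F = sumC s G.
Proof.
rewrite /sumC; elim: s => [//|n s IH] H /=; rewrite H ?mem_head // IH // => m ms.
by apply: H; rewrite inE ms orbT.
Qed.

Lemma sumC_scal (s : seq nat) F c : sumC s (fun n => c * F n)%C = (c * sumC s F)%C.
Proof.
rewrite /sumC; elim: s => [|n s IH] /=; first by rewrite Cmult_0_r.
by rewrite IH; ring.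
Qed.

Lemma sumC_filter (p : pred nat) (s : seq nat) F :
  sumC [seq n <- s | p n] F = sumC s (fun n => if p n then F n else RtoC 0%R).
Proof.
rewrite /sumC; elim: s => [//|n s IH] /=; case: ifP => pn /=; rewrite IH ?Cplus_0_l //.
Qed.

Lemma sumC_iotaS n F : sumC (iota 0 n.+1) F = (sumC (iota 0 n) F + F n)%C.
Proof.
rewrite /sumC -addn1 iotaD foldr_cat /= add0n Cplus_0_r.
elim: (iota 0 n) => /= [|m s ->]; ring.
Qed.

Lemma sumC_shift n F : (F 0 + sumC (iota 0 n) (fun i => F i.+1))%C = (sumC (iota 0 n) F + F n)%C.
Proof.
elim: n => [|n IH]; first by rewrite /sumC /=; ring.
by rewrite !sumC_iotaS -IH; ring.
Qed.

(* The sum over a period is invariant under every shift, so it equals [w] times itself. *)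
Lemma periodic_sum0 (H : nat -> C) (d g : nat) (w : C) : (forall b, H (b + d) = H b) ->
  (forall b, H (b + g) = (w * H b)%C) -> w <> RtoC 1%R -> sumC (iota 0 d) H = RtoC 0%R.
Proof.
move=> Hd Hg w1.
have Hk k : sumC (iota 0 d) (fun b => H (b + k)) = sumC (iota 0 d) H.
  elim: k => [|k IH]; first by apply: sumC_ext => b _; rewrite addn0.
  rewrite -IH; have := sumC_shift d (fun b => H (b + k)).
  rewrite add0n (addnC d) Hd => E.
  have E2 : sumC (iota 0 d) (fun b => H (b.+1 + k)%N) = sumC (iota 0 d) (fun b => H (b + k)).
    have -> : sumC (iota 0 d) (fun b => H (b.+1 + k)%N) = ((H k + sumC (iota 0 d) (fun b => H (b.+1 + k)%N)) - H k)%C by ring.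
    by rewrite E; ring.
  by rewrite -E2; apply: sumC_ext => b _; rewrite addSnnS.
have := Hk g; rewrite (sumC_ext (G := fun b => (w * H b)%C)); last by move=> b _; exact: Hg.
rewrite sumC_scal => E.
case: (excluded_middle_informative (sumC (iota 0 d) H = RtoC 0%R)) => // ne; exfalso.
have w0 : (w - RtoC 1%R)%C <> RtoC 0%R.
  move=> E0; apply: w1.
  have -> : w = ((w - RtoC 1%R) + RtoC 1%R)%C by ring.
  by rewrite E0 Cplus_0_l.
apply: (Cmult_neq_0 _ _ w0 ne).
have -> : ((w - RtoC 1%R) * sumC (iota 0 d) H = w * sumC (iota 0 d) H - sumC (iota 0 d) H)%C by ring.
by rewrite E; ring.
Qed.

(** Modulo 8: for odd [d] the factor [d^2 - 1] is divisible, for even [d] the factor [a d - 1] is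
    odd and 8 divides [X]. The same alternative works modulo 3. *)
Lemma dvd24_sqr (a d X : Z) : (24 | (a * d - 1) * X)%Z -> (24 | (d * d - 1) * X)%Z.
Proof.
move=> [w Hw].
have [u U] : (8 | (d * d - 1) * X)%Z.
  case: (Z.eq_dec (d mod 2) 1) => od.
    by have [f F] := Zsqr8 od; exists (f * X)%Z; rewrite F; ring.
  have [d' Ed] : exists d', d = (2 * d')%Z by clear -od; exists (d / 2)%Z; mlia.
  have [q Q] : (8 | X)%Z.
    apply: (@odd_cancel8 (a * d - 1)); last by exists (3 * w)%Z; lia.
    rewrite Ed (_ : (a * (2 * d') - 1 = 2 * (a * d') - 1)%Z); last by ring.
    by move: (a * d')%Z => t; clear; mlia.
  by exists ((d * d - 1) * q)%Z; rewrite Q; ring.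
have [v V] : (3 | (d * d - 1) * X)%Z.
  case: (Z.eq_dec (d mod 3) 0) => d3.
    have [q Q] : (3 | X)%Z; last by exists ((d * d - 1) * q)%Z; rewrite Q; ring.
    exists (a * (d / 3) * X - 8 * w)%Z; have := Z.div_mod d 3 ltac:(lia); rewrite d3 => Ed.
    by rewrite {1}Ed in Hw; lia.
  have [q [Q|Q]] : exists q, (d = 3 * q + 1 \/ d = 3 * q + 2)%Z by clear -d3; exists (d / 3)%Z; mlia.
    by exists ((3 * q * q + 2 * q) * X)%Z; rewrite Q; ring.
  by exists ((3 * q * q + 4 * q + 1) * X)%Z; rewrite Q; ring.
by exists (3 * u - v)%Z; lia.
Qed.

Lemma eR_cong (u v : Z) : (24 | u - v)%Z -> eR (IZR u / 24) = eR (IZR v / 24).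
Proof.
move=> [w Hw]; have -> : u = (v + w * 24)%Z by lia.
rewrite plus_IZR mult_IZR (_ : ((IZR v + IZR w * 24) / 24 = IZR v / 24 + IZR w)%R); last by field.
by rewrite eR_add eR_int Cmult_1_r.
Qed.

(* Both index sets are arithmetic progressions once one solution of
   [(x + 24 m) p = (x + 24 m') s] is known. *)
Lemma zs_reindex (p s : nat) (x : Z) (U V : Z -> C) (S : C) : 0 < p -> 0 < s -> coprime p s ->
  (forall m m', ((x + 24 * m) * Z.of_nat p = (x + 24 * m') * Z.of_nat s)%Z -> V m' = U m) ->
  (forall m, (forall m', ((x + 24 * m) * Z.of_nat p <> (x + 24 * m') * Z.of_nat s)%Z) -> U m = RtoC 0%R) ->
  (forall m', (forall m, ((x + 24 * m) * Z.of_nat p <> (x + 24 * m') * Z.of_nat s)%Z) -> V m' = RtoC 0%R) ->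
  zs U S -> zs V S.
Proof.
move=> p0 s0 cps HUV HU HV ZU.
have [u [v Huv]] : exists u v, (Z.of_nat p * u + Z.of_nat s * v = 1)%Z.
  by apply: coprime_bezout; rewrite !Zabs2Nat.id.
case: (excluded_middle_informative (exists m m', ((x + 24 * m) * Z.of_nat p = (x + 24 * m') * Z.of_nat s)%Z)) => [[m0 [m0' E0]]|ne].
  apply: (@zs_AP2 p m0' _ _ p0).
    move=> i Hi; apply: HV => m E; apply: (Hi (u * (i - m0') + (m - m0) * v)%Z).
    have E1 : ((m - m0) * Z.of_nat p = (i - m0') * Z.of_nat s)%Z by lia.
    transitivity ((i - m0') * (Z.of_nat p * u + Z.of_nat s * v) + m0')%Z; first by rewrite Huv; ring.
    transitivity ((i - m0') * Z.of_nat p * u + (i - m0') * Z.of_nat s * v + m0')%Z; first by ring.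
    by rewrite -E1; ring.
  apply: (@zs_ext (fun k => U (Z.of_nat s * k + m0)%Z)).
    by move=> k; symmetry; apply: HUV; lia.
  apply: (@zs_AP1 s m0 _ _ s0) => // i Hi; apply: HU => m' E.
  apply: (Hi ((m' - m0') * u + (i - m0) * v)%Z).
  have E1 : ((i - m0) * Z.of_nat p = (m' - m0') * Z.of_nat s)%Z by lia.
  transitivity ((i - m0) * (Z.of_nat p * u + Z.of_nat s * v) + m0)%Z; first by rewrite Huv; ring.
  transitivity ((i - m0) * Z.of_nat p * u + (i - m0) * Z.of_nat s * v + m0)%Z; first by ring.
  by rewrite E1; ring.
have U0 m : RtoC 0%R = U m by symmetry; apply: HU => m' E; apply: ne; exists m, m'.
have V0 m : RtoC 0%R = V m by symmetry; apply: HV => m' E; apply: ne; exists m', m.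
rewrite (zs_unique ZU (zs_ext U0 zs_zero)); exact: zs_ext V0 zs_zero.
Qed.

Section HeckeA.
Variables (N : nat) (r : nat -> Z) (K : Z) (l a d g p s : nat).
Hypotheses (N0 : 0 < N) (HK : ((K - sumr N r) mod 4 = 0)%Z) (Hl : in_Lr N r l).
Hypotheses (al : a %| l) (caN : coprime a N) (Ed : d = l %/ a) (Eg : g = gcdn a d).
Hypotheses (Ea : a = p * g) (Es : d = s * g) (cps : coprime p s).
Local Notation x := (xN N r).
Local Notation rho m := (IZR (xN N r) / 24 + IZR m)%R.

Let l0 : 0 < l. Proof. by case: Hl. Qed.
Let a0 : 0 < a. Proof. exact: dvdn_gt0 l0 al. Qed.
Let d0 : 0 < d. Proof. by rewrite Ed divn_gt0 // dvdn_leq. Qed.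
Let El : l = a * d. Proof. by rewrite Ed mulnC divnK. Qed.
Let g0 : 0 < g. Proof. by rewrite Eg gcdn_gt0 a0. Qed.
Let p0 : 0 < p. Proof. by move: a0; rewrite Ea muln_gt0 => /andP[]. Qed.
Let s0 : 0 < s. Proof. by move: d0; rewrite Es muln_gt0 => /andP[]. Qed.
Let EZ : Z.of_nat l = (Z.of_nat a * Z.of_nat d)%Z. Proof. by rewrite El Nat2Z.inj_mul. Qed.
Let Za : Z.of_nat a = (Z.of_nat p * Z.of_nat g)%Z. Proof. by rewrite Ea Nat2Z.inj_mul. Qed.
Let Zd : Z.of_nat d = (Z.of_nat s * Z.of_nat g)%Z. Proof. by rewrite Es Nat2Z.inj_mul. Qed.
Let Rl : INR l = (INR a * INR d)%R. Proof. by rewrite El mult_INR. Qed.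
Let Rd : INR d = (INR s * INR g)%R. Proof. by rewrite Es mult_INR. Qed.
Let aR : INR a <> 0%R. Proof. by apply: not_0_INR; lia. Qed.
Let dR : INR d <> 0%R. Proof. by apply: not_0_INR; lia. Qed.
Let gR : INR g <> 0%R. Proof. by apply: not_0_INR; lia. Qed.
Let sR : INR s <> 0%R. Proof. by apply: not_0_INR; lia. Qed.
Let HX : (24 | (Z.of_nat a * Z.of_nat d - 1) * x)%Z.
Proof. by have [H _] := in_Lr_dvd Hl; rewrite -EZ. Qed.
Let HS : (24 | (Z.of_nat a * Z.of_nat d - 1) * moment N r (fun n => Z.of_nat (N %/ n)))%Z.
Proof. by have [_ H] := in_Lr_dvd Hl; rewrite -EZ. Qed.
Let K4 : (4 | K - sumr N r)%Z. Proof. by apply/Z.mod_divide. Qed.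

Definition hterm (b : nat) : C :=
  (RtoC (powerRZ (IZR (kron (- Z.of_nat N * Z.of_nat b) g)) K) *
   eR (- (INR b * INR d * IZR x / 24)) * psi N r K l a b)%C.

Lemma gcd_shift b : gcdn (gcdn a (b + g)) d = gcdn (gcdn a b) d.
Proof.
by rewrite (gcdnAC a (b + g)) (gcdnAC a b) -Eg gcdnDr.
Qed.

(** By [psi_b_dvd], shifting [b] changes the exponent of [psi] by an integer. *)
Lemma psi_shift b : psi N r K l a (b + g) = psi N r K l a b.
Proof.
rewrite !(psi_eR _ _ _ _ al) -Ed.
case: (boolP (odd (a * d))) => [ol|el].
  by have -> : psi_num N a (b + g) d r K (delta1Z N r K l a) = psi_num N a b d r K (delta1Z N r K l a) by rewrite /psi_num ol.
case: (boolP (odd N)) => [oN|eN].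
  by have -> : psi_num N a (b + g) d r K (delta1Z N r K l a) = psi_num N a b d r K (delta1Z N r K l a) by rewrite /psi_num (negPf el) oN.
have d1E : delta1Z N r K l a = (if [&& ~~ odd (a * d), 4 %| N, Z.odd K & odd (logn 2 (varpi N r))] then 1 else 0)%Z.
  by rewrite Ed; exact: erefl.
have [q Hq] := @psi_b_dvd N a 0 d r K 0%Z 0%Z 0%Z N0 a0 d0 HX HS K4 _ d1E eN el.
have F b' : psi_num N a b' d r K (delta1Z N r K l a) = (- (3 * (K + 2 * sbit (chi4 (varpi N r))) * (Z.of_nat a - 1)) - 3 * Z.of_nat N * (K + 2 * sbit (chi4 (varpi N r))) * (1 + delta1Z N r K l a) * Z.of_nat b')%Z.
  by rewrite /psi_num (negPf el) eN.
rewrite !F; apply: eR_cong; exists (- (q * Z.of_nat g))%Z; rewrite Nat2Z.inj_add.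
transitivity (-3 * Z.of_nat g * (Z.of_nat N * (K + 2 * sbit (chi4 (varpi N r))) * (1 + delta1Z N r K l a)))%Z; first by ring.
by rewrite Hq; ring.
Qed.

(** For odd [g] the symbol is periodic modulo [g]. Even [g] makes [l] even and [N] odd, which forces
    [K] to be even, and then the power of the sign is 1. *)
Lemma kron_shift b : gcdn (gcdn a b) d = 1 ->
  powerRZ (IZR (kron (- Z.of_nat N * Z.of_nat (b + g)) g)) K = powerRZ (IZR (kron (- Z.of_nat N * Z.of_nat b) g)) K.
Proof.
move=> c1; case: (boolP (odd g)) => og.
  congr (powerRZ (IZR _) K); apply: kron_mod => //; exists (- Z.of_nat N)%Z; rewrite Nat2Z.inj_add; ring.
have ea : ~~ odd a by apply: contra og; apply: dvdn_odd; rewrite Eg dvdn_gcdl.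
have oN : odd N.
  apply: contraT => eN; move: caN; rewrite /coprime => /eqP E.
  by have : 2 %| gcdn a N; [rewrite dvdn_gcd !dvdn2 ea eN|rewrite E].
have el : ~~ odd (a * d) by rewrite oddM negb_and ea.
have [w Hw] := @even_S8 N a 0 d r K 0%Z 0%Z 0%Z N0 a0 d0 HX HS K4 el.
have [_ [v Hv]] := rel_oddN r N0 oN; rewrite Hw in Hv.
have [k4 Hk4] := K4.
have [K' EK] : exists K', K = (2 * K')%Z.
  by exists (4 * w - sbit (chi4 (varpi N r)) - 2 * v + 2 * k4)%Z; lia.
have H u : pm u -> powerRZ (IZR u) K = 1%R.
  move=> pu; apply: RtoC_inj; rewrite -(eR_signK K pu) EK.
  rewrite (_ : (- (IZR (2 * K' * sbit u) / 2) = IZR (- (K' * sbit u)))%R) ?eR_int //.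
  by rewrite opp_IZR !mult_IZR; field.
have cop b' : gcdn (gcdn a b') d = 1 -> pm (kron (- Z.of_nat N * Z.of_nat b') g).
  move=> c; apply: pm_kron => //.
  have -> : Z.abs_nat (- Z.of_nat N * Z.of_nat b') = N * b'.
    by apply: Nat2Z.inj; rewrite Zabs2Nat.id_abs Z.abs_mul Z.abs_opp !Z.abs_eq ?Nat2Z.inj_mul //; lia.
  rewrite coprimeMl; apply/andP; split.
    by rewrite coprime_sym; apply: coprime_dvdl caN; rewrite Eg dvdn_gcdl.
  by rewrite /coprime Eg gcdnA (gcdnC b') c.
by rewrite !H //; apply: cop; rewrite ?gcd_shift.
Qed.

Lemma hterm_shift b : gcdn (gcdn a b) d = 1 ->
  hterm (b + g) = (eR (- (INR g * INR d * IZR x / 24)) * hterm b)%C.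
Proof.
move=> c1; rewrite /hterm psi_shift kron_shift // plus_INR.
rewrite (_ : (- ((INR b + INR g) * INR d * IZR x / 24) = - (INR b * INR d * IZR x / 24) + - (INR g * INR d * IZR x / 24))%R); last by field.
by rewrite eR_add; ring.
Qed.

(** Extension by 0 to the excluded [b]: the sum then runs over a full period, where shifts by [g]
    act. *)
Definition Hb (t : R) (b : nat) : C :=
  if gcdn (gcdn a b) d == 1 then (hterm b * eR (t * INR b / INR d))%C else RtoC 0%R.
Definition theta (t : R) : R := (t * INR g / INR d - INR g * INR d * IZR x / 24)%R.

Lemma Hb_shift t b : Hb t (b + g) = (eR (theta t) * Hb t b)%C.
Proof.
rewrite /Hb gcd_shift; case: eqP => c1; last by rewrite Cmult_0_r.
rewrite hterm_shift // plus_INR.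
rewrite (_ : (t * (INR b + INR g) / INR d = t * INR b / INR d + t * INR g / INR d)%R); last by field; exact: dR.
by rewrite /theta /Rminus !eR_add; ring.
Qed.

Lemma Hb_shiftk t b k : Hb t (b + k * g) = (eR (INR k * theta t) * Hb t b)%C.
Proof.
elim: k => [|k IH]; first by rewrite mul0n addn0 Rmult_0_l eR_0 Cmult_1_l.
by rewrite mulSnr addnA Hb_shift IH S_INR Rmult_plus_distr_r Rmult_1_l eR_add; ring.
Qed.

(** A shift by [d = s g] is [s] shifts by [g], and the total phase [s theta] is an integer because
    24 divides [(d^2 - 1) x_N]. *)
Lemma Hb_period m b : Hb (rho m) (b + d) = Hb (rho m) b.
Proof.
have [w Hw] := dvd24_sqr HX.
have Hw' : ((INR d * INR d - 1) * IZR x = IZR w * 24)%R.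
  by have := f_equal IZR Hw; rewrite !(mult_IZR, minus_IZR) -!INR_IZR_INZ.
have -> : b + d = b + s * g by rewrite -Es.
rewrite Hb_shiftk (_ : (INR s * theta (rho m) = IZR (m - w))%R) ?eR_int ?Cmult_1_l //.
transitivity (rho m * (INR s * INR g) / INR d - (INR s * INR g) * INR d * IZR x / 24)%R.
  by rewrite /theta; field; exact: dR.
rewrite -Rd; transitivity (rho m - INR d * INR d * IZR x / 24)%R; first by field; exact: dR.
by rewrite minus_IZR; lra.
Qed.

Lemma Hb_sum0 m : (forall m', ((x + 24 * m) * Z.of_nat a <> (x + 24 * m') * Z.of_nat d)%Z) ->
  sumC (iota 0 d) (Hb (rho m)) = RtoC 0%R.
Proof.
move=> H; apply: (@periodic_sum0 _ d g (eR (theta (rho m)))); [exact: Hb_period|exact: Hb_shift|].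
move=> /eR_eq1 [n Hn]; have [w Hw] := HX.
have E1 : (rho m = INR s * theta (rho m) + INR d * INR d * IZR x / 24)%R.
  by rewrite /theta Rd; field; split; [exact: gR|exact: sR].
rewrite Hn in E1.
have Ez : (x + 24 * m = 24 * Z.of_nat s * n + Z.of_nat d * Z.of_nat d * x)%Z.
  by apply: eq_IZR; rewrite !(plus_IZR, mult_IZR) -!INR_IZR_INZ; lra.
(* An integral phase [n] would put the exponent into the lattice: multiply
   [x + 24 m = 24 s n + d^2 x] by [a] and use [s a = p d] and [a d x = x + 24 w]. *)
apply: (H (w + n * Z.of_nat p)%Z); rewrite Ez.
have Hw' : (Z.of_nat a * Z.of_nat d * x = x + 24 * w)%Z by lia.
have Esa : (Z.of_nat s * Z.of_nat a = Z.of_nat p * Z.of_nat d)%Z by rewrite Za Zd; ring.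
transitivity (24 * n * (Z.of_nat s * Z.of_nat a) + Z.of_nat d * (Z.of_nat a * Z.of_nat d * x))%Z; first by ring.
by rewrite Esa Hw'; ring.
Qed.

(** As [l / a^2 = d / a], the hypothesis says [l n / a^2 = x_N/24 + m] for [n = x_N/24 + m']. *)
Lemma cf_atE (cf : Z -> C) m m' : ((x + 24 * m) * Z.of_nat a = (x + 24 * m') * Z.of_nat d)%Z ->
  cf_at N r cf l a m' = cf m.
Proof.
move=> E; rewrite /cf_at EZ; cbv zeta; rewrite Z.pow_2_r.
have -> : (Z.of_nat a * Z.of_nat d * (x + 24 * m') - Z.of_nat a * Z.of_nat a * x = m * (24 * (Z.of_nat a * Z.of_nat a)))%Z.
  transitivity (Z.of_nat a * ((x + 24 * m') * Z.of_nat d) - Z.of_nat a * Z.of_nat a * x)%Z; first by ring.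
  by rewrite -E; ring.
have a1 : (0 < Z.of_nat a)%Z by have := a0; lia.
by rewrite Z_mod_mult Z.eqb_refl Z_div_mult //; nia.
Qed.

Lemma cf_at0 (cf : Z -> C) m' : (forall m, ((x + 24 * m) * Z.of_nat a <> (x + 24 * m') * Z.of_nat d)%Z) ->
  cf_at N r cf l a m' = RtoC 0%R.
Proof.
move=> H; rewrite /cf_at EZ; cbv zeta; rewrite Z.pow_2_r.
have a1 : (0 < Z.of_nat a)%Z by have := a0; lia.
case: Z.eqb_spec => E; last by [].
have n0 : (24 * (Z.of_nat a * Z.of_nat a) <> 0)%Z by nia.
have [q Q] := proj1 (Z.mod_divide _ _ n0) E.
exfalso; apply: (H q); apply: (Z.mul_reg_l _ _ (Z.of_nat a)); first by lia.
by lia.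
Qed.

Lemma Im_affine (b : nat) tau :
  Im ((RtoC (INR a) * tau + RtoC (INR b)) / RtoC (INR d))%C = (INR a * Im tau / INR d)%R.
Proof.
rewrite /Cdiv -RtoC_inv; last exact: dR.
by case: tau => u v; rewrite /Im /Cmult /Cplus /RtoC /=; field; exact: dR.
Qed.

Lemma hecke_term (f : C -> C) tau b : gcdn (gcdn a b) d = 1 ->
  (let '(x, y, z) := xyz (Z.of_nat N) (Z.of_nat a) (Z.of_nat b) (Z.of_nat d) in
   Cinv (chi N r (- Z.of_nat N * Z.of_nat b + Z.of_nat a * x)%Z z (- Z.of_nat N * Z.of_nat d)%Z y 1%Z) *
   Cinv (chi N r (Z.of_nat a * y)%Z (Z.of_nat b * y - Z.of_nat d * z)%Z (Z.of_nat N) x 1%Z) *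
   f ((RtoC (IZR (Z.of_nat a)) * tau + RtoC (IZR (Z.of_nat b))) / RtoC (IZR (Z.of_nat d))))%C
  = (RtoC (IZR (kron (Z.of_nat a) (varpi N r))) *
     (hterm b * f ((RtoC (INR a) * tau + RtoC (INR b)) / RtoC (INR d))))%C.
Proof.
move=> c1; have := xyzP N0 a0 d0 caN c1; case: (xyz _ _ _ _) => [[x1 y1] z1] E.
have c1' : gcdn (gcdn a b) (l %/ a) = 1 by rewrite -Ed.
have CP := @chi_pair N r K l a b N0 HK Hl al caN c1' x1 y1 z1.
rewrite -Ed -Eg in CP; rewrite (CP E) /hterm.
rewrite (INR_IZR_INZ a) (INR_IZR_INZ b) (INR_IZR_INZ d); ring.
Qed.

Lemma hecke_zs f cf Y tau : qexp N r f cf Y -> (Y < INR a * Im tau / INR d)%R ->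
  zs (fun m => cf_at N r cf l a m * sumC (iota 0 d) (fun b => if gcdn (gcdn a b) d == 1 then
        RtoC (powerRZ (IZR (kron (- Z.of_nat N * Z.of_nat b)%Z g)) K) *
        eR (INR b * INR d * (rho m / INR l - IZR x / 24)) * psi N r K l a b else RtoC 0%R)
        * e (RtoC (rho m) * tau))%C
     (sumC (iota 0 d) (fun b => if gcdn (gcdn a b) d == 1 then
        hterm b * f ((RtoC (INR a) * tau + RtoC (INR b)) / RtoC (INR d)) else RtoC 0%R))%C.
Proof.
move=> Hq Ht.
(* [U] is indexed by the exponents of [f], the target by those of the Hecke image. Terms of [U]
   whose exponent leaves x_N/24 + Z vanish by [Hb_sum0]; the others are matched by [zs_reindex]. *)
pose U m := (cf m * e (RtoC (rho m * INR a / INR d)%R * tau) * sumC (iota 0 d) (Hb (rho m)))%C.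
apply: (@zs_reindex p s x U _ _ p0 s0 cps).
- move=> m m' E; cbv beta.
  have E' : ((x + 24 * m) * Z.of_nat a = (x + 24 * m') * Z.of_nat d)%Z by rewrite Za Zd !Z.mul_assoc E.
  have Er : (rho m' = rho m * INR a / INR d)%R.
    apply: (Rmult_eq_reg_r (24 * INR d)); last by apply: Rmult_integral_contrapositive; split; [lra|exact: dR].
    have := f_equal IZR E'; rewrite !(plus_IZR, mult_IZR) -!INR_IZR_INZ => Er.
    by transitivity ((IZR x + 24 * IZR m) * INR a)%R; [rewrite Er; field|field; exact: dR].
  rewrite (cf_atE cf E') (@sumC_ext _ _ (Hb (rho m))); last first.
    move=> b _; rewrite /Hb; case: eqP => c1; last by [].
    rewrite /hterm (_ : (INR b * INR d * (rho m' / INR l - IZR x / 24) = - (INR b * INR d * IZR x / 24) + rho m * INR b / INR d)%R).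
      by rewrite eR_add; ring.
    by rewrite Er Rl; field; split; [exact: dR|exact: aR].
  by rewrite Er /U; ring.
- move=> m H; rewrite /U Hb_sum0 ?Cmult_0_r // => m' E; apply: (H m').
  apply: (Z.mul_reg_r _ _ (Z.of_nat g)); first by have := g0; lia.
  by rewrite -!Z.mul_assoc -Za -Zd.
- move=> m' H; rewrite cf_at0 ?Cmult_0_l // => m E; apply: (H m).
  apply: (Z.mul_reg_r _ _ (Z.of_nat g)); first by have := g0; lia.
  by rewrite -!Z.mul_assoc -Za -Zd.
apply: (@zs_ext (fun m => sumC (iota 0 d) (fun b => (if gcdn (gcdn a b) d == 1 then hterm b else RtoC 0%R) *
   (cf m * e (RtoC (rho m) * ((RtoC (INR a) * tau + RtoC (INR b)) / RtoC (INR d))))))%C).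
  move=> m; rewrite /U -sumC_scal; apply: sumC_ext => b _; rewrite e_frac; last exact: dR.
  by rewrite /Hb; case: eqP => _; ring.
rewrite (@sumC_ext _ _ (fun b => (if gcdn (gcdn a b) d == 1 then hterm b else RtoC 0%R) * f ((RtoC (INR a) * tau + RtoC (INR b)) / RtoC (INR d)))%C); last first.
  by move=> b _; case: eqP => _ //; rewrite Cmult_0_l.
apply: (@zs_sumC (iota 0 d) (fun b m => (if gcdn (gcdn a b) d == 1 then hterm b else RtoC 0%R) *
   (cf m * e (RtoC (rho m) * ((RtoC (INR a) * tau + RtoC (INR b)) / RtoC (INR d)))))%C).
move=> b _; have Ht' : (Y < Im ((RtoC (INR a) * tau + RtoC (INR b)) / RtoC (INR d))%C)%R by rewrite Im_affine.
exact: (@zs_scal (if gcdn (gcdn a b) d == 1 then hterm b else RtoC 0%R) _ _ (qexp_zs Hq Ht')).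
Qed.
End HeckeA.

(** The imaginary part of (a tau + b)/d is (a/d) Im tau, at least Im tau / l, whence the height
    [l |Y|]; the absolute value covers negative [Y]. *)
Lemma hecke_qexp N r K l f cf Y : 0 < N -> ((K - sumr N r) mod 4 = 0)%Z -> in_Lr N r l ->
  qexp N r f cf Y -> qexp N r (hecke N r K l f) (hecke_coeff N r K l cf) (INR l * Rabs Y)%R.
Proof.
move=> N0 HK Hl Hq; apply: zs_qexp => tau Ht.
have l0 : 0 < l by case: Hl.
rewrite /hecke; cbv zeta.
set sq := [seq a <- divisors l | coprime a N].
pose kr (a : nat) := (RtoC (IZR (kron (Z.of_nat a) (varpi N r))) * RtoC (Rpower (INR a) (IZR K / 2)))%C.
pose V (a : nat) (m : Z) := (cf_at N r cf l a m * sumC (iota 0 (l %/ a)) (fun b => if gcdn (gcdn a b) (l %/ a) == 1 then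
        RtoC (powerRZ (IZR (kron (- Z.of_nat N * Z.of_nat b)%Z (gcdn a (l %/ a)))) K) *
        eR (INR b * INR (l %/ a) * ((IZR (xN N r) / 24 + IZR m) / INR l - IZR (xN N r) / 24)) * psi N r K l a b else RtoC 0%R)
        * e (RtoC (IZR (xN N r) / 24 + IZR m)%R * tau))%C.
apply: (@zs_ext (fun m => RtoC (Rpower (INR l) (- (IZR K / 2) / 2)) * sumC sq (fun a => kr a * V a m))%C).
  move=> m; rewrite /hecke_coeff; cbv zeta; rewrite -/sq -[in RHS]Cmult_assoc; congr (_ * _)%C.
  rewrite [RHS]Cmult_comm -sumC_scal; apply: sumC_ext => a _.
  by rewrite sumC_filter /V /kr; ring.
apply: (@zs_scal _ (fun m => sumC sq (fun a => kr a * V a m)%C)).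
apply: (@zs_sumC sq (fun a m => kr a * V a m)%C) => a; rewrite mem_filter => /andP[caN ad].
have al : a %| l by rewrite dvdn_divisors.
have a0 : 0 < a := dvdn_gt0 l0 al.
rewrite /V; have [d Ed] : exists d, d = l %/ a by exists (l %/ a).
rewrite -Ed; have [g Eg] : exists g, g = gcdn a d by exists (gcdn a d).
rewrite -Eg.
have El : l = a * d by rewrite Ed mulnC divnK.
have d0 : 0 < d by move: l0; rewrite El muln_gt0 => /andP[].
have g0 : 0 < g by rewrite Eg gcdn_gt0 a0.
have [p Ea] : exists p, a = p * g by exists (a %/ g); rewrite divnK // Eg dvdn_gcdl.
have [s Es] : exists s, d = s * g by exists (d %/ g); rewrite divnK // Eg dvdn_gcdr.
have cps : coprime p s by rewrite /coprime -(eqn_pmul2r g0) mul1n muln_gcdl -Ea -Es -Eg.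
have Ht' : (Y < INR a * Im tau / INR d)%R.
  have A1 : (1 <= INR a)%R by apply: (le_INR 1); apply/leP.
  have D1 : (0 < INR d)%R by apply: lt_0_INR; apply/leP.
  have Rl : INR l = (INR a * INR d)%R by rewrite El mult_INR.
  rewrite Rl in Ht.
  have Y0 := Rabs_pos Y; have Y1 := Rle_abs Y.
  have h1 : (Y * INR d <= Rabs Y * INR d)%R by apply: Rmult_le_compat_r; lra.
  have h2 : (Rabs Y * INR d * 1 <= Rabs Y * INR d * (INR a * INR a))%R.
    by apply: Rmult_le_compat_l; [apply: Rmult_le_pos; lra|nra].
  have h3 : (INR a * (INR a * INR d * Rabs Y) < INR a * Im tau)%R by apply: Rmult_lt_compat_l; lra.
  apply: (Rmult_lt_reg_r (INR d)) => //.
  by rewrite (_ : (INR a * Im tau / INR d * INR d = INR a * Im tau)%R); [lra|field; lra].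
rewrite sumC_filter (@sumC_ext _ _ (fun b => RtoC (IZR (kron (Z.of_nat a) (varpi N r))) * (if gcdn (gcdn a b) d == 1 then
        hterm N r K l a d g b * f ((RtoC (INR a) * tau + RtoC (INR b)) / RtoC (INR d)) else RtoC 0%R))%C); last first.
  move=> b _; case: eqP => c1; last by rewrite Cmult_0_r.
  by eapply hecke_term; eassumption.
rewrite sumC_scal Cmult_assoc (Cmult_comm (RtoC (Rpower _ _))).
apply: (@zs_scal (kr a)).
by eapply hecke_zs; eassumption.
Qed.

Lemma qexp_mono N r g c (Y Y' : R) : (Y <= Y')%R -> qexp N r g c Y -> qexp N r g c Y'.
Proof.
by move=> YY [M [Hz Hs]]; exists M; split=> // tau Ht; apply: Hs; lra.
Qed.

Lemma hecke_expansion (N : nat) (r : nat -> Z) (K : Z) (f : C -> C) (l : nat) :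
  (0 < N)%nat ->
  ((K - sumr N r) mod 4 = 0)%Z ->
  merom_modform N r K f ->
  in_Lr N r l ->
  (exists Y0 : R, (0 <= Y0)%R /\ exists cf cT : Z -> C,
      qexp N r f cf Y0 /\ qexp N r (hecke N r K l f) cT Y0) /\
  (forall (Y Y' : R) (cf cf' : Z -> C),
      qexp N r f cf Y -> qexp N r f cf' Y' -> cf = cf') /\
  (forall (Y Y' : R) (cT cT' : Z -> C),
      qexp N r (hecke N r K l f) cT Y -> qexp N r (hecke N r K l f) cT' Y' -> cT = cT') /\
  (forall (Y Y' : R) (cf cT : Z -> C),
      qexp N r f cf Y -> qexp N r (hecke N r K l f) cT Y' ->
      forall m : Z, cT m = hecke_coeff N r K l cf m).
Proof.
move=> N0 HK Hf Hl; split; [|split; [|split]].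
- have [Y [cf Hq]] := f_qexp_exists Hf.
  exists (Rmax (Rabs Y) (INR l * Rabs Y))%R; split; first exact: Rle_trans (Rabs_pos Y) (Rmax_l _ _).
  exists cf, (hecke_coeff N r K l cf); split.
    by apply: qexp_mono Hq; apply: Rle_trans (Rle_abs Y) (Rmax_l _ _).
  by apply: qexp_mono (hecke_qexp N0 HK Hl Hq); exact: Rmax_r.
- by move=> Y Y' c c' H H'; exact: qexp_unique H H'.
- by move=> Y Y' c c' H H'; exact: qexp_unique H H'.
- by move=> Y Y' cf cT Hq HT m; rewrite (qexp_unique HT (hecke_qexp N0 HK Hl Hq)).
Qed.

End HeckeExpansion.

Require Import Defs.
From Stdlib Require Import Reals ZArith.
From Coquelicot Require Import Coquelicot.
From mathcomp Require Import ssreflect ssrbool ssrnat.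

Theorem theorem9p15 (N : nat) (r : nat -> Z) (K : Z) (f : C -> C) (l : nat) :
  (0 < N)%nat ->
  ((K - sumr N r) mod 4 = 0)%Z ->
  merom_modform N r K f ->
  in_Lr N r l ->
  (exists Y0 : R, (0 <= Y0)%R /\ exists cf cT : Z -> C,
      qexp N r f cf Y0 /\ qexp N r (hecke N r K l f) cT Y0) /\
  (forall (Y Y' : R) (cf cf' : Z -> C),
      qexp N r f cf Y -> qexp N r f cf' Y' -> cf = cf') /\
  (forall (Y Y' : R) (cT cT' : Z -> C),
      qexp N r (hecke N r K l f) cT Y -> qexp N r (hecke N r K l f) cT' Y' -> cT = cT') /\
  (forall (Y Y' : R) (cf cT : Z -> C),
      qexp N r f cf Y -> qexp N r (hecke N r K l f) cT Y' ->
      forall m : Z, cT m = hecke_coeff N r K l cf m).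
Proof. exact: HeckeExpansion.hecke_expansion. Qed.
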